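(* The active spanning trees $\alpha(\vec G)$ of ordered digraphs satisfy the following inductive definition. Let $\vec G$ be an ordered digraph on edge set $E$, with underlying graph $G$ and $\omega=\max(E)$. If $E=\emptyset$ then $\alpha(\vec G)=\emptyset$. (Isthmus/loop case) If $\omega$ is an isthmus of $G$ then $\alpha(\vec G)=\alpha(-_\omega\vec G)=\alpha(\vec G/\omega)\cup\{\omega\}$. If $\omega$ is a loop of $G$ then $\alpha(\vec G)=\alpha(-_\omega\vec G)=\alpha(\vec G\backslash\omega)$. If $\omega$ is neither an isthmus nor a loop of $G$, define a minor $\vec G_0\in\{\vec G/\omega,\vec G\backslash\omega\}$ as follows. (Choice by activity comparison) If $\vec G/\omega$ and $\vec G\backslash\omega$ do not have the same active partition, then $\vec G_0$ is the unique minor within $\{\vec G/\omega,\vec G\backslash\omega\}$ whose active partition is obtained by removing $\omega$ from the active partition of $\vec G$ (this is well defined). (Choice by full optimality) If $\vec G/\omega$ and $\vec G\backslash\omega$ have the same active partition, let $\vec G_\omega$ be the active minor of $\vec G$ containing $\omega$, with edge set $E_\omega$ and underlying graph $G_\omega$. Let $T'=\alpha(\vec G_\omega\backslash\omega)=\alpha(\vec G\backslash\omega)\cap E_\omega$, $C=C_{G_\omega}(T';\omega)$ and $e=\min(C)$; if $e$ and $\omega$ have opposite directions in $C$ then $\vec G_0=\vec G\backslash\omega$; if they have the same directions in $C$ then $\vec G_0=\vec G/\omega$. Or equivalently: let $T''=\alpha(\vec G_\omega/\omega)=\alpha(\vec G/\omega)\cap E_\omega$, $D=C^*_{G_\omega}(T''\cup\{\omega\};\omega)$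 and $e=\min(D)$; if $e$ and $\omega$ have opposite directions in $D$ then $\vec G_0=\vec G/\omega$; if they have the same directions in $D$ then $\vec G_0=\vec G\backslash\omega$. (Assignment) If $\vec G_0=\vec G\backslash\omega$ then $\alpha(\vec G)=\alpha(\vec G\backslash\omega)$ and $\alpha(-_\omega\vec G)=\alpha(\vec G/\omega)\cup\{\omega\}$. If $\vec G_0=\vec G/\omega$ then $\alpha(\vec G)=\alpha(\vec G/\omega)\cup\{\omega\}$ and $\alpha(-_\omega\vec G)=\alpha(\vec G\backslash\omega)$.
   Context: Graphs are finite, may have loops and multiple edges, and are connected unless they arise as minors (isolated vertices are ignored, and for a disconnected graph ''spanning tree'' means maximal spanning forest). For $F\subseteq E$, $G(F)$ is the restriction of $G$ to $F$ (deletion of $E\setminus F$) and $G/F$ is the contraction of $F$; $G\backslash\omega$, $G/\omega$ are deletion and contraction of the edge $\omega$; similarly for digraphs. Cycles and cocycles (inclusion-minimal non-empty edge cuts) are edge subsets. Minors inherit the linear order. $-_A\vec G$ is obtained by reversing the edges in $A$; $-_\omega\vec G=-_{\{\omega\}}\vec G$. A cycle is directed if its edges are consistently oriented along it; a cocycle is directed if all its edges go from one side of the cut to the other. $\subset$ is strict inclusion, $\uplus$ disjoint union. Let $\vec G$ be an ordered digraph; its dual-active edges $a_1<\cdots<a_\iota$ are the smallest edges of directed cocycles, its active edges $a'_1<\cdots<a'_\varepsilon$ the smallest edges of directed cycles. Its active filtration is $\emptyset=F'_\varepsilon\subset\cdots\subset F'_0=F_c=F_0\subset\cdots\subset F_\iota=E$,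 where $F_c$ is the union of all directed cycles, $F_k=E\setminus\bigcup\{D\text{ directed cocycle}:\min(D)\ge a_{k+1}\}$ for $0\le k\le\iota-1$, $F'_k=\bigcup\{C\text{ directed cycle}:\min(C)\ge a'_{k+1}\}$ for $0\le k\le\varepsilon-1$. Its active partition is the partition of $E$ into the parts $F_k\setminus F_{k-1}$ ($1\le k\le\iota$) and $F'_{k-1}\setminus F'_k$ ($1\le k\le\varepsilon$), always considered as given together with the cyclic flat $F_c$ (so equality of active partitions includes equality of cyclic flats). Its active minors are $\vec G(F_k)/F_{k-1}$ ($1\le k\le\iota$) and $\vec G(F'_{k-1})/F'_k$ ($1\le k\le\varepsilon$); their edge sets are the parts of the active partition. Removing $\omega$ from an active partition means removing it from its part (and from the cyclic flat if it belongs to it). $\vec G$ is bipolar w.r.t. $p$ if every edge is in a directed cocycle and every directed cocycle contains $p$; cyclic-bipolar w.r.t. $p$ if every edge is in a directed cycle and every directed cycle contains $p$. For a spanning tree $T$, $C^*_G(T;b)$ ($b\in T$) is the unique cocycle contained in $(E\setminus T)\cup\{b\}$ and $C_G(T;e)$ ($e\notin T$) the unique cycle contained in $T\cup\{e\}$. Two edges of a cycle have the same (opposite) directions in it if they are oriented the same way (opposite ways) along it; two edges of a cocycle have the same (opposite) directions in it if they cross the cut in the same (opposite) way. Active spanning tree. If $\vec G$ is bipolar w.r.t. $p=\min(E)$, $\alpha(\vec G)$ is the unique spanning tree $T$ (existence and uniqueness is a known theorem) such that every $b\in T\setminus\{p\}$ and $\min C^*_G(T;b)$ have opposite directions in $C^*_G(T;b)$,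 and every $e\in E\setminus T$ and $\min C_G(T;e)$ have opposite directions in $C_G(T;e)$. If $\vec G$ is cyclic-bipolar w.r.t. $p=\min(E)$, the definition is the same with ''every $b\in T$'' and ''every $e\in(E\setminus T)\setminus\{p\}$''. In general, with the active filtration of $\vec G$, $\alpha(\vec G)=\biguplus_{1\le k\le\iota}\alpha(\vec G(F_k)/F_{k-1})\uplus\biguplus_{1\le k\le\varepsilon}\alpha(\vec G(F'_{k-1})/F'_k)$ (these minors are bipolar, resp. cyclic-bipolar, w.r.t. their smallest edge). *)

(* Defs.v *)
From mathcomp Require Import all_boot all_order.

Set Implicit Arguments.
Unset Strict Implicit.
Unset Printing Implicit Defensive.

Import Order.TTheory.

(* The edge set is a subset of a fixed finite linear order [E], so that all
   minors live over the same [V] and [E] and inherit the linear order. Vertices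
   of [V] incident with no edge of [edges G] are isolated and play no role; the
   values of [tail] and [head] outside [edges G] play no role either. The
   underlying graph of [G] is [G] itself, used through notions that do not
   depend on the orientation. *)
Record digraph (disp : Order.disp_t) (V : finType) (E : finOrderType disp) :=
  Digraph { edges : {set E}; tail : E -> V; head : E -> V }.

Section OrderedSets.
Context {disp : Order.disp_t} {E : finOrderType disp}.
Implicit Types (A : {set E}) (x : E).

Definition is_min A x : bool := (x \in A) && [forall y in A, (x <= y)%O].
Definition is_max A x : bool := (x \in A) && [forall y in A, (y <= x)%O].

End OrderedSets.

Section Digraphs.
Context {disp : Order.disp_t} {V : finType} {E : finOrderType disp}.
Implicit Types (G H : digraph V E) (A B C D F T : {set E}) (b e f p w : E).

Definition adjacent G F : rel V := fun u v =>
  [exists e in edges G :&: F,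
     ((tail G e == u) && (head G e == v)) ||
     ((tail G e == v) && (head G e == u))].

(* Connectedness up to isolated vertices. *)
Definition connected_digraph G : bool :=
  [forall e in edges G, forall f in edges G,
     connect (adjacent G [set: E]) (tail G e) (tail G f)].

Definition restrict G F : digraph V E :=
  Digraph (edges G :&: F) (tail G) (head G).

Definition delete G w : digraph V E :=
  Digraph (edges G :\ w) (tail G) (head G).

(* Each connected component of [G(F)] is contracted to a representative vertex;
   its other vertices become isolated. *)
Definition contract G F : digraph V E :=
  Digraph (edges G :\: F)
    (fun e => root (adjacent G F) (tail G e))
    (fun e => root (adjacent G F) (head G e)).

Definition reorient G A : digraph V E :=
  Digraph (edges G)
    (fun e => if e \in A then head G e else tail G e)
    (fun e => if e \in A then tail G e else head G e).

(* A step [(e, true)] traverses [e] from its tail to its head, and [(e, false)]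
   traverses it from its head to its tail. *)
Definition step_src G (a : E * bool) : V :=
  if a.2 then tail G a.1 else head G a.1.
Definition step_dst G (a : E * bool) : V :=
  if a.2 then head G a.1 else tail G a.1.

Definition simple_closed_walk G (s : seq (E * bool)) : bool :=
  [&& s != [::],
      all (fun a => a.1 \in edges G) s,
      uniq [seq a.1 | a <- s],
      uniq [seq step_src G a | a <- s] &
      cycle (fun a a' => step_dst G a == step_src G a') s].

(* Bounding the length by [#|E|] is harmless, as the edges of the sequence are
   distinct. *)
Definition traversal G C (s : #|E|.-bseq (E * bool)) : bool :=
  simple_closed_walk G s && (C == [set e in [seq a.1 | a <- s]]).

Definition graph_cycle G C : bool := [exists s, traversal G C s].

Definition directed_cycle G C : bool :=
  [exists s, traversal G C s && all (fun a => a.2) s].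

Definition same_in_cycle G C e f : bool :=
  [exists s, traversal G C s &&
    [exists d : bool, ((e, d) \in val s) && ((f, d) \in val s)]].

Definition opposite_in_cycle G C e f : bool :=
  [exists s, traversal G C s &&
    [exists d : bool, ((e, d) \in val s) && ((f, ~~ d) \in val s)]].

Definition cut G (S : {set V}) : {set E} :=
  [set e in edges G | (tail G e \in S) != (head G e \in S)].

Definition graph_cocycle G D : bool :=
  minset (fun A => (A != set0) && [exists S, A == cut G S]) D.

Definition directed_cocycle G D : bool :=
  graph_cocycle G D &&
  [exists S, (D == cut G S) && [forall e in D, tail G e \in S]].

Definition same_in_cocycle G D e f : bool :=
  [&& e \in D, f \in D &
   [exists S, (D == cut G S) && ((tail G e \in S) == (tail G f \in S))]].

Definition opposite_in_cocycle G D e f : bool :=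
  [&& e \in D, f \in D &
   [exists S, (D == cut G S) && ((tail G e \in S) != (tail G f \in S))]].

Definition isthmus G w : bool := graph_cocycle G [set w].
Definition loop G w : bool := graph_cycle G [set w].

Definition forest G T : bool :=
  (T \subset edges G) && [forall C, graph_cycle G C ==> ~~ (C \subset T)].

Definition spanning_tree G T : bool := maxset (forest G) T.

(* The value [set0] is not meaningful: it is never taken when [T] is a spanning
   tree and [b \in T] (resp. [e \notin T] is an edge). *)
Definition fund_cocycle G T b : {set E} :=
  odflt set0 [pick D | graph_cocycle G D && (D \subset b |: (edges G :\: T))].
Definition fund_cycle G T e : {set E} :=
  odflt set0 [pick C | graph_cycle G C && (C \subset e |: T)].

Definition dual_active G : seq E :=
  sort <=%O
    (enum [set a | [exists D, directed_cocycle G D && is_min D a]]).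
Definition active G : seq E :=
  sort <=%O
    (enum [set a | [exists C, directed_cycle G C && is_min C a]]).

Definition min_ge A (a : E) : bool := [exists m, is_min A m && (a <= m)%O].

Definition cyclic_flat G : {set E} := \bigcup_(C | directed_cycle G C) C.

(* [acyclic_filtration G k] is F_k and [cyclic_filtration G k] is F'_k; the
   active edges are indexed from 0 in [active G] and [dual_active G], so that
   [onth (dual_active G) k] is a_(k+1), which exists for k < iota. *)
Definition acyclic_filtration G (k : nat) : {set E} :=
  if onth (dual_active G) k is Some a
  then edges G :\: \bigcup_(D | directed_cocycle G D && min_ge D a) D
  else edges G.
Definition cyclic_filtration G (k : nat) : {set E} :=
  if onth (active G) k is Some a
  then \bigcup_(C | directed_cycle G C && min_ge C a) C
  else set0.

Definition active_partition G : {set {set E}} * {set E} :=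
  ([set acyclic_filtration G k.+1 :\: acyclic_filtration G k
     | k : 'I_(size (dual_active G))] :|:
   [set cyclic_filtration G k :\: cyclic_filtration G k.+1
     | k : 'I_(size (active G))],
   cyclic_flat G).

(* A part reduced to [w] disappears. *)
Definition remove_from_partition w (P : {set {set E}} * {set E}) :
    {set {set E}} * {set E} :=
  ([set A :\ w | A in P.1] :\ set0, P.2 :\ w).

Definition active_minors G : seq (digraph V E) :=
  [seq contract (restrict G (acyclic_filtration G k.+1))
                (acyclic_filtration G k)
     | k <- iota 0 (size (dual_active G))] ++
  [seq contract (restrict G (cyclic_filtration G k))
                (cyclic_filtration G k.+1)
     | k <- iota 0 (size (active G))].

(* The default [G] is not meaningful: the edge sets of the active minors
   partition [edges G]. *)
Definition active_minor_of G w : digraph V E :=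
  seq.head G [seq H <- active_minors G | w \in edges H].

Definition bipolar G p : bool :=
  [forall e in edges G, exists D, directed_cocycle G D && (e \in D)] &&
  [forall D, directed_cocycle G D ==> (p \in D)].

Definition cyclic_bipolar G p : bool :=
  [forall e in edges G, exists C, directed_cycle G C && (e \in C)] &&
  [forall C, directed_cycle G C ==> (p \in C)].

Definition optimal_inside G T B : bool :=
  [forall b in B, exists m,
     is_min (fund_cocycle G T b) m &&
     opposite_in_cocycle G (fund_cocycle G T b) b m].

Definition optimal_outside G T B : bool :=
  [forall e in B, exists m,
     is_min (fund_cycle G T e) m &&
     opposite_in_cycle G (fund_cycle G T e) e m].

Definition fully_optimal G T : bool :=
  spanning_tree G T &&
  [exists p, is_min (edges G) p &&
    ([&& bipolar G p, optimal_inside G T (T :\ p) &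
         optimal_outside G T (edges G :\: T)] ||
     [&& cyclic_bipolar G p, optimal_inside G T T &
         optimal_outside G T ((edges G :\: T) :\ p)])].

(* [alpha] for a digraph that is bipolar or cyclic-bipolar with respect to its
   smallest edge: the unique fully optimal spanning tree. *)
Definition alpha_bipolar G : {set E} :=
  odflt set0 [pick T | fully_optimal G T].

Definition alpha G : {set E} :=
  \bigcup_(H <- active_minors G) alpha_bipolar H.

End Digraphs.

Variant minor_kind := Contraction | Deletion.

Section Choice.
Context {disp : Order.disp_t} {V : finType} {E : finOrderType disp}.
Implicit Types (G : digraph V E) (w : E) (k : minor_kind).

Definition minor G w k : digraph V E :=
  match k with Contraction => contract G [set w] | Deletion => delete G w end.

(* In the next two definitions [G] is meant to be the active minor, containing
   [w], of the digraph under consideration. *)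
Definition full_optimality_choice G w k : Prop :=
  let C := fund_cycle G (alpha (delete G w)) w in
  exists2 e, is_min C e &
    match k with
    | Deletion => opposite_in_cycle G C e w
    | Contraction => same_in_cycle G C e w
    end.

Definition dual_full_optimality_choice G w k : Prop :=
  let D := fund_cocycle G (w |: alpha (contract G [set w])) w in
  exists2 e, is_min D e &
    match k with
    | Contraction => opposite_in_cocycle G D e w
    | Deletion => same_in_cocycle G D e w
    end.

Definition assignment G w k : Prop :=
  match k with
  | Deletion =>
      alpha G = alpha (delete G w) /\
      alpha (reorient G [set w]) = w |: alpha (contract G [set w])
  | Contraction =>
      alpha G = w |: alpha (contract G [set w]) /\
      alpha (reorient G [set w]) = alpha (delete G w)
  end.

End Choice.

(* Main.v *)
Require Import Defs.
From mathcomp Require Import all_boot all_order.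
From mathcomp Require Import all_algebra ring lra zify.
From mathcomp Require Import boolp.

(** The notions of the statement (directed cycles and cocycles, relative
    directions in fundamental cycles and cocycles, the active filtration) depend
    only on two orthogonal subspaces of the functions on the edges: the tensions
    (differences of vertex potentials) and the flows. An [opair] is such a pair
    of subspaces with its ground set. Exchanging the two subspaces is duality,
    which exchanges deletion with contraction and bipolar with cyclic-bipolar, so
    that half of the arguments come for free although graphs are not closed under
    duality. The only form of linear duality that is needed is the field
    [painting] of [wf]; in a digraph it says that the ends of an edge are either
    joined by a walk in a given edge set or separated by a cut avoiding that set.
    It implies the alternative between nonnegative covectors and nonnegative
    vectors ([nonneg_alternative]).

    Uniqueness of the fully optimal tree. Let T be fully optimal with respect to
    p, and let z be a nonzero covector that is nonnegative on T and vanishes at p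
    if p is in T. Then the first nonzero coordinate of z is negative
    ([optimal_lexneg]). Thus each fundamental cocycle of T is lexicographically
    largest among the covectors that compete with it. If T and T' are both fully
    optimal, the differences of their fundamental cocycles have negative first
    coordinate in both directions, hence are null, and T and T' agree element by
    element ([optimal_agree]). The same lemma shows that a fully optimal tree
    exists only in a bipolar or cyclic-bipolar digraph ([optimal_bip]).

    Existence and choice. Let w be the greatest edge. It is never the smallest
    element of a fundamental cycle or cocycle with at least two elements; so a
    fully optimal tree of the deletion of w satisfies in G all conditions but the
    one on the fundamental cycle of w, and that one holds in exactly one of the
    orientations G and -_w G. The same is true of a fully optimal tree of the
    contraction of w, with w added. By uniqueness, the two trees so obtained are
    not fully optimal for the same orientation ([optimal_both]). This gives the
    existence of fully optimal trees ([optimal_exists]), the equivalence of the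
    two criteria by full optimality, and the assignment in that case. When only
    one minor is bipolar, its tree is fully optimal for G, since otherwise G and
    -_w G would both be bipolar, and then both minors as well
    ([bip_reverse_minors]).

    The general case. The active filtration is encoded by an integer-valued
    function, a [leveling], whose level sets are the parts and whose order is the
    order of the filtration. Levelings are the functions whose level minors are
    bipolar or cyclic-bipolar with respect to the smallest element of the part;
    each pair has exactly one ([leveling_exists], [leveling_uniq]), and it carries
    the same information as the active partition with its cyclic flat
    ([active_partitionE], [level_partition_inj]). Deleting or contracting w
    affects the level minor of w only ([lminor_del], [lminor_con]); so the
    leveling of G remains a leveling of a minor exactly when the active minor of w
    remains bipolar, resp. cyclic-bipolar, in that minor. When one minor only
    inherits the active partition of G, the other one inherits that of -_w G
    ([leveling_exclusive]): if the same minor inherited both, then w would lie at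
    the same level in G and in -_w G, and both minors would inherit. *)

Set Implicit Arguments.
Unset Strict Implicit.
Unset Printing Implicit Defensive.

Import Order.TTheory GRing.Theory Num.Theory.
Local Open Scope ring_scope.

(** * Orthogonal pairs of subspaces and their minors *)
Section OrthogonalPairs.
Context {disp : Order.disp_t} {E : finOrderType disp}.
Implicit Types (A C D F S T : {set E}) (a b e f p w : E) (x y z : E -> rat).

(** Covectors (tensions) and vectors (flows) are functions on all of [E] of
    which only the values on the ground set matter, so that a pair and its minors
    live over the same type. *)
Record opair := OPair
  { ground : {set E}; covec : (E -> rat) -> Prop; vect : (E -> rat) -> Prop }.
Implicit Types M : opair.

(** Since membership depends only on the values on [S], two pairs with the same
    ground set and the same covectors are equal in the sense of Leibniz, and
    identities between minors can be used for rewriting. *)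
Record saturated_subspace S (X : (E -> rat) -> Prop) : Prop := SaturatedSubspace
  { sub_ext : forall x x', (forall e, e \in S -> x e = x' e) -> X x -> X x';
    sub0 : X (fun _ => 0);
    sub_lin : forall (s t : rat) x x', X x -> X x' ->
      X (fun e => s * x e + t * x' e) }.

(** [painting] is the colouring property of an orthogonal pair of matroids; it
    makes each subspace the full orthogonal complement of the other one. *)
Record wf M : Prop := Wf
  { covec_sub : saturated_subspace (ground M) (covec M);
    vect_sub : saturated_subspace (ground M) (vect M);
    orth : forall x y, covec M x -> vect M y ->
      \sum_(e in ground M) x e * y e = 0;
    painting : forall C w, w \in ground M -> w \notin C ->
      (exists x, [/\ covec M x, x w != 0 &
         forall e, e \in ground M -> e \in C -> x e = 0]) \/
      (exists y, [/\ vect M y, y w != 0 &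
         forall e, e \in ground M -> e \notin C -> e != w -> y e = 0]) }.

Definition dual M : opair := OPair (ground M) (vect M) (covec M).

Lemma dualK M : dual (dual M) = M.
Proof. by case: M. Qed.

Lemma wf_dual M : wf M -> wf (dual M).
Proof.
case=> cs vs o pt; split=> //=.
  by move=> x y Hx Hy; rewrite -[RHS](o y x) //; apply: eq_bigr => e _; rewrite mulrC.
move=> C w wM wC.
have wC' : w \notin ~: (w |: C) by rewrite !inE eqxx.
case: (pt _ _ wM wC') => [[x [Hx xw x0]]|[y [Hy yw y0]]]; [right|left].
  exists x; split=> // e eM eC ew; apply: x0 => //.
  by rewrite !inE (negPf eC) (negPf ew).
exists y; split=> // e eM eC; apply: y0 => //.
  by rewrite !inE eC orbT.
by apply: contraNneq wC => <-.
Qed.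

Lemma covec_scale M (s : rat) x : wf M -> covec M x -> covec M (fun e => s * x e).
Proof.
move=> wM Hx; apply: (sub_ext (covec_sub wM)) (sub_lin (covec_sub wM) s 0 Hx Hx).
by move=> e _; ring.
Qed.

Lemma covecN M x : wf M -> covec M x -> covec M (fun e => - x e).
Proof.
move=> wM Hx; apply: (sub_ext (covec_sub wM)) (covec_scale (-1) wM Hx).
by move=> e _; ring.
Qed.

Lemma covecD M x x' : wf M -> covec M x -> covec M x' -> covec M (fun e => x e + x' e).
Proof.
move=> wM Hx Hx'; apply: (sub_ext (covec_sub wM)) (sub_lin (covec_sub wM) 1 1 Hx Hx').
by move=> e _; ring.
Qed.

Lemma covecB M x x' : wf M -> covec M x -> covec M x' -> covec M (fun e => x e - x' e).
Proof.
move=> wM Hx Hx'; apply: (sub_ext (covec_sub wM)) (sub_lin (covec_sub wM) 1 (-1) Hx Hx').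
by move=> e _; ring.
Qed.

(** Let y be orthogonal to all covectors. Painting the support of y at one of
    its elements w cannot give a covector, which would meet y in w only; so it
    gives a vector inside the support of y, and subtracting a multiple of it makes
    the support smaller. *)
Lemma vectP M y : wf M ->
  vect M y <-> (forall x, covec M x -> \sum_(e in ground M) x e * y e = 0).
Proof.
move=> wM; split=> [Hy x Hx|]; first exact: orth.
have [n] := ubnP #|[set e in ground M | y e != 0]|.
elim: n y => // n IHn y le_n oy.
have [y0|] := eqVneq [set e in ground M | y e != 0] set0.
  apply: (sub_ext (vect_sub wM)) (sub0 (vect_sub wM)) => e eM.
  by move/setP/(_ e): y0; rewrite !inE eM /=; move/negbFE/eqP.
case/set0Pn=> w; rewrite inE => /andP[wM' yw].
have wC : w \notin [set e | y e != 0] :\ w by rewrite !inE eqxx.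
case: (painting wM wM' wC) => [[x [Hx xw x0]]|[y' [Hy' yw' y0']]].
  have := oy x Hx; rewrite (bigD1 w) //= big1 => [|e /andP[eM ew]].
    by move/eqP; rewrite addr0 mulf_eq0 (negPf xw) (negPf yw).
  have [->|ye] := eqVneq (y e) 0; first by rewrite mulr0.
  by rewrite x0 ?mul0r // !inE ew ye.
pose t := y w / y' w.
have Hz : vect M (fun e => y e - t * y' e).
  apply: IHn => [|x Hx].
    move: le_n; rewrite ltnS; apply: leq_trans; apply/proper_card/properP; split.
      apply/subsetP=> e; rewrite !inE => /andP[eM]; rewrite eM /=.
      apply: contraNneq => ye; case: (eqVneq e w) => [eqe|ew].
        by move: yw; rewrite -eqe ye eqxx.
      by rewrite ye y0' ?mulr0 ?subr0 // !inE ye eqxx ew.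
    exists w; first by rewrite inE wM'.
    by rewrite inE wM' /= /t mulfVK ?subrr ?eqxx.
  rewrite (eq_bigr (fun e => x e * y e - t * (x e * y' e))); last first.
    by move=> e _; ring.
  by rewrite big_split /= oy // add0r sumrN -mulr_sumr (orth wM) // mulr0 oppr0.
apply: (sub_ext (vect_sub wM)) (sub_lin (vect_sub wM) 1 t Hz Hy').
by move=> e _ /=; ring.
Qed.

(** By [vectP] the covectors determine the vectors. *)
Lemma wf_eq M M' : wf M -> wf M' -> ground M = ground M' ->
  (forall x, covec M x <-> covec M' x) -> M = M'.
Proof.
move=> wM wM' eqg eqc.
have eqv y : vect M y <-> vect M' y.
  rewrite !vectP //; split=> o x /eqc Hx; [rewrite -eqg|rewrite eqg]; exact: o.
case: M M' {wM wM'} eqg eqc eqv => [S X Y] [S' X' Y'] /= -> eqc eqv.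
by congr OPair; apply: funext => x; apply: propext.
Qed.

(** The functions that agree on [S'] with a member of [X] vanishing on [C]:
    covectors of a minor are covectors vanishing on the contracted elements, with
    the values on the deleted elements forgotten. *)
Definition lift_sub S' C (X : (E -> rat) -> Prop) S : (E -> rat) -> Prop :=
  fun x => exists x0, [/\ X x0, forall e, e \in S -> e \in C -> x0 e = 0 &
    forall e, e \in S' -> x0 e = x e].

Definition minor_ground M C D := ground M :\: (C :|: D).

(** Contraction of [C] and deletion of [D]. *)
Definition pair_minor M C D : opair :=
  OPair (minor_ground M C D)
    (lift_sub (minor_ground M C D) C (covec M) (ground M))
    (lift_sub (minor_ground M C D) D (vect M) (ground M)).

Lemma dual_minor M C D : dual (pair_minor M C D) = pair_minor (dual M) D C.
Proof. by rewrite /dual /pair_minor /minor_ground /= setUC. Qed.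

Lemma lift_subP S S' C X :
  saturated_subspace S X -> saturated_subspace S' (lift_sub S' C X S).
Proof.
move=> sX; split.
- move=> x x' eqx [x0 [H0 H1 H2]]; exists x0; split=> // e eS.
  by rewrite H2 // eqx.
- by exists (fun _ => 0); split=> //; apply: sub0 sX.
- move=> s t x x' [x0 [H0 H1 H2]] [x1 [H0' H1' H2']].
  exists (fun e => s * x0 e + t * x1 e); split; first exact: sub_lin sX _ _ _ _ _ _.
    by move=> e eS eC; rewrite H1 // H1' //; ring.
  by move=> e eS; rewrite H2 // H2'.
Qed.

Lemma wf_minor M C D : wf M -> [disjoint C & D] -> wf (pair_minor M C D).
Proof.
move=> wM dCD; split=> /=.
- exact: lift_subP (covec_sub wM).
- exact: lift_subP (vect_sub wM).
- move=> x y [x0 [X0 X1 X2]] [y0 [Y0 Y1 Y2]].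
  rewrite -[RHS](orth wM X0 Y0) [RHS](bigID (mem (minor_ground M C D))) /=.
  rewrite [X in _ = _ + X]big1 ?addr0 => [|e /andP[eM]].
    apply: eq_big => [e|e /[dup] eM' ?]; last by rewrite X2 ?Y2.
    by rewrite /minor_ground !inE; case: (e \in ground M); rewrite ?andbF.
  rewrite !inE eM andbT negbK => /orP[eC|eD].
    by rewrite X1 // mul0r.
  by rewrite Y1 // mulr0.
- move=> C1 w; rewrite !inE negb_or => /andP[/andP[wC wD] wM'] wC1.
  have wC' : w \notin (C :|: C1) :\: D by rewrite !inE (negPf wC) (negPf wC1) andbF.
  case: (painting wM wM' wC') => [[x [Hx xw x0]]|[y [Hy yw y0]]]; [left|right].
    exists x; split=> //.
      exists x; split=> // e eM eC; apply: x0 => //; rewrite !inE eC /= andbT.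
      by have := disjointFr dCD eC => ->.
    move=> e; rewrite !inE negb_or => /andP[/andP[eC eD] eM] eC1; apply: x0 => //.
    by rewrite !inE eC1 orbT eD.
  exists y; split=> //.
    exists y; split=> // e eM eD; apply: y0; rewrite ?inE ?eD //.
    by apply: contraNneq wD => <-.
  move=> e; rewrite !inE negb_or => /andP[/andP[eC eD] eM] eC1 ew; apply: y0 => //.
  by rewrite !inE (negPf eC) (negPf eC1) andbF.
Qed.

Definition del M w := pair_minor M set0 [set w].
Definition con M w := pair_minor M [set w] set0.

Lemma dual_del M w : dual (del M w) = con (dual M) w.
Proof. exact: dual_minor. Qed.

Lemma dual_con M w : dual (con M w) = del (dual M) w.
Proof. exact: dual_minor. Qed.

Lemma wf_del M w : wf M -> wf (del M w).
Proof. by move=> wM; apply: wf_minor wM _; rewrite -setI_eq0 set0I. Qed.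

Lemma wf_con M w : wf M -> wf (con M w).
Proof. by move=> wM; apply: wf_minor wM _; rewrite -setI_eq0 setI0. Qed.

Lemma ground_del M w : ground (del M w) = ground M :\ w.
Proof. by rewrite /= /minor_ground set0U. Qed.

Lemma ground_con M w : ground (con M w) = ground M :\ w.
Proof. by rewrite /= /minor_ground setU0. Qed.

Lemma in_del M w e : (e \in ground (del M w)) = (e != w) && (e \in ground M).
Proof. by rewrite ground_del !inE. Qed.

Lemma in_con M w e : (e \in ground (con M w)) = (e != w) && (e \in ground M).
Proof. by rewrite ground_con !inE. Qed.

Lemma covec_del M w x :
  covec (del M w) x <->
  exists x0, covec M x0 /\ forall e, e \in ground M -> e != w -> x0 e = x e.
Proof.
split=> [[x0 [H0 _ H2]]|[x0 [H0 H2]]]; exists x0; split=> //.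
- by move=> e eM ew; apply: H2; have := in_del M w e; rewrite /= ew eM.
- by move=> e; rewrite inE.
- by move=> e; have := in_del M w e => /= ->; case/andP=> *; apply: H2.
Qed.

Lemma covec_con M w x : w \in ground M ->
  covec (con M w) x <->
  exists x0, [/\ covec M x0, x0 w = 0 &
    forall e, e \in ground M -> e != w -> x0 e = x e].
Proof.
move=> wM; split=> [[x0 [H0 H1 H2]]|[x0 [H0 H1 H2]]]; exists x0; split=> //.
- by apply: H1; rewrite ?inE.
- by move=> e eM ew; apply: H2; have := in_con M w e; rewrite /= ew eM.
- by move=> e eM; rewrite inE => /eqP ->.
- by move=> e; have := in_con M w e => /= ->; case/andP=> *; apply: H2.
Qed.

Lemma vect_con M w y :
  vect (con M w) y <->
  exists y0, vect M y0 /\ forall e, e \in ground M -> e != w -> y0 e = y e.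
Proof. by have := @covec_del (dual M) w y; rewrite -dual_con. Qed.

Lemma vect_del M w y : w \in ground M ->
  vect (del M w) y <->
  exists y0, [/\ vect M y0, y0 w = 0 &
    forall e, e \in ground M -> e != w -> y0 e = y e].
Proof. by move=> wM; have := @covec_con (dual M) w y wM; rewrite -dual_del. Qed.

(** Tucker's alternative. By induction, each of the deletion and the contraction
    of another element e has a solution. If none of these is one for [M], there
    are a covector x and a vector y, both nonnegative except at e, where both are
    negative, and both positive at w: their scalar product is positive. *)
Lemma nonneg_alternative M w : wf M -> w \in ground M ->
  (exists x, [/\ covec M x, 0 < x w & forall e, e \in ground M -> 0 <= x e]) \/
  (exists y, [/\ vect M y, 0 < y w & forall e, e \in ground M -> 0 <= y e]).
Proof.
have [n] := ubnP #|ground M|.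
elim: n M => // n IHn M le_n wM wG.
have [G1|] := eqVneq (ground M :\ w) set0.
  have only e : e \in ground M -> e = w.
    move=> eM; apply/eqP; apply: contraT => ew.
    by have := in_set0 e; rewrite -G1 !inE ew eM.
  have w0 : w \notin set0 by rewrite inE.
  case: (painting wM wG w0) => [[x [Hx xw _]]|[y [Hy yw _]]]; [left|right].
    exists (fun e => x w * x e); split; first exact: covec_scale.
      by rewrite -expr2 exprn_even_gt0.
    by move=> e /only ->; rewrite -expr2 sqr_ge0.
  exists (fun e => y w * y e); split; first exact: (covec_scale _ (wf_dual wM)).
    by rewrite -expr2 exprn_even_gt0.
  by move=> e /only ->; rewrite -expr2 sqr_ge0.
case/set0Pn=> e0; rewrite !inE => /andP[e0w e0M].
have lt_card : (#|ground M :\ e0| < n)%N.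
  by move: le_n; rewrite (cardsD1 e0) e0M.
have wM0 : w \in ground M :\ e0 by rewrite !inE eq_sym e0w.
have := IHn (del M e0) _ (wf_del _ wM) _; rewrite ground_del => /(_ lt_card wM0).
have := IHn (con M e0) _ (wf_con _ wM) _; rewrite ground_con => /(_ lt_card wM0).
have we0 : w != e0 by rewrite eq_sym.
case=> [[x [/(covec_con _ e0M) [x0 [Hx xe eqx]] xw xge]]|[y' [Hy' yw' yge']]].
  move=> _; left; exists x0; split=> //; first by rewrite eqx.
  move=> e eM; have [->|ee0] := eqVneq e e0; first by rewrite xe.
  by rewrite eqx // xge // !inE ee0.
case=> [[x [Hx xw xge]]|[y [/(vect_del _ e0M) [y0 [Hy ye eqy]] yw yge]]]; last first.
  right; exists y0; split=> //; first by rewrite eqy.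
  move=> e eM; have [->|ee0] := eqVneq e e0; first by rewrite ye.
  by rewrite eqy // yge // !inE ee0.
case/covec_del: Hx => [x0 [Hx eqx]]; case/vect_con: Hy' => [y0 [Hy eqy]].
have [xe|xe] := lerP 0 (x0 e0).
  left; exists x0; split=> //; first by rewrite eqx.
  move=> e eM; have [->//|ee0] := eqVneq e e0.
  by rewrite eqx // xge // !inE ee0.
have [ye|ye] := lerP 0 (y0 e0).
  right; exists y0; split=> //; first by rewrite eqy.
  move=> e eM; have [->//|ee0] := eqVneq e e0.
  by rewrite eqy // yge' // !inE ee0.
have := orth wM Hx Hy.
rewrite (bigD1 e0) //= (bigD1 w) /= ?wG ?we0 // (eqx w) // (eqy w) //.
have : 0 <= \sum_(i | (i \in ground M) && (i != e0) && (i != w)) x0 i * y0 i.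
  apply: sumr_ge0 => e /andP[/andP[eM ee0] ew].
  by rewrite mulr_ge0 // ?eqx ?eqy ?xge ?yge' // !inE ee0.
have := mulr_gt0 xw yw'.
have : 0 < x0 e0 * y0 e0 by rewrite nmulr_rgt0.
lra.
Qed.
End OrthogonalPairs.

(** * Bipolar pairs under deletion, contraction and reversal *)
Section Bipolar.
Context {disp : Order.disp_t} {E : finOrderType disp}.
Implicit Types (A C D F S T Z : {set E}) (a b e f p w : E) (x y z : E -> rat).
Implicit Types M : opair (E := E).

Lemma in_minor M C D e :
  (e \in ground (pair_minor M C D)) = [&& e \notin C, e \notin D & e \in ground M].
Proof. by rewrite !inE negb_or andbA. Qed.

Lemma nonneg_painting M C D w : wf M -> [disjoint C & D] ->
    w \in ground M -> w \notin C -> w \notin D ->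
  (exists x, [/\ covec M x, 0 < x w,
     forall e, e \in ground M -> e \in C -> x e = 0 &
     forall e, e \in ground M -> e \notin C -> e \notin D -> 0 <= x e]) \/
  (exists y, [/\ vect M y, 0 < y w,
     forall e, e \in ground M -> e \in D -> y e = 0 &
     forall e, e \in ground M -> e \notin C -> e \notin D -> 0 <= y e]).
Proof.
move=> wM dCD wG wC wD.
have wG' : w \in ground (pair_minor M C D) by rewrite in_minor wC wD.
case: (nonneg_alternative (wf_minor wM dCD) wG') => [|] [x [[x0 [H0 H1 H2]] xw xge]];
  [left|right]; exists x0; split=> //.
- by rewrite H2.
- move=> e eM eC eD; have eG : e \in ground (pair_minor M C D) by rewrite in_minor eC eD.
  by rewrite H2 ?xge.
- by rewrite H2.
- move=> e eM eC eD; have eG : e \in ground (pair_minor M C D) by rewrite in_minor eC eD.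
  by rewrite H2 ?xge.
Qed.

Lemma covec_sum M A Z : wf M ->
  (forall e, e \in A -> exists x, [/\ covec M x, 0 < x e,
     forall f, f \in Z -> x f = 0 & forall f, f \in A -> 0 <= x f]) ->
  exists x, [/\ covec M x, forall f, f \in Z -> x f = 0 &
     forall f, f \in A -> 0 < x f].
Proof.
move=> wM H.
suff [x [Hx xZ xA xs]] : exists x, [/\ covec M x, forall f, f \in Z -> x f = 0,
    forall f, f \in A -> 0 <= x f & forall f, f \in enum A -> 0 < x f].
  by exists x; split=> // f fA; apply: xs; rewrite mem_enum.
have : {subset enum A <= A} by move=> f; rewrite mem_enum.
elim: (enum A) => [_|e s IHs sub].
  by exists (fun _ => 0); split=> //; apply: sub0 (covec_sub wM).
have [|x [Hx xZ xA xs]] := IHs.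
  by move=> f fs; apply: sub; rewrite inE fs orbT.
have [|x' [Hx' xe' xZ' xA']] := H e; first by apply: sub; rewrite mem_head.
exists (fun f => x f + x' f); split; first exact: covecD.
- by move=> f fZ; rewrite xZ // xZ' // addr0.
- by move=> f fA; rewrite addr_ge0 ?xA ?xA'.
- move=> f fes; have fA := sub f fes; move: fes; rewrite inE => /predU1P[->|fs].
    by rewrite ltr_wpDl // xA // sub ?mem_head.
  by rewrite ltr_pwDl ?xs // xA'.
Qed.

(** Adding up the multiples that suffice for each element of [D]. *)
Lemma dominate (D : {set E}) x u : (forall f, f \in D -> 0 < u f) ->
  exists K : rat, 0 <= K /\ forall f, f \in D -> 0 <= x f + K * u f.
Proof.
move=> uD; suff [K [K0 H]] : exists K : rat, 0 <= K /\
    forall f, f \in enum D -> 0 <= x f + K * u f.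
  by exists K; split=> // f fD; apply: H; rewrite mem_enum.
have : {subset enum D <= D} by move=> f; rewrite mem_enum.
elim: (enum D) => [_|e s IHs sub]; first by exists 0.
have [|K [K0 H]] := IHs; first by move=> f fs; apply: sub; rewrite inE fs orbT.
have ue := uD e (sub e (mem_head _ _)).
have t0 : 0 <= `|x e| / u e by rewrite divr_ge0 // ltW.
exists (K + `|x e| / u e); split; first by rewrite addr_ge0.
move=> f; rewrite inE => /predU1P[->|fs].
  rewrite mulrDl divfK ?gt_eqF // addrCA addr_ge0 //.
    by rewrite mulr_ge0 // ltW.
  by rewrite -lerBlDr sub0r lerNl -normrN ler_norm.
rewrite mulrDl addrA addr_ge0 ?H // mulr_ge0 // ltW // uD // sub // inE fs orbT //.
Qed.

Definition flip w x : E -> rat := fun e => if e == w then - x e else x e.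

Lemma flipK w : involutive (flip w).
Proof. by move=> x; apply: funext => e; rewrite /flip; case: eqP => // _; rewrite opprK. Qed.

Lemma flip_id w x e : e != w -> flip w x e = x e.
Proof. by rewrite /flip => /negPf ->. Qed.

Lemma flip_eq0 w x e : (flip w x e == 0) = (x e == 0).
Proof. by rewrite /flip (fun_if (fun t => t == 0)) oppr_eq0 if_same. Qed.

Definition reverse M w : opair :=
  OPair (ground M) (fun x => covec M (flip w x)) (fun y => vect M (flip w y)).

Lemma dual_reverse M w : dual (reverse M w) = reverse (dual M) w.
Proof. by []. Qed.

Lemma reverseK M w : reverse (reverse M w) w = M.
Proof.
case: M => S X Y; rewrite /reverse /=; congr OPair; apply: funext => x; congr (_ _);
exact: flipK.
Qed.

Lemma flip_sub S X w : saturated_subspace S X ->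
  saturated_subspace S (fun x => X (flip w x)).
Proof.
move=> sX; split.
- move=> x x' eqx; apply: (sub_ext sX) => e eS; rewrite /flip eqx //.
- by apply: (sub_ext sX) (sub0 sX) => e _; rewrite /flip oppr0 if_same.
- move=> s t x x' Hx Hx'; apply: (sub_ext sX) (sub_lin sX s t Hx Hx') => e _.
  by rewrite /flip; case: eqP => // _; ring.
Qed.

Lemma wf_reverse M w : wf M -> wf (reverse M w).
Proof.
move=> wM; split=> /=.
- exact: flip_sub (covec_sub wM).
- exact: flip_sub (vect_sub wM).
- move=> x y Hx Hy; rewrite -[RHS](orth wM Hx Hy); apply: eq_bigr => e _.
  by rewrite /flip; case: eqP => // _; ring.
- move=> C v vM vC; case: (painting wM vM vC) => [|] [x [Hx xv x0]]; [left|right];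
  exists (flip w x); rewrite ?flipK; split=> //.
  + by rewrite flip_eq0.
  + by move=> e eM eC; rewrite /flip x0 // oppr0 if_same.
  + by rewrite flip_eq0.
  + by move=> e eM eC ev; rewrite /flip x0 // oppr0 if_same.
Qed.

Lemma lift_sub_flip w S' C X S :
  lift_sub S' C (fun x => X (flip w x)) S = fun x => lift_sub S' C X S (flip w x).
Proof.
apply: funext => x; apply: propext; split=> [] [x0 [H0 H1 H2]]; exists (flip w x0);
  rewrite ?flipK; split=> // e eS.
- by move=> eC; rewrite /flip H1 // oppr0 if_same.
- by rewrite /flip H2.
- by move=> eC; rewrite /flip H1 // oppr0 if_same.
- by rewrite /flip (H2 e eS) /flip; case: eqP; rewrite ?opprK.
Qed.

Lemma reverse_minor M w C D : pair_minor (reverse M w) C D = reverse (pair_minor M C D) w.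
Proof. by rewrite /pair_minor /reverse /= !lift_sub_flip. Qed.

Lemma reverse_out M w : wf M -> w \notin ground M -> reverse M w = M.
Proof.
move=> wM wG; apply: wf_eq => //; first exact: wf_reverse.
have eqf x e : e \in ground M -> flip w x e = x e.
  by move=> eM; apply: flip_id; apply: contraNneq wG => <-.
move=> x; split=> /= Hx; apply: (sub_ext (covec_sub wM)) Hx => e eM; by rewrite eqf.
Qed.

Lemma del_reverse M w : wf M -> del (reverse M w) w = del M w.
Proof. by move=> wM; rewrite /del reverse_minor reverse_out // ?in_minor ?inE ?eqxx //; apply: wf_del. Qed.

Lemma con_reverse M w : wf M -> con (reverse M w) w = con M w.
Proof. by move=> wM; rewrite /con reverse_minor reverse_out // ?in_minor ?inE ?eqxx //; apply: wf_con. Qed.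

(** For the pair of a digraph: every edge is in a directed cocycle, and a flow
    is positive outside [p], which forces every directed cocycle to contain [p].
    So this is bipolarity, and the same for the dual pair is cyclic-bipolarity. *)
Definition bip M p : Prop :=
  [/\ is_min (ground M) p,
      exists x, covec M x /\ forall e, e \in ground M -> 0 < x e &
      exists y, vect M y /\ forall e, e \in ground M -> e != p -> 0 < y e].

(** Isthmuses; the loops are the coloops of the dual pair. *)
Definition coloop M w := exists x,
  [/\ covec M x, x w != 0 & forall e, e \in ground M -> e != w -> x e = 0].

Lemma is_min_in S p : is_min S p -> p \in S.
Proof. by case/andP. Qed.

Lemma is_minP S p e : is_min S p -> e \in S -> (p <= e)%O.
Proof. by case/andP=> _ /forallP/(_ e)/implyP. Qed.

Lemma is_maxP S p e : is_max S p -> e \in S -> (e <= p)%O.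
Proof. by case/andP=> _ /forallP/(_ e)/implyP. Qed.

Lemma is_min_uniq S p q : is_min S p -> is_min S q -> p = q.
Proof.
move=> mp mq; apply: le_anti; rewrite (is_minP mp) ?(is_minP mq) //; exact: is_min_in.
Qed.

Lemma is_minI S p : p \in S -> (forall e, e \in S -> (p <= e)%O) -> is_min S p.
Proof. by move=> pS H; rewrite /is_min pS; apply/forallP=> e; apply/implyP/H. Qed.

Lemma is_min_D1 S p w : is_max S w -> w != p -> is_min (S :\ w) p = is_min S p.
Proof.
move=> mw wp; apply/idP/idP=> mp.
  have := is_min_in mp; rewrite !inE => /andP[pw pS].
  apply: is_minI => // e eS; have [->|ew] := eqVneq e w; first exact: (is_maxP mw).
  by apply: (is_minP mp); rewrite !inE ew.
apply: is_minI; first by rewrite !inE eq_sym wp (is_min_in mp).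
by move=> e; rewrite !inE => /andP[_]; apply: is_minP.
Qed.

Lemma orth_nonneg M x y : wf M -> covec M x -> vect M y ->
  (forall e, e \in ground M -> 0 <= x e * y e) ->
  forall e, e \in ground M -> x e * y e = 0.
Proof.
move=> wM Hx Hy H e eM.
have := orth wM Hx Hy => /eqP; rewrite psumr_eq0 // => /allP/(_ e).
by rewrite mem_index_enum eM => /(_ isT) /eqP.
Qed.

Lemma bip_excl M p : wf M -> bip M p -> bip (dual M) p -> False.
Proof.
move=> wM [mp [x [Hx xp]] _] [_ [y [Hy yp]] _].
have pM := is_min_in mp.
have : x p * y p = 0.
  apply: orth_nonneg Hx Hy _ _ pM => // e eM.
  by rewrite mulr_ge0 // ltW ?xp ?yp.
by apply/eqP; rewrite mulf_neq0 // gt_eqF ?xp ?yp.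
Qed.

Lemma bip_noloop M p w : wf M -> bip M p -> w \in ground M ->
  w != p -> ~ coloop M w /\ ~ coloop (dual M) w.
Proof.
move=> wM [mp [x [Hx xp]] [y [Hy yp]]] wG wp; split=> [] [z [Hz zw z0]].
  have := orth wM Hz Hy; rewrite (bigD1 w) //= big1 => [|e /andP[eM ew]].
    by move/eqP; rewrite addr0 mulf_eq0 (negPf zw) gt_eqF ?yp.
  by rewrite z0 ?mul0r.
have := orth wM Hx Hz; rewrite (bigD1 w) //= big1 => [|e /andP[eM ew]].
  by move/eqP; rewrite addr0 mulf_eq0 (negPf zw) gt_eqF ?xp.
by rewrite z0 ?mulr0.
Qed.

Section MaximalElement.
Variables (M : opair (E := E)) (p w : E).
Hypotheses (wM : wf M) (mw : is_max (ground M) w) (wp : w != p).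

Let wG : w \in ground M. Proof. by case/andP: mw. Qed.

Lemma bip_delE : bip (del M w) p <->
  [/\ is_min (ground M) p,
      exists x, covec M x /\ forall e, e \in ground M -> e != w -> 0 < x e &
      exists y, [/\ vect M y, y w = 0 &
        forall e, e \in ground M -> e != w -> e != p -> 0 < y e]].
Proof.
split=> [[mp [x [/covec_del [x0 [Hx eqx]] xp]] [y [/(vect_del _ wG) [y0 [Hy yw eqy]] yp]]]
        |[mp [x [Hx xp]] [y [Hy yw yp]]]].
  split.
  - by rewrite -(is_min_D1 mw wp) -ground_del.
  - exists x0; split=> // e eM ew; rewrite eqx // xp // in_del ew //.
  - exists y0; split=> // e eM ew ep; rewrite eqy // yp // in_del ew //.
split.
- by rewrite ground_del is_min_D1.
- exists x; split; first by apply/covec_del; exists x.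
  by move=> e; rewrite in_del => /andP[ew eM]; apply: xp.
- exists y; split; first by apply/vect_del => //; exists y.
  by move=> e; rewrite in_del => /andP[ew eM]; apply: yp.
Qed.

Lemma bip_conE : bip (con M w) p <->
  [/\ is_min (ground M) p,
      exists x, [/\ covec M x, x w = 0 &
        forall e, e \in ground M -> e != w -> 0 < x e] &
      exists y, vect M y /\
        forall e, e \in ground M -> e != w -> e != p -> 0 < y e].
Proof.
split=> [[mp [x [/(covec_con _ wG) [x0 [Hx xw eqx]] xp]] [y [/vect_con [y0 [Hy eqy]] yp]]]
        |[mp [x [Hx xw xp]] [y [Hy yp]]]].
  split.
  - by rewrite -(is_min_D1 mw wp) -ground_con.
  - exists x0; split=> // e eM ew; rewrite eqx // xp // in_con ew //.
  - exists y0; split=> // e eM ew ep; rewrite eqy // yp // in_con ew //.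
split.
- by rewrite ground_con is_min_D1.
- exists x; split; first by apply/covec_con => //; exists x.
  by move=> e; rewrite in_con => /andP[ew eM]; apply: xp.
- exists y; split; first by apply/vect_con; exists y.
  by move=> e; rewrite in_con => /andP[ew eM]; apply: yp.
Qed.

(** If the contraction is not bipolar, the alternative yields a vector y' that is
    nonnegative and nonzero outside [w]. Being orthogonal to a positive
    covector, y' is negative at [w], so a positive combination of y and y' vanishes
    at [w] and shows that the deletion is bipolar. *)
Lemma bip_minor : bip M p -> bip (del M w) p \/ bip (con M w) p.
Proof.
case=> mp [x [Hx xp]] [y [Hy yp]].
rewrite bip_delE bip_conE.
pose A := ground M :\ w.
have dis : [disjoint [set w] & set0 : {set E}] by rewrite -setI_eq0 setI0.
have := @covec_sum M A [set w] wM.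
case: (pselect (forall e, e \in A -> exists x0, [/\ covec M x0, 0 < x0 e,
     forall f, f \in [set w] -> x0 f = 0 & forall f, f \in A -> 0 <= x0 f])).
  move=> H /(_ H) [x0 [Hx0 x0w x0p]]; right; split=> //; last first.
    by exists y; split=> // e eM _; apply: yp.
  exists x0; split=> //; first by rewrite x0w ?inE.
  by move=> e eM ew; rewrite x0p // !inE ew.
move=> H _; left; split=> //; first by exists x; split=> // e eM _; apply: xp.
have [y' [Hy' [e [eA ye]] yA]] : exists y', [/\ vect M y',
    exists e, e \in A /\ 0 < y' e & forall f, f \in A -> 0 <= y' f].
  apply: contra_notP H => H e /[dup] eA; rewrite !inE => /andP[ew eM].
  have ew1 : e \notin [set w] by rewrite inE.
  have e0 : e \notin set0 by rewrite inE.
  case: (nonneg_painting wM dis eM ew1 e0) => [[x0 [Hx0 xe x00 xge]]|[y' [Hy' ye _ yge]]].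
    exists x0; split=> //; first by move=> f; rewrite inE => /eqP ->; apply: x00; rewrite ?inE.
    by move=> f; rewrite !inE => /andP[fw fM]; apply: xge; rewrite ?inE.
  exfalso; apply: H; exists y'; split=> //; first by exists e.
  by move=> f; rewrite !inE => /andP[fw fM]; apply: yge; rewrite ?inE.
have yw' : y' w < 0.
  rewrite ltNge; apply/negP=> yw'; move: (eA); rewrite !inE => /andP[ew eM].
  have : x e * y' e = 0.
    apply: orth_nonneg Hx Hy' _ _ eM => // f fM; rewrite mulr_ge0 ?(ltW (xp _ fM)) //.
    by have [->//|fw] := eqVneq f w; rewrite yA // !inE fw.
  by apply/eqP; rewrite mulf_neq0 // gt_eqF ?xp.
(* the coefficients are positive and cancel the values at w *)
exists (fun f => (- y' w) * y f + y w * y' f); split.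
- exact: (sub_lin (vect_sub wM)).
- by ring.
- move=> f fM fw fp; rewrite ltr_pwDl //.
    by rewrite mulr_gt0 ?yp // oppr_gt0.
  by rewrite mulr_ge0 ?yA ?(ltW (yp _ wG wp)) // !inE fw.
Qed.

(** A positive covector of [M] and one of the reversed pair have opposite signs
    at [w], hence a positive combination of them vanishes at [w]; likewise for
    vectors. *)
Lemma bip_reverse_minors : bip M p -> bip (reverse M w) p ->
  bip (del M w) p /\ bip (con M w) p.
Proof.
case=> mp [x [Hx xp]] [y [Hy yp]] [_ [x' [Hx' xp']] [y' [Hy' yp']]].
have xw := xp w wG; have xw' := xp' w wG; have yw := yp w wG wp; have yw' := yp' w wG wp.
rewrite bip_delE bip_conE; split; split=> //.
- by exists x; split=> // e eM _; apply: xp.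
- exists (fun e => y' w * y e + y w * flip w y' e); split.
  + exact: (sub_lin (vect_sub wM)).
  + by rewrite /flip eqxx; ring.
  + by move=> e eM ew ep; rewrite flip_id // addr_gt0 // mulr_gt0 ?yp ?yp'.
- exists (fun e => x' w * x e + x w * flip w x' e); split.
  + exact: (sub_lin (covec_sub wM)).
  + by rewrite /flip eqxx; ring.
  + by move=> e eM ew; rewrite flip_id // addr_gt0 // mulr_gt0 ?xp ?xp'.
- by exists y; split=> // e eM _; apply: yp.
Qed.

(** A covector that is positive on [A] absorbs, once scaled, any covector which
    is positive at [w]. *)
Lemma perturb (M' : opair (E := E)) (A : {set E}) x : wf M' ->
  w \in ground M' -> ~ coloop (dual M') w -> covec M' x -> x w = 0 ->
  (forall e, e \in A -> 0 < x e) ->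
  exists x', [/\ covec M' x', 0 < x' w & forall e, e \in A -> 0 < x' e].
Proof.
move=> wM' wG' nl Hx xw xA.
have w0 : w \notin set0 by rewrite inE.
case: (painting wM' wG' w0) => [[z [Hz zw _]]|[y [Hy yw y0]]]; last first.
  case: nl; exists y; split=> // e eM ew; apply: y0; rewrite ?inE //.
have [K [_ KA]] := dominate (fun e => z w * z e) xA.
(* the factor z w makes the value at w a square; x does not contribute at w *)
exists (fun e => z w * z e + (K + 1) * x e); split.
- exact: (sub_lin (covec_sub wM')).
- by rewrite xw mulr0 addr0 -expr2 exprn_even_gt0.
- by move=> e eA; rewrite mulrDl mul1r addrA ltr_wpDl ?KA ?xA.
Qed.

(** The contraction gives the covector and the deletion gives the vector, up to
    a perturbation which makes them positive at [w]. *)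
Lemma bip_both : bip (del M w) p -> bip (con M w) p ->
  ~ coloop M w -> ~ coloop (dual M) w -> bip M p.
Proof.
rewrite bip_delE bip_conE => [] [mp _ [y [Hy yw yp]]] [_ [x [Hx xw xp]] _] nc nl.
split=> //.
  have [e|x' [Hx' xw' xp']] := @perturb M (ground M :\ w) x wM wG nl Hx xw.
    by rewrite !inE => /andP[ew eM]; apply: xp.
  exists x'; split=> // e eM; have [->//|ew] := eqVneq e w.
  by apply: xp'; rewrite !inE ew.
have nc' : ~ coloop (dual (dual M)) w by rewrite dualK.
have [e|y' [Hy' yw' yp']] := @perturb (dual M) (ground M :\ w :\ p) y (wf_dual wM) wG nc' Hy yw.
  by rewrite !inE => /and3P[ep ew eM]; apply: yp.
exists y'; split=> // e eM ep; have [->//|ew] := eqVneq e w.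
by apply: yp'; rewrite !inE ew ep.
Qed.
End MaximalElement.

Lemma coloop_reverse M w : coloop (reverse M w) w -> coloop M w.
Proof.
case=> x [Hx xw x0]; exists (flip w x); split=> //.
  by rewrite /flip eqxx oppr_eq0.
by move=> e eM ew; rewrite flip_id // x0.
Qed.

End Bipolar.

(** * Uniqueness of fully optimal trees *)
Section FullyOptimal.
Context {disp : Order.disp_t} {E : finOrderType disp}.
Implicit Types (A C D F S T Z : {set E}) (a b c e f m p w : E) (x y z : E -> rat).
Implicit Types M : opair (E := E).

Lemma exists_least (Q : E -> Prop) : (exists c, Q c) ->
  exists c, Q c /\ forall c', Q c' -> (c <= c')%O.
Proof.
case=> c0 Qc0; have Qb : `[< Q c0 >] by apply/asboolP.
case: (@arg_minP _ _ _ c0 (fun c => `[< Q c >]) id Qb) => c /asboolP Qc H.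
by exists c; split=> // c' Qc'; apply: H; apply/asboolP.
Qed.

(** When [T] is a spanning tree, [x] is a positive multiple of the signed
    fundamental cocycle of [b], with [b] positive. For the dual pair and the
    complement of [T] this is the fundamental cycle of [b]. *)
Definition fund M T b x : Prop :=
  [/\ covec M x, 0 < x b & forall c, c \in T -> c != b -> x c = 0].

(** For a fundamental covector of [b], which is positive at [b], this says that
    [b] and the smallest element of the cocycle have opposite directions. *)
Definition negmin S x : Prop :=
  exists m, [/\ m \in S, x m < 0 & forall e, e \in S -> (e < m)%O -> x e = 0].

Definition half_optimal M p T : Prop :=
  forall b, b \in T -> exists x, fund M T b x /\ (b != p -> negmin (ground M) x).

(** The element [p] is exempt from the condition on the side where it lies:
    [p \in T] is the bipolar case and [p \notin T] the cyclic-bipolar one, which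
    makes the notion self-dual. *)
Definition optimal M p T : Prop :=
  [/\ T \subset ground M, half_optimal M p T &
      half_optimal (dual M) p (ground M :\: T)].

Lemma optimal_dual M p T : optimal M p T -> optimal (dual M) p (ground M :\: T).
Proof.
case=> sT h h'; split=> //=; first exact: subsetDl.
by rewrite dualK setDDr setDv set0U (setIidPr sT).
Qed.

(** The fundamental cocycle of [b] and the fundamental cycle of [e] can only
    meet in [b] and [e]. *)
Lemma fund_orth M T b e x y : wf M -> T \subset ground M -> b \in T ->
  e \in ground M :\: T -> fund M T b x -> fund (dual M) (ground M :\: T) e y ->
  x b * y b + x e * y e = 0.
Proof.
move=> wM sT bT /[dup] eT'; rewrite inE => /andP[eT eM] [Hx xb x0] [Hy ye y0].
have be : e != b by apply: contraNneq eT => ->.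
rewrite -[RHS](orth wM Hx Hy) (bigD1 b) ?(subsetP sT) //= (bigD1 e) /= ?eM ?be //.
rewrite big1 ?addr0 // => f /andP[/andP[fM fb] fe].
have [fT|fT] := boolP (f \in T); first by rewrite x0 // mul0r.
by rewrite y0 ?mulr0 // inE fT.
Qed.

(** The condition on the fundamental cocycle of [f], read on fundamental cycles:
    the smallest element m of that cocycle is the first element outside [T] whose
    fundamental cycle contains [f], and [f] is positive in it. *)
Lemma optimal_dom M p T f : wf M -> optimal M p T -> f \in T -> f != p ->
  exists m, [/\ m \in ground M :\: T, (m < f)%O,
    forall y, fund (dual M) (ground M :\: T) m y -> 0 < y f &
    forall c y, c \in ground M :\: T -> (c < m)%O ->
      fund (dual M) (ground M :\: T) c y -> y f = 0].
Proof.
move=> wM [sT h _] fT fp; have [x [fx /(_ fp) [m [mM xm xlt]]]] := h f fT.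
have [_ xf x0] := fx.
have mf : m != f by apply: contraTneq xm => ->; rewrite -leNgt ltW.
have mT : m \notin T by apply/negP=> mT; move: xm; rewrite x0 // ltxx.
have mG : m \in ground M :\: T by rewrite inE mT.
exists m; split=> //.
- rewrite lt_neqAle mf leNgt; apply/negP=> /(xlt _ (subsetP sT _ fT)) xf0.
  by rewrite xf0 ltxx in xf.
- move=> y fy; have := fund_orth wM sT fT mG fx fy.
  have [_ ym _] := fy => eq0.
  have : x m * y m < 0 by rewrite nmulr_rlt0.
  rewrite -(@pmulr_rgt0 _ (x f)) //; move: eq0; lra.
- move=> c y cT cm fy; have := fund_orth wM sT fT cT fx fy.
  rewrite (xlt c) // ?mul0r ?addr0; last by move: cT; rewrite inE => /andP[].
  by move/eqP; rewrite mulf_eq0 gt_eqF //= => /eqP.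
Qed.

(** Among the elements outside [T] whose fundamental cycle meets the support of
    z, let c be the smallest. By [optimal_dom], all other terms of the scalar
    product of z with the fundamental cycle of c are nonnegative, so z is negative
    at c. And z vanishes below c, as an element g of its support below c would give
    an element at most g with the same property. *)
Lemma optimal_lexneg M p T z : wf M -> optimal M p T -> covec M z ->
  (p \in T -> z p = 0) -> (forall t, t \in T -> 0 <= z t) ->
  (exists f, f \in ground M /\ z f != 0) -> negmin (ground M) z.
Proof.
move=> wM oT Hz zp zT [f0 [f0M zf0]].
have [sT _ h'] := oT.
(* the fundamental cycle of c meets the support of z *)
pose Q c := c \in ground M :\: T /\ exists y, fund (dual M) (ground M :\: T) c y /\
  exists f, [/\ f \in ground M, z f != 0 & y f != 0].
have zTp f : f \in T -> z f != 0 -> f != p.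
  by move=> fT; apply: contraNneq => efp; rewrite efp zp // -efp.
have QT f : f \in T -> z f != 0 -> exists m, [/\ Q m, (m < f)%O,
    forall y, fund (dual M) (ground M :\: T) m y -> 0 < y f &
    forall c y, c \in ground M :\: T -> (c < m)%O ->
      fund (dual M) (ground M :\: T) c y -> y f = 0].
  move=> fT zf; have [m [mT mf mpos mlt]] := optimal_dom wM oT fT (zTp f fT zf).
  exists m; split=> //; split=> //; have [y [fy _]] := h' m mT.
  by exists y; split=> //; exists f; rewrite (subsetP sT) // zf gt_eqF ?mpos.
have QnT f : f \in ground M -> f \notin T -> z f != 0 -> Q f.
  move=> fM fT zf; have fT' : f \in ground M :\: T by rewrite inE fT.
  split=> //; have [y [fy _]] := h' f fT'; exists y; split=> //; exists f; split=> //.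
  by case: fy => _ yf _; rewrite gt_eqF.
have [|c [[cT' [y [fy [f [fM zf yf]]]]] cmin]] := @exists_least Q.
  have [f0T|f0T] := boolP (f0 \in T); last by exists f0; apply: QnT.
  by have [m [Qm _ _ _]] := QT f0 f0T zf0; exists m.
have [Hy yc y0] := fy.
have cM : c \in ground M by move: cT'; rewrite inE => /andP[].
have rest g : g \in ground M -> g != c -> 0 <= z g * y g.
  move=> gM gc; have [gT|gT] := boolP (g \in T); last first.
    by rewrite y0 ?mulr0 // inE gT.
  have [->|zg] := eqVneq (z g) 0; first by rewrite mul0r.
  have [m [Qm mg mpos mlt]] := QT g gT zg.
  have := cmin m Qm; rewrite le_eqVlt => /predU1P[ecm|cm].
    by rewrite mulr_ge0 ?zT ?ltW // mpos // -ecm.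
  by rewrite (mlt c y) // mulr0.
have zc : z c < 0.
  have := orth wM Hz Hy; rewrite (bigD1 c) //=.
  have [zc0|zc0] := eqVneq (z c) 0.
    rewrite zc0 mul0r add0r => /eqP; rewrite psumr_eq0; last first.
      by move=> g /andP[gM gc]; apply: rest.
    move/allP/(_ f); rewrite mem_index_enum fM /= => /(_ isT).
    have [efc|fc] := eqVneq f c => /=; last by rewrite mulf_eq0 (negPf zf) (negPf yf).
    by rewrite efc zc0 eqxx in zf.
  have : 0 <= \sum_(i in ground M | i != c) z i * y i.
    by apply: sumr_ge0 => g /andP[gM gc]; apply: rest.
  move=> s0 s1; have : z c * y c <= 0 by move: s0 s1; lra.
  by rewrite pmulr_lle0 // le_eqVlt (negPf zc0).
exists c; split=> // g gM gc; apply/eqP; apply: contraT => zg.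
have [gT|gT] := boolP (g \in T); last first.
  by have := cmin g (QnT g gM gT zg); rewrite leNgt gc.
have [m [Qm mg _ _]] := QT g gT zg.
by have := cmin m Qm; rewrite leNgt (lt_trans mg gc).
Qed.

Lemma negmin_contra S x : negmin S x -> negmin S (fun e => - x e) -> False.
Proof.
case=> [m [mS xm xlt]] [m' [mS' xm' xlt']]; case: (ltgtP m m') => [lt|lt|eq].
- by have := xlt' m mS lt => /eqP; rewrite oppr_eq0 => /eqP xm0; rewrite xm0 ltxx in xm.
- by have := xlt m' mS' lt => xm0; rewrite xm0 oppr0 ltxx in xm'.
- by move: xm'; rewrite -eq oppr_lt0 ltNge ltW.
Qed.

Lemma nonneg_negmin S x : (forall e, e \in S -> 0 <= x e) -> negmin S x -> False.
Proof. by move=> H [m [mS xm _]]; move: (H m mS); rewrite leNgt xm. Qed.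

(** A nonnegative covector has no negative first coordinate. *)
Lemma optimal_nonneg M p T x : wf M -> optimal M p T -> covec M x ->
  (p \in T -> x p = 0) -> (forall e, e \in ground M -> 0 <= x e) ->
  forall e, e \in ground M -> x e = 0.
Proof.
move=> wM oT Hx xp xge e eM; apply/eqP; apply: contraT => xe.
have [sT _ _] := oT.
exfalso; apply: (nonneg_negmin xge).
apply: (optimal_lexneg wM oT Hx xp) => [t tT|]; last by exists e.
by rewrite xge // (subsetP sT).
Qed.

(** By [optimal_nonneg] for the dual pair there is no nonzero nonnegative
    vector, so the alternative gives a positive covector; and there is no nonzero
    nonnegative covector vanishing at [p], which gives the positive vector. *)
Lemma optimal_bip M p T : wf M -> is_min (ground M) p -> optimal M p T ->
  p \in T -> bip M p.
Proof.
move=> wM mp oT pT.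
have dis0 : [disjoint set0 & set0 : {set E}] by rewrite -setI_eq0 setI0.
have disp0 : [disjoint [set p] & set0 : {set E}] by rewrite -setI_eq0 setI0.
split=> //.
  have [|x [Hx _ xp]] := @covec_sum _ _ M (ground M) set0 wM; last by exists x.
  move=> e eM; have e0 : e \notin set0 by rewrite inE.
  case: (nonneg_painting wM dis0 eM e0 e0) => [[x [Hx xe _ xge]]|[y [Hy ye _ yge]]].
    exists x; split=> // f; first by rewrite inE.
    by move=> fM; apply: xge; rewrite ?inE.
  have ye0 : y e = 0.
    apply: (optimal_nonneg (wf_dual wM) (optimal_dual oT)) => //=.
      by rewrite inE pT.
    by move=> f fM; apply: yge; rewrite ?inE.
  by rewrite ye0 ltxx in ye.
have [|y [Hy _ yp]] := @covec_sum _ _ (dual M) (ground M :\ p) set0 (wf_dual wM).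
  move=> e; rewrite !inE => /andP[ep eM]; have e0 : e \notin set0 by rewrite inE.
  have ep' : e \notin [set p] by rewrite inE.
  case: (nonneg_painting wM disp0 eM ep' e0) => [[x [Hx xe xp xge]]|[y [Hy ye _ yge]]].
    have xp0 : x p = 0 by rewrite xp ?inE ?(is_min_in mp).
    have xe0 : x e = 0.
      apply: (optimal_nonneg wM oT) => //= f fM; have [->|fp] := eqVneq f p.
        by rewrite xp0.
      by apply: xge; rewrite ?inE.
    by rewrite xe0 ltxx in xe.
  exists y; split=> // f; first by rewrite inE.
  by rewrite !inE => /andP[fp fM]; apply: yge; rewrite ?inE.
by exists y; split=> // e eM ep; apply: yp; rewrite !inE ep.
Qed.

(** [T] is a spanning set: apply [optimal_lexneg] to z and to -z. *)
Lemma optimal_zero M p T z : wf M -> optimal M p T -> covec M z ->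
  (forall t, t \in T -> z t = 0) -> forall e, e \in ground M -> z e = 0.
Proof.
move=> wM oT Hz zT e eM; apply/eqP; apply: contraT => ze; exfalso.
apply: (@negmin_contra (ground M) z).
  apply: (optimal_lexneg wM oT Hz) => [/zT //|t /zT ->//|]; by exists e.
apply: (optimal_lexneg wM oT (covecN wM Hz)) => [/zT ->|t /zT ->|]; rewrite ?oppr0 //.
by exists e; rewrite oppr_eq0.
Qed.

Lemma strong_ind (P : E -> Prop) :
  (forall b, (forall c, (c < b)%O -> P c) -> P b) -> forall b, P b.
Proof.
move=> H b; apply: contrapT => nPb.
have [c [nPc cmin]] := @exists_least (fun b => ~ P b) (ex_intro _ b nPb).
apply: nPc; apply: H => d dc; apply: contrapT => /cmin; by rewrite leNgt dc.
Qed.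

(** At [b], the two trees coincide and have the same fundamental cocycle up to
    scaling. *)
Definition agree M T T' b : Prop := b \in ground M ->
  (b \in T) = (b \in T') /\
  (b \in T -> forall x x', fund M T b x -> fund M T' b x' -> x b = x' b ->
     forall e, e \in ground M -> x e = x' e).

Lemma fund_scale M T b x (s : rat) : wf M -> 0 < s ->
  fund M T b x -> fund M T b (fun e => s * x e).
Proof.
move=> wM s0 [Hx xb x0]; split; first exact: covec_scale.
  by rewrite mulr_gt0.
by move=> c cT cb; rewrite x0 // mulr0.
Qed.

(** Where the trees agree at [m], the fundamental cocycle of [m] for [T'] is
    one for [T], hence vanishes at [t]; so [m] is not in the fundamental cycle of
    [t] for [T']. *)
Lemma agree_cross M p T T' m t y : wf M -> optimal M p T -> optimal M p T' ->
  agree M T T' m -> m \in T' -> t \in T -> t != m -> t \in ground M :\: T' ->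
  fund (dual M) (ground M :\: T') t y -> y m = 0.
Proof.
move=> wM [sT h1 _] [sT' h1' _] ag mT' tT tm tG' fy.
have [mM tM] := (subsetP sT' m mT', subsetP sT t tT).
have [eqm eqx] := ag mM; have mT : m \in T by rewrite eqm.
have [u [fu _]] := h1 m mT; have [u' [fu' _]] := h1' m mT'.
have [_ um u0] := fu; have [_ um' _] := fu'.
have s0 : 0 < u' m / u m by rewrite divr_gt0.
have := eqx mT _ _ (fund_scale wM s0 fu) fu' _ t tM.
rewrite divfK ?gt_eqF // (u0 t) // mulr0 => /(_ erefl) ut0.
have := fund_orth wM sT' mT' tG' fu' fy; rewrite -ut0 mul0r addr0 => /eqP.
by rewrite mulf_eq0 gt_eqF //= => /eqP.
Qed.

(** If [b] were not in [T'], the smallest element m of its fundamental cycle for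
    [T'] would be in [T'] and below [b], where the two trees agree: this
    contradicts [agree_cross]. *)
Lemma agree_in M p T T' b : wf M -> optimal M p T -> optimal M p T' ->
  p \in T' -> (forall c, (c < b)%O -> agree M T T' c) -> b \in ground M ->
  b \in T -> b \in T'.
Proof.
move=> wM oT oT' pT' IH bM bT; apply: contraT => bT'.
have [sT' _ h2'] := oT'.
have bG' : b \in ground M :\: T' by rewrite inE bT'.
have bp : b != p by apply: contraNneq bT' => ->.
have [y [fy /(_ bp) [m [mM ym ylt]]]] := h2' b bG'.
have [_ yb y0] := fy.
have mb : m != b by apply: contraTneq ym => ->; rewrite -leNgt ltW.
have mT' : m \in T'.
  by apply: contraT => mT'; move: ym; rewrite y0 ?ltxx // inE mT'.
have lt_mb : (m < b)%O.
  rewrite lt_neqAle mb leNgt; apply/negP=> /(ylt _ bM) yb0.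
  by rewrite yb0 ltxx in yb.
move: ym; rewrite (agree_cross wM oT oT' (IH m lt_mb) mT' bT _ bG' fy) ?ltxx //.
by rewrite eq_sym.
Qed.

(** Let t be in [T] but not in [T'], and let m be the smallest element of its
    fundamental cycle for [T']. The case m < b is excluded by [agree_cross]; if
    m = b then x' is positive at t, and if m > b then x' vanishes at t. *)
Lemma agree_nonneg M p T T' b x x' : wf M -> optimal M p T -> optimal M p T' ->
  p \in T -> p \in T' -> (forall c, (c < b)%O -> agree M T T' c) ->
  b \in T -> b \in T' -> fund M T b x -> fund M T' b x' -> x b = x' b ->
  forall t, t \in T -> 0 <= x' t - x t.
Proof.
move=> wM oT oT' pT pT' IH bT bT' fx fx' eqb t tT.
have [sT' h1' h2'] := oT'; have [sT _ _] := oT.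
have tM : t \in ground M by rewrite (subsetP sT).
have [->|tb] := eqVneq t b; first by rewrite eqb subrr.
have [_ xb x0] := fx; have [_ xb' x0'] := fx'.
rewrite (x0 t) // subr0.
have [tT'|tT'] := boolP (t \in T'); first by rewrite x0'.
have tG' : t \in ground M :\: T' by rewrite inE tT'.
have tp : t != p by apply: contraNneq tT' => ->.
have [y [fy /(_ tp) [m [mM ym ylt]]]] := h2' t tG'.
have [_ yt y0] := fy.
have mt : m != t by apply: contraTneq ym => ->; rewrite -leNgt ltW.
have mT' : m \in T'.
  by apply: contraT => mT'; move: ym; rewrite y0 ?ltxx // inE mT'.
have := fund_orth wM sT' bT' tG' fx' fy.
case: (ltgtP m b) => [lt|lt|emb].
- move: ym; rewrite (agree_cross wM oT oT' (IH m lt) mT' tT _ tG' fy) ?ltxx //.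
  by rewrite eq_sym.
- rewrite (ylt b) ?(subsetP sT) // mulr0 add0r => /eqP.
  by rewrite mulf_eq0 (gt_eqF yt) orbF => /eqP ->.
- rewrite -emb => eq0; have : x' m * y m < 0 by rewrite emb pmulr_rlt0 // -emb.
  by rewrite -(pmulr_lge0 _ yt); move: eq0; lra.
Qed.

Lemma agree_sym M T T' b : agree M T T' b -> agree M T' T b.
Proof.
move=> H bM; have [eqb eqx] := H bM; split=> // bT' x x' fx fx' eqxb e eM.
by apply/esym/(eqx _ x' x) => //; rewrite eqb.
Qed.

(** Once scaled to agree at [b], the two fundamental cocycles differ by a
    covector which, by [agree_nonneg], satisfies the hypotheses of [optimal_lexneg]
    for one tree, while its opposite satisfies them for the other tree. *)
Lemma optimal_agree M p T T' b : wf M -> optimal M p T -> optimal M p T' -> p \in T -> p \in T' -> agree M T T' b.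
Proof.
move=> wM oT oT' pT pT'; elim/strong_ind: b => b IH bM.
have IH' c : (c < b)%O -> agree M T' T c by move=> /IH/agree_sym.
split.
  apply/idP/idP; first exact: agree_in oT oT' pT' IH bM.
  exact: agree_in oT' oT pT IH' bM.
move=> bT x x' fx fx' eqb e eM.
have bT' : b \in T' := agree_in wM oT oT' pT' IH bM bT.
have [Hx xb x0] := fx; have [Hx' xb' x0'] := fx'.
have eqp : x p = x' p.
  by have [->//|pb] := eqVneq p b; rewrite x0 ?x0'.
apply/eqP; apply: contraT => nex; exfalso.
apply: (@negmin_contra (ground M) (fun e => x e - x' e)).
  apply: (optimal_lexneg wM oT') => [||t tT|].
  - exact: covecB.
  - by rewrite eqp subrr.
  - exact: (agree_nonneg wM oT' oT pT' pT IH' bT' bT fx' fx).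
  - by exists e; rewrite subr_eq0.
apply: (optimal_lexneg wM oT) => [||t tT|].
- by apply: covecN => //; apply: covecB.
- by rewrite eqp subrr oppr0.
- rewrite opprB; exact: (agree_nonneg wM oT oT' pT pT' IH bT bT' fx fx').
- by exists e; rewrite oppr_eq0 subr_eq0.
Qed.

Lemma optimal_uniq_in M p T T' : wf M -> optimal M p T -> optimal M p T' -> p \in T -> p \in T' -> T = T'.
Proof.
move=> wM oT oT' pT pT'; apply/setP=> b.
have [bM|bM] := boolP (b \in ground M).
  by have [] := optimal_agree wM oT oT' pT pT' bM.
have [sT _ _] := oT; have [sT' _ _] := oT'.
by rewrite (contraNF (subsetP sT b)) // (contraNF (subsetP sT' b)).
Qed.

Lemma optimal_bipd M p T : wf M -> is_min (ground M) p -> optimal M p T ->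
  p \notin T -> bip (dual M) p.
Proof.
move=> wM mp oT pT; apply: optimal_bip (optimal_dual oT) _ => //.
  exact: wf_dual.
by rewrite inE pT (is_min_in mp).
Qed.

(** Two trees on different sides of [p] would make the pair both bipolar and
    cyclic-bipolar. *)
Lemma optimal_uniq M p T T' : wf M -> is_min (ground M) p ->
  optimal M p T -> optimal M p T' -> T = T'.
Proof.
move=> wM mp oT oT'.
have [sT _ _] := oT; have [sT' _ _] := oT'.
have pM := is_min_in mp.
have [pT|pT] := boolP (p \in T); have [pT'|pT'] := boolP (p \in T').
- exact: optimal_uniq_in oT oT' _ _.
- by case: (bip_excl wM (optimal_bip wM mp oT pT) (optimal_bipd wM mp oT' pT')).
- by case: (bip_excl wM (optimal_bip wM mp oT' pT') (optimal_bipd wM mp oT pT)).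
- have : ground M :\: T = ground M :\: T'.
    apply: (optimal_uniq_in (wf_dual wM) (optimal_dual oT) (optimal_dual oT')).
      by rewrite inE pT.
    by rewrite inE pT'.
  move=> eqD; rewrite -(setIidPr sT) -(setIidPr sT').
  by rewrite -[_ :&: T]set0U -(setDv (ground M)) -setDDr eqD setDDr setDv set0U.
Qed.
End FullyOptimal.

(** * Existence of fully optimal trees *)
Section DeletionContraction.
Context {disp : Order.disp_t} {E : finOrderType disp}.
Implicit Types (A C D F S T U Z : {set E}) (a b c e f m p w : E) (x y z : E -> rat).
Implicit Types M : opair (E := E).

Lemma exists_min S : S != set0 -> exists p, is_min S p.
Proof.
case/set0Pn=> e0 e0S; have [|p [pS H]] := @exists_least _ _ (fun e => e \in S).
  by exists e0.
by exists p; apply: is_minI.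
Qed.

Lemma exists_max S : S != set0 -> exists w, is_max S w.
Proof.
case/set0Pn=> e0 e0S.
case: (@arg_maxP _ _ _ e0 (fun e => e \in S) id e0S) => w wS H.
by exists w; rewrite /is_max wS; apply/forallP=> e; apply/implyP/H.
Qed.

(** Putting back the greatest element does not change the smallest element of
    the support. *)
Lemma negmin_lift S w x x0 : is_max S w -> negmin (S :\ w) x ->
  (forall e, e \in S -> e != w -> x0 e = x e) -> negmin S x0.
Proof.
move=> mw [m [mS xm xlt]] eqx; move: (mS); rewrite !inE => /andP[mw' mS'].
exists m; split=> //; first by rewrite eqx.
move=> e eS em; have ew : e != w.
  by apply: contraTneq em => ->; rewrite -leNgt (is_maxP mw).
by rewrite eqx // xlt // !inE ew.
Qed.

(** Spanning trees, by their linear properties: a covector vanishing on [T] is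
    null, and so is a vector supported by [T]. *)
Definition base M T : Prop :=
  [/\ T \subset ground M,
      forall x, covec M x -> (forall t, t \in T -> x t = 0) ->
        forall e, e \in ground M -> x e = 0 &
      forall y, vect M y -> (forall t, t \in ground M :\: T -> y t = 0) ->
        forall e, e \in ground M -> y e = 0].

Lemma base_dual M T : base M T -> base (dual M) (ground M :\: T).
Proof.
case=> sT h h'; split=> //=; first exact: subsetDl.
by move=> y Hy y0; apply: h => // t tT; apply: y0; rewrite !inE tT (subsetP sT).
Qed.

Lemma optimal_base M p T : wf M -> optimal M p T -> base M T.
Proof.
move=> wM oT; have [sT _ _] := oT; split=> // [x Hx xT|y Hy yT].
  exact: optimal_zero oT Hx xT.
exact: (optimal_zero (wf_dual wM) (optimal_dual oT) Hy yT).
Qed.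

Lemma base_reverse M w T : base (reverse M w) T -> base M T.
Proof.
case=> sT h h'; split=> // [x Hx xT|y Hy yT] e eM.
  have /eqP : flip w x e = 0.
    apply: h => //=; first by rewrite flipK.
    by move=> t tT; rewrite /flip xT // oppr0 if_same.
  by rewrite flip_eq0 => /eqP.
have /eqP : flip w y e = 0.
  apply: h' => //=; first by rewrite flipK.
  by move=> t tT; rewrite /flip yT // oppr0 if_same.
by rewrite flip_eq0 => /eqP.
Qed.

Section Lift.
Variables (M : opair (E := E)) (p w : E).
Hypothesis (mw : is_max (ground M) w).

Let wG : w \in ground M. Proof. by case/andP: mw. Qed.

Lemma half_del_lift T : half_optimal (del M w) p T -> T \subset ground M :\ w ->
  half_optimal M p T.
Proof.
move=> h sT b bT; have [x [[Hx xb x0] xneg]] := h b bT.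
case/covec_del: Hx => x1 [Hx1 eqx].
have inT t : t \in T -> t \in ground M /\ t != w.
  by move/(subsetP sT); rewrite !inE => /andP[].
exists x1; split.
  split=> // [|t tT tb]; first by have [? ?] := inT b bT; rewrite eqx.
  by have [? ?] := inT t tT; rewrite eqx // x0.
by move=> /xneg; rewrite ground_del => /negmin_lift; apply.
Qed.

Lemma half_con_lift U : half_optimal (con M w) p U -> U \subset ground M :\ w ->
  (exists x, fund M (w |: U) w x /\ (w != p -> negmin (ground M) x)) ->
  half_optimal M p (w |: U).
Proof.
move=> h sU Hw b; rewrite !inE => /predU1P[->//|bU].
have [x [[Hx xb x0] xneg]] := h b bU.
case/(covec_con _ wG): Hx => x1 [Hx1 xw eqx].
have inU t : t \in U -> t \in ground M /\ t != w.
  by move/(subsetP sU); rewrite !inE => /andP[].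
exists x1; split.
  split=> // [|t]; first by have [? ?] := inU b bU; rewrite eqx.
  rewrite !inE => /predU1P[->//|tU] tb.
  by have [? ?] := inU t tU; rewrite eqx // x0.
by move=> /xneg; rewrite ground_con => /negmin_lift; apply.
Qed.
End Lift.

(** Only the condition on the fundamental cycle of [w] has to be added. *)
Lemma optimal_del_lift M p w T y : wf M -> is_max (ground M) w ->
  optimal (del M w) p T -> fund (dual M) (ground M :\: T) w y ->
  negmin (ground M) y -> optimal M p T.
Proof.
move=> wM mw [sT h h'] fy ny; rewrite ground_del in sT.
have wG : w \in ground M by case/andP: mw.
have wT : w \notin T by apply/negP => /(subsetP sT); rewrite !inE eqxx.
have eqD : ground M :\: T = w |: (ground M :\ w) :\: T.
  by apply/setP=> e; rewrite !inE; case: eqVneq => //= ->; rewrite wT wG.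
split.
- exact: subset_trans sT (subsetDl _ _).
- exact: half_del_lift h sT.
- rewrite eqD; apply: half_con_lift => //.
  + by rewrite -dual_del -ground_del.
  + exact: subsetDl.
  + by exists y; rewrite -eqD.
Qed.

Lemma setD1D M w T : T \subset ground M :\ w -> w \in ground M ->
  ground M :\: ((ground M :\ w) :\: T) = w |: T.
Proof.
move=> sT wG; apply/setP=> e; rewrite !inE.
case: eqVneq => [->|ew] /=; first by rewrite wG andbT andbF.
case eT : (e \in T) => /=; last by rewrite andNb.
by move/(subsetP sT): eT; rewrite !inE => /andP[].
Qed.

Lemma optimal_con_lift M p w T x : wf M -> is_max (ground M) w ->
  optimal (con M w) p T -> fund M (w |: T) w x ->
  negmin (ground M) x -> optimal M p (w |: T).
Proof.
move=> wM mw oT fx nx; have wG : w \in ground M by case/andP: mw.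
have [sT _ _] := oT; rewrite ground_con in sT.
rewrite -(setD1D sT wG) -[M in optimal M]dualK; apply: optimal_dual.
apply: (optimal_del_lift (w := w) (wf_dual wM) mw _ _ nx).
  by rewrite -dual_con -ground_con; apply: optimal_dual.
by rewrite dualK setD1D.
Qed.

(** Otherwise painting at [w] gives a covector vanishing on [T], hence null
    outside [w], and [w] is a coloop. *)
Lemma fund_del_exists M p w T : wf M -> w \in ground M -> ~ coloop M w ->
  optimal (del M w) p T -> exists y, fund (dual M) (ground M :\: T) w y.
Proof.
move=> wM wG nc oT; have [sT _ _] := oT; rewrite ground_del in sT.
have wT : w \notin T by apply/negP => /(subsetP sT); rewrite !inE eqxx.
case: (painting wM wG wT) => [[x [Hx xw xT]]|[y [Hy yw y0]]].
  case: nc; exists x; split=> // e eM ew.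
  have inT t : t \in T -> t \in ground M.
    by move/(subsetP sT); rewrite !inE => /andP[].
  apply: (optimal_zero (wf_del w wM) oT).
  - by apply/covec_del; exists x.
  - by move=> t tT; apply: xT => //; apply: inT.
  - by rewrite in_del ew.
exists (fun e => y w * y e); split.
- exact: (covec_scale _ (wf_dual wM)).
- by rewrite -expr2 exprn_even_gt0.
- by move=> e; rewrite inE => /andP[eT eM] ew; rewrite (y0 e) // mulr0.
Qed.

Lemma fund_con_exists M p w T : wf M -> w \in ground M -> ~ coloop (dual M) w ->
  optimal (con M w) p T -> exists x, fund M (w |: T) w x.
Proof.
move=> wM wG nl oT; have [sT _ _] := oT; rewrite ground_con in sT.
have := @fund_del_exists (dual M) p w (ground (con M w) :\: T) (wf_dual wM) wG nl.
rewrite -dual_con dualK ground_con => /(_ _) [|x].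
  by have := optimal_dual oT; rewrite ground_con.
by rewrite setD1D // => fx; exists x.
Qed.

(** Reversing [w] and changing the global sign keeps the value at [w] and
    changes all other signs, in particular that of the smallest element of the
    support, which differs from [w]. *)
Lemma negmin_alt S w y : is_max S w -> 0 < y w ->
  (exists e, [/\ e \in S, e != w & y e != 0]) ->
  negmin S y \/ negmin S (flip w (fun e => - y e)).
Proof.
move=> mw yw [e [eS ew ye]].
have [|m [[mS ym] mmin]] := @exists_least _ _ (fun e => e \in S /\ y e != 0).
  by exists e.
have ylt f : f \in S -> (f < m)%O -> y f = 0.
  move=> fS fm; apply/eqP; apply: contraT => yf.
  by have := mmin f (conj fS yf); rewrite leNgt fm.
have mw' : m != w.
  apply: contraNneq ew => emw; rewrite eq_le (is_maxP mw) //= -emw.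
  exact: mmin.
case: (ltgtP (y m) 0) => [lt0|gt0|eq0]; last by rewrite eq0 eqxx in ym.
  by left; exists m.
right; exists m; split=> //; first by rewrite flip_id // oppr_lt0.
by move=> f fS fm; rewrite /flip ylt // !oppr0 if_same.
Qed.

Lemma fund_flip M w T y : wf M -> fund M T w y ->
  fund (reverse M w) T w (flip w (fun e => - y e)).
Proof.
move=> wM [Hy yw y0]; split=> /=.
- by rewrite flipK; apply: covecN.
- by rewrite /flip eqxx opprK.
- by move=> c cT cw; rewrite flip_id // y0 // oppr0.
Qed.

Lemma fund_not_loop M w T y : wf M -> ~ coloop M w -> fund M T w y ->
  exists e, [/\ e \in ground M, e != w & y e != 0].
Proof.
move=> wM nc [Hy yw y0]; apply: contra_notP nc => H; exists y; split=> //.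
  by rewrite gt_eqF.
move=> e eM ew; apply/eqP; apply: contraT => ye; exfalso; apply: H.
by exists e.
Qed.

Lemma optimal_del_flip M p w T y : wf M -> is_max (ground M) w ->
  ~ coloop (dual M) w ->
  optimal (del M w) p T -> fund (dual M) (ground M :\: T) w y ->
  (negmin (ground M) y /\ optimal M p T) \/
  (negmin (ground M) (flip w (fun e => - y e)) /\ optimal (reverse M w) p T).
Proof.
move=> wM mw nl oT fy; have [_ yw _] := fy.
case: (negmin_alt mw yw (fund_not_loop (wf_dual wM) nl fy)) => ny; [left|right].
  by split=> //; apply: optimal_del_lift oT fy ny.
split=> //; apply: (optimal_del_lift (w := w) (wf_reverse w wM)) ny => //.
  by rewrite del_reverse.
by rewrite dual_reverse; apply: (fund_flip (wf_dual wM)).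
Qed.

Lemma optimal_con_flip M p w T x : wf M -> is_max (ground M) w ->
  ~ coloop M w ->
  optimal (con M w) p T -> fund M (w |: T) w x ->
  (negmin (ground M) x /\ optimal M p (w |: T)) \/
  (negmin (ground M) (flip w (fun e => - x e)) /\ optimal (reverse M w) p (w |: T)).
Proof.
move=> wM mw nc oT fx; have [_ xw _] := fx.
case: (negmin_alt mw xw (fund_not_loop wM nc fx)) => nx; [left|right].
  by split=> //; apply: optimal_con_lift oT fx nx.
split=> //; apply: (optimal_con_lift (w := w) (wf_reverse w wM)) nx => //.
  by rewrite con_reverse.
exact: fund_flip.
Qed.

Lemma optimal_del_alt M p w T : wf M -> is_max (ground M) w ->
  ~ coloop M w -> ~ coloop (dual M) w -> optimal (del M w) p T ->
  optimal M p T \/ optimal (reverse M w) p T.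
Proof.
move=> wM mw nc nl oT; have wG : w \in ground M by case/andP: mw.
have [y fy] := fund_del_exists wM wG nc oT.
by case: (optimal_del_flip wM mw nl oT fy) => [] [_ ?]; [left|right].
Qed.

Lemma optimal_con_alt M p w T : wf M -> is_max (ground M) w ->
  ~ coloop M w -> ~ coloop (dual M) w -> optimal (con M w) p T ->
  optimal M p (w |: T) \/ optimal (reverse M w) p (w |: T).
Proof.
move=> wM mw nc nl oT; have wG : w \in ground M by case/andP: mw.
have [x fx] := fund_con_exists wM wG nl oT.
by case: (optimal_con_flip wM mw nc oT fx) => [] [_ ?]; [left|right].
Qed.

(** The two candidates differ at [w], so by [optimal_uniq] they cannot be optimal
    for the same orientation of [w]. *)
Lemma optimal_both M p w T' T'' : wf M -> is_max (ground M) w ->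
  is_min (ground M) p -> ~ coloop M w -> ~ coloop (dual M) w ->
  optimal (del M w) p T' -> optimal (con M w) p T'' ->
  (optimal M p T' /\ optimal (reverse M w) p (w |: T'')) \/
  (optimal M p (w |: T'') /\ optimal (reverse M w) p T').
Proof.
move=> wM mw mp nc nl oT' oT''.
have wT' : w \notin T'.
  by have [sT _ _] := oT'; apply/negP => /(subsetP sT); rewrite in_del eqxx.
have neq : T' <> w |: T'' by move=> eT; move: wT'; rewrite eT !inE eqxx.
case: (optimal_del_alt wM mw nc nl oT') => o1;
case: (optimal_con_alt wM mw nc nl oT'') => o2.
- by case: neq; apply: optimal_uniq wM mp o1 o2.
- by left.
- by right.
- by case: neq; apply: optimal_uniq (wf_reverse w wM) mp o1 o2.
Qed.

Lemma coloop_reverse_iff M w : coloop (reverse M w) w <-> coloop M w.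
Proof.
split; first exact: coloop_reverse.
by rewrite -{1}(reverseK M w); apply: coloop_reverse.
Qed.

(** By induction on the ground set. If a single minor of [w] is known to be
    bipolar and its tree is not optimal for [M], it is optimal for the reversed
    pair, which is then bipolar; so both minors are bipolar and [optimal_both]
    applies. *)
Lemma optimal_exists M p : wf M -> bip M p -> exists T, optimal M p T /\ p \in T.
Proof.
have [n] := ubnP #|ground M|; elim: n M => // n IHn M le_n wM bM.
have [mp [x [Hx xp]] _] := bM; have pM := is_min_in mp.
have [|w mw] := @exists_max (ground M); first by apply/set0Pn; exists p.
have wG : w \in ground M by case/andP: mw.
have [ewp|wp] := eqVneq w p.
  have eqG : ground M = [set p].
    apply/setP=> e; rewrite inE; apply/idP/eqP => [eM|->//].
    by apply: le_anti; rewrite (is_minP mp) // -ewp (is_maxP mw).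
  exists [set p]; rewrite inE eqxx; split=> //; split.
  - by rewrite eqG.
  - move=> b; rewrite inE => /eqP ->; exists x; split; last by rewrite eqxx.
    by split=> // [|c]; rewrite ?xp // inE => /eqP ->; rewrite eqxx.
  - by move=> b; rewrite eqG setDv inE.
have [nc nl] := bip_noloop wM bM wG wp.
have ltc : (#|ground M :\ w| < n)%N by move: le_n; rewrite (cardsD1 w) wG.
have wpT : p != w by rewrite eq_sym.
have bips : bip (reverse M w) p -> bip (del M w) p /\ bip (con M w) p.
  exact: bip_reverse_minors.
have exd : bip (del M w) p -> exists T, optimal (del M w) p T /\ p \in T.
  by apply: IHn; rewrite ?ground_del //; apply: wf_del.
have exc : bip (con M w) p -> exists T, optimal (con M w) p T /\ p \in T.
  by apply: IHn; rewrite ?ground_con //; apply: wf_con.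
have both : bip (del M w) p -> bip (con M w) p -> exists T, optimal M p T /\ p \in T.
  move=> /exd[T' [oT' pT']] /exc[T'' [oT'' pT'']].
  case: (optimal_both wM mw mp nc nl oT' oT'') => [] [o1 _].
    by exists T'.
  by exists (w |: T''); rewrite !inE pT'' orbT.
case: (bip_minor wM mw wp bM) => [bd|bc].
  have [T' [oT' pT']] := exd bd.
  case: (optimal_del_alt wM mw nc nl oT') => o1; first by exists T'.
  have [] := bips (optimal_bip (wf_reverse w wM) mp o1 pT'); exact: both.
have [T' [oT' pT']] := exc bc.
have pwT : p \in w |: T' by rewrite !inE pT' orbT.
case: (optimal_con_alt wM mw nc nl oT') => o1; first by exists (w |: T').
have [] := bips (optimal_bip (wf_reverse w wM) mp o1 pwT); exact: both.
Qed.
End DeletionContraction.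

(** * Levelings: the active filtration of a pair *)
Section Levels.
Context {disp : Order.disp_t} {E : finOrderType disp}.
Implicit Types (A C D F S T U Z : {set E}) (a b c e f g m p w : E) (x y z : E -> rat).
Implicit Types (M : opair (E := E)) (lvl : E -> int) (l : int).

(** Position in the linear order, so that levels can be integers. *)
Definition rank e : nat := #|[set f | (f < e)%O]|.

Lemma ltn_rank a b : (rank a < rank b)%N = (a < b)%O.
Proof.
have homo c d : (c < d)%O -> (rank c < rank d)%N.
  move=> cd; apply/proper_card/properP; split.
    by apply/subsetP=> f; rewrite !inE => fc; apply: lt_trans cd.
  by exists c; rewrite !inE ?ltxx.
case: (ltgtP a b) => [/homo -> //|/homo ba|->]; last by rewrite ltnn.
by rewrite ltnNge ltnW.
Qed.

Lemma leq_rank a b : (rank a <= rank b)%N = (a <= b)%O.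
Proof. by rewrite leqNgt ltn_rank leNgt. Qed.

Lemma rank_inj : injective rank.
Proof. by move=> a b eqr; apply: le_anti; rewrite -!leq_rank eqr leqnn. Qed.

(** Disjointness makes the order of deletions and contractions irrelevant. *)
Lemma minor_minor M C D C' D' : wf M -> [disjoint C :|: C' & D :|: D'] ->
  pair_minor (pair_minor M C D) C' D' = pair_minor M (C :|: C') (D :|: D').
Proof.
move=> wM dis.
have d1 : [disjoint C & D] := disjointW (subsetUl _ _) (subsetUl _ _) dis.
have d3 : [disjoint C' & D] := disjointW (subsetUr _ _) (subsetUl _ _) dis.
have d4 : [disjoint C' & D'] := disjointW (subsetUr _ _) (subsetUr _ _) dis.
apply: wf_eq.
- by apply: wf_minor => //; apply: wf_minor.
- exact: wf_minor.
- apply/setP=> e; rewrite !in_minor !inE; do !case: (_ \in _) => //.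
move=> x; split=> [[x1 [[x0 [H0 H1 H2]] H3 H4]]|[x0 [H0 H1 H2]]].
  exists x0; split=> // e.
    move=> eM; rewrite !inE; have [eC|eC] := boolP (e \in C); first by move=> _; apply: H1.
    move=> /= eC'; have eG : e \in ground (pair_minor M C D).
      by rewrite in_minor eC eM (disjointFr d3 eC').
    by rewrite H2 // H3.
  move=> eG; have : e \in ground (pair_minor (pair_minor M C D) C' D').
    by move: eG; rewrite !inE; do !case: (_ \in _).
  move=> eG'; rewrite H2; first exact: H4.
  by move: eG'; rewrite !in_minor => /and3P[].
exists x0; split=> [|e|e].
- by exists x0; split=> // e eM eC; apply: H1; rewrite ?inE ?eC.
- by rewrite !inE => /andP[_ eM] eC'; apply: H1; rewrite ?inE ?eC' ?orbT.
- by move=> eG; apply: H2; move: eG; rewrite !inE; do !case: (_ \in _).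
Qed.

(** When [lvl] increases along the active filtration, these are the active
    minors: restriction to the levels at most [l], contraction of those below. *)
Definition lminor M lvl l := pair_minor M [set e | lvl e < l] [set e | l < lvl e].

Lemma lminor_dis lvl l : [disjoint [set e | lvl e < l] & [set e | l < lvl e]].
Proof.
rewrite -setI_eq0; apply/eqP/setP=> e; rewrite !inE.
by case: ltgtP.
Qed.

Lemma wf_lminor M lvl l : wf M -> wf (lminor M lvl l).
Proof. by move=> wM; apply: wf_minor wM (lminor_dis _ _). Qed.

Lemma in_lminor M lvl l e :
  (e \in ground (lminor M lvl l)) = (e \in ground M) && (lvl e == l).
Proof. by rewrite in_minor !inE; case: ltgtP; rewrite ?andbF ?andbT. Qed.

(** Duality reverses the active filtration. *)
Definition opp_level lvl := fun e => - lvl e.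

Lemma lminor_dual M lvl l : lminor (dual M) (opp_level lvl) (- l) = dual (lminor M lvl l).
Proof.
rewrite /lminor dual_minor; congr pair_minor; apply/setP=> e; rewrite !inE /opp_level ?ltrN2 //.
Qed.

Lemma pair_minor_ext M C D C' D' :
  (forall e, e \in ground M -> (e \in C) = (e \in C')) ->
  (forall e, e \in ground M -> (e \in D) = (e \in D')) ->
  pair_minor M C D = pair_minor M C' D'.
Proof.
move=> eqC eqD; have eqG : minor_ground M C D = minor_ground M C' D'.
  by apply/setP=> e; rewrite !inE; case eM: (e \in ground M); rewrite ?andbF ?eqC ?eqD.
rewrite /pair_minor eqG; congr OPair; apply: funext => x; apply: propext;
  split=> [] [x0 [H0 H1 H2]]; exists x0; split=> // e eM eC; apply: H1 => //.
- by rewrite eqC.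
- by rewrite -eqC.
- by rewrite eqD.
- by rewrite -eqD.
Qed.

Lemma lminor_eq M lvl lvl' l :
  (forall e, e \in ground M -> lvl e = lvl' e) -> lminor M lvl l = lminor M lvl' l.
Proof. by move=> eql; apply: pair_minor_ext => e eM; rewrite !inE eql. Qed.

Definition bip_at l M p : Prop := if 0 < l then bip M p else bip (dual M) p.

(** The level of an element of the part with smallest element a is
    (rank a) + 1 for a part outside the cyclic flat, and the opposite for a part
    inside it. The sign thus records the cyclic flat, and the levels increase along
    the filtration, as the smallest elements do on the acyclic side whereas they
    decrease on the cyclic side. *)
Definition leveling M lvl : Prop := forall e, e \in ground M -> exists p,
  [/\ lvl e != 0, `|lvl e|%N = (rank p).+1 &
      bip_at (lvl e) (lminor M lvl (lvl e)) p].

Lemma bip_at_dual l M p : l != 0 -> bip_at (- l) (dual M) p = bip_at l M p.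
Proof. by rewrite /bip_at oppr_gt0 dualK; case: ltgtP. Qed.

Lemma leveling_dual M lvl : leveling M lvl -> leveling (dual M) (opp_level lvl).
Proof.
move=> L e eM; have [p [n0 eqr bp]] := L e eM; exists p; split.
- by rewrite oppr_eq0.
- by rewrite /opp_level abszN.
- by rewrite lminor_dual bip_at_dual.
Qed.

Lemma leveling_ext M lvl lvl' :
  (forall e, e \in ground M -> lvl e = lvl' e) -> leveling M lvl -> leveling M lvl'.
Proof.
move=> eql L e eM; have [p [n0 eqr bp]] := L e eM; exists p.
by rewrite -eql // -(lminor_eq _ eql).
Qed.

(** Both signs of the level at once: the smallest element [p] of the part is
    exempt from positivity of the covector on the cyclic side and of the vector on
    the acyclic side. *)
Lemma leveling_at M lvl e : leveling M lvl -> e \in ground M -> exists p,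
  [/\ p \in ground M, lvl p = lvl e,
      forall f, f \in ground M -> lvl f = lvl e -> (p <= f)%O,
      lvl e != 0 /\ `|lvl e|%N = (rank p).+1 &
      exists x y, [/\ covec M x, vect M y,
        forall f, f \in ground M -> lvl f < lvl e -> x f = 0,
        forall f, f \in ground M -> lvl e < lvl f -> y f = 0 &
        forall f, f \in ground M -> lvl f = lvl e ->
          ((f != p) || (0 < lvl e) -> 0 < x f) /\
          ((f != p) || (lvl e < 0) -> 0 < y f)]].
Proof.
move=> L eM; have [p [n0 eqr]] := L e eM.
wlog gt0 : M lvl {L} eM n0 eqr / 0 < lvl e => [W|].
  have : (0 < lvl e) || (lvl e < 0) by lia.
  case/orP=> [gt0|lt0]; first exact: W.
    rewrite -bip_at_dual // -lminor_dual => bd.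
    have [||||p' [pM eql pmin [n0' eqr'] [x [y [Hx Hy xz yz xy]]]]] :=
      W (dual M) (opp_level lvl) eM.
    - by rewrite oppr_eq0.
    - by rewrite abszN.
    - by rewrite /opp_level oppr_gt0.
    - by [].
    have epp : p' = p by apply: rank_inj; move: eqr'; rewrite abszN eqr => -[].
    exists p'; split=> //.
    - exact: oppr_inj.
    - by move=> f fM eqf; apply: pmin => //; rewrite /opp_level eqf.
    - by rewrite n0 eqr epp.
    exists y, x; split=> // f fM.
    - by move=> lf; apply: yz => //; rewrite ltrN2.
    - by move=> lf; apply: xz => //; rewrite ltrN2.
    move=> eqf; have [|xp yp] := xy f fM; first by rewrite /opp_level eqf.
    by move: xp yp; rewrite epp /opp_level oppr_gt0 oppr_lt0.
rewrite /bip_at gt0 => -[mp [x [[x0 [X0 X1 X2]] xp]] [y [[y0 [Y0 Y1 Y2]] yp]]].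
have := is_min_in mp; rewrite in_lminor => /andP[pM /eqP eql].
have inl f : f \in ground M -> lvl f = lvl e -> f \in ground (lminor M lvl (lvl e)).
  by move=> fM eqf; rewrite in_lminor fM eqf eqxx.
exists p; split=> //.
  by move=> f fM eqf; apply: (is_minP mp); apply: inl.
exists x0, y0; split=> // [f fM lf|f fM lf|f fM eqf].
- by apply: X1; rewrite ?inE.
- by apply: Y1; rewrite ?inE.
have fL := inl f fM eqf; rewrite X2 // Y2 //; split; first by rewrite xp.
by rewrite ltNge (ltW gt0) orbF => fp; apply: yp.
Qed.

(** For the pair of a digraph: [e] is in a directed cocycle all of whose
    elements are at least [a]. *)
Definition bounded_covec M e a : Prop := exists x,
  [/\ covec M x, forall f, f \in ground M -> 0 <= x f, 0 < x e &
      forall f, f \in ground M -> (f < a)%O -> x f = 0].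

Lemma exists_argmax (Q : E -> Prop) (h : E -> int) : (exists c, Q c) ->
  exists c, Q c /\ forall c', Q c' -> h c' <= h c.
Proof.
case=> c0 Qc0; have Qb : `[< Q c0 >] by apply/asboolP.
case: (@arg_maxP _ _ _ c0 (fun c => `[< Q c >]) h Qb) => c /asboolP Qc H.
by exists c; split=> // c' Qc'; apply: H; apply/asboolP.
Qed.

(** If x is such a covector, let f be an element of its support of smallest
    level; the vector attached to that level vanishes above it and is positive on
    the part, so x has to vanish on the part, unless the smallest element of the
    part is in the support, that is, unless the level is large enough. Conversely,
    if no covector is supported by the levels from that of [e] on, the alternative
    gives a vector that is nonnegative there, and the covector attached to the
    largest level of its support contradicts orthogonality. *)
Lemma leveling_char M lvl e a : wf M -> leveling M lvl -> e \in ground M ->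
  bounded_covec M e a <-> (rank a)%:Z < lvl e.
Proof.
move=> wM L eM; split=> [[x [Hx xge xe xlt]]|lt_ae].
  rewrite ltNge; apply/negP=> le_ea.
  have [|f [[fM xf] fmax]] := @exists_argmax (fun f => f \in ground M /\ x f != 0) (opp_level lvl).
    by exists e; rewrite gt_eqF.
  have le_fa : lvl f <= rank a.
    by apply: le_trans le_ea; rewrite -lerN2 fmax // gt_eqF.
  have [p [pM eqp pmin [n0 eqr] [x' [y [_ Hy _ yz yp]]]]] := leveling_at L fM.
  have ypos g : g \in ground M -> x g != 0 -> lvl g = lvl f -> 0 < y g.
    move=> gM xg eqg; have [_] := yp g gM eqg; apply.
    have [egp|//] := eqVneq g p; rewrite ltNge /=.
    apply/negP=> lf0; move: xg; rewrite egp xlt ?eqxx // -ltn_rank.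
    by move: eqr le_fa; lia.
  have xy g : g \in ground M -> 0 <= x g * y g.
    move=> gM; have [->|xg] := eqVneq (x g) 0; first by rewrite mul0r.
    have := fmax g (conj gM xg); rewrite lerN2 le_eqVlt => /predU1P[eqg|lt_fg].
      by rewrite mulr_ge0 ?xge // ltW // ypos.
    by rewrite yz // mulr0.
  have := orth_nonneg wM Hx Hy xy fM.
  by move/eqP; rewrite mulf_eq0 (negPf xf) gt_eqF // ypos.
pose C := [set f | lvl f < lvl e].
have dis : [disjoint C & set0 : {set E}] by rewrite -setI_eq0 setI0.
have eC : e \notin C by rewrite inE ltxx.
have e0 : e \notin set0 by rewrite inE.
case: (nonneg_painting wM dis eM eC e0) => [[x [Hx xe xC xge]]|[y [Hy ye _ yge]]].
  exists x; split=> // f fM.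
    have [fC|fC] := boolP (f \in C); first by rewrite xC.
    by apply: xge; rewrite // inE.
  move=> lt_fa; apply: xC => //; rewrite inE.
  have [p [pM eqp pmin [n0 eqr] _]] := leveling_at L fM.
  have := pmin f fM erefl; rewrite -leq_rank; move: lt_fa; rewrite -ltn_rank.
  by move: eqr lt_ae; lia.
have [|f [[fM yf] fmax]] := @exists_argmax (fun f => f \in ground M /\ y f != 0) lvl.
  by exists e; rewrite gt_eqF.
have [p [pM eqp pmin [n0 eqr] [x [y' [Hx _ xz _ xp]]]]] := leveling_at L fM.
have le_ef : lvl e <= lvl f by apply: fmax; rewrite gt_eqF.
have f0 : 0 < lvl f by lia.
have xpos g : g \in ground M -> lvl g = lvl f -> 0 < x g.
  by move=> gM eqg; have [H _] := xp g gM eqg; apply: H; rewrite f0 orbT.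
have ypos g : g \in ground M -> lvl g = lvl f -> 0 <= y g.
  by move=> gM eqg; apply: yge; rewrite ?inE // eqg -leNgt.
have xy g : g \in ground M -> 0 <= x g * y g.
  move=> gM; have [->|yg] := eqVneq (y g) 0; first by rewrite mulr0.
  have := fmax g (conj gM yg); rewrite le_eqVlt => /predU1P[eqg|lt_fg].
    by rewrite mulr_ge0 ?ypos // ltW // xpos.
  by rewrite xz // mul0r.
have := orth_nonneg wM Hx Hy xy fM.
by move/eqP; rewrite mulf_eq0 (negPf yf) gt_eqF // xpos.
Qed.

Lemma leveling_le M lvl lvl' e : wf M -> leveling M lvl -> leveling M lvl' ->
  e \in ground M -> 0 < lvl e -> lvl e <= lvl' e.
Proof.
move=> wM L L' eM gt0; have [p [_ eqr _]] := L e eM.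
have : (rank p)%:Z < lvl e by move: eqr; lia.
by move/(leveling_char p wM L eM)/(leveling_char p wM L' eM); move: eqr; lia.
Qed.

(** [leveling_char] determines positive levels, and by duality negative ones. *)
Lemma leveling_uniq M lvl lvl' : wf M -> leveling M lvl -> leveling M lvl' ->
  forall e, e \in ground M -> lvl e = lvl' e.
Proof.
move=> wM L L' e eM; have [p [n0 eqr _]] := L e eM; have [p' [n0' eqr' _]] := L' e eM.
have := leveling_le wM L L' eM; have := leveling_le wM L' L eM.
have wM' := wf_dual wM; have D := leveling_dual L; have D' := leveling_dual L'.
have := leveling_le wM' D D' eM; have := leveling_le wM' D' D eM.
by rewrite /opp_level; lia.
Qed.

(** The property of levels given by [leveling_char], as a definition. *)
Definition level_spec M e l : Prop :=
  (exists p, l = (rank p).+1%:Z /\ forall a, bounded_covec M e a <-> (a <= p)%O) \/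
  (exists p, l = - (rank p).+1%:Z /\ forall a, bounded_covec (dual M) e a <-> (a <= p)%O).

Lemma level_spec_dual M e l : level_spec M e l -> level_spec (dual M) e (- l).
Proof.
case=> [] [p [-> H]]; [right|left]; exists p; rewrite ?opprK ?dualK; by [].
Qed.

Lemma bounded_covec_le M e a b : (a <= b)%O -> bounded_covec M e b -> bounded_covec M e a.
Proof.
move=> ab [x [Hx xge xe xlt]]; exists x; split=> // f fM fa; apply: xlt => //.
exact: lt_le_trans ab.
Qed.

(** [p] is the largest a for which [e] is in the support of a nonnegative
    covector bounded by a. *)
Lemma level_spec_exists M e : wf M -> e \in ground M -> exists l, level_spec M e l.
Proof.
have half M' : (exists x, [/\ covec M' x, 0 < x e &
      forall f, f \in ground M' -> 0 <= x f]) ->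
    exists p, forall a, bounded_covec M' e a <-> (a <= p)%O.
  case=> x [Hx xe xge].
  have [|p [Hp pmax]] := @exists_argmax (bounded_covec M' e) (fun a => (rank a)%:Z).
    have [|a [_ amin]] := @exists_least _ _ (fun _ : E => True); first by exists e.
    exists a; exists x; split=> // f _ fa.
    by have := amin f I; rewrite leNgt fa.
  exists p => a; split=> [/pmax|ap]; first by rewrite -leq_rank.
  exact: bounded_covec_le Hp.
move=> wM eM; case: (nonneg_alternative wM eM) => [/(half M)|/(half (dual M))] [p Hp].
  by exists (rank p).+1%:Z; left; exists p.
by exists (- (rank p).+1%:Z); right; exists p.
Qed.

(** The smallest element of the support of a bounding covector. *)
Lemma bounded_covec_least M e a : wf M -> e \in ground M -> bounded_covec M e a ->
  exists m, [/\ m \in ground M, (a <= m)%O, bounded_covec M e m & bounded_covec M m m].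
Proof.
move=> wM eM [x [Hx xge xe xlt]].
have [|m [[mM xm] mmin]] := @exists_least _ _ (fun f => f \in ground M /\ x f != 0).
  by exists e; rewrite gt_eqF.
have xlt' f : f \in ground M -> (f < m)%O -> x f = 0.
  move=> fM fm; apply/eqP; apply: contraT => xf.
  by have := mmin f (conj fM xf); rewrite leNgt fm.
exists m; split=> //.
- by rewrite leNgt; apply/negP=> /(xlt _ mM)/eqP; rewrite (negPf xm).
- by exists x.
- by exists x; split=> //; rewrite lt_neqAle eq_sym xm xge.
Qed.

Section FromSpec.
Variables (M : opair (E := E)) (lvl : E -> int).
Hypotheses (wM : wf M) (spec : forall e, e \in ground M -> level_spec M e (lvl e)).

Lemma spec_char e a : e \in ground M -> bounded_covec M e a <-> (rank a)%:Z < lvl e.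
Proof.
move=> eM; case: (spec eM) => [] [p [-> H]].
  by rewrite H -leq_rank; split; lia.
split; last by lia.
case=> x [Hx xge xe _]; exfalso.
have [y [Hy yge ye _]] : bounded_covec (dual M) e p by apply/H; rewrite lexx.
have xy f : f \in ground M -> 0 <= x f * y f.
  by move=> fM; rewrite mulr_ge0 ?xge ?yge.
have := orth_nonneg wM Hx Hy xy eM.
by move/eqP; rewrite mulf_eq0 !gt_eqF.
Qed.

Lemma spec_bound e a : e \in ground M -> (rank a)%:Z < lvl e -> (a <= e)%O.
Proof.
move=> eM /(spec_char _ eM) [x [_ _ xe xlt]]; rewrite leNgt; apply/negP=> ea.
by move: xe; rewrite xlt // ltxx.
Qed.

(** The covector required by [bip] is a sum of extremal ones. If the vector did
    not exist, the alternative would give a covector x vanishing at p and below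
    level [l], nonnegative at level [l] and positive at some f of that level.
    Adding a large multiple of a covector which is positive above level [l] makes
    x nonnegative, with a support that contains f and starts strictly above p, so
    the level of f would be larger than [l]. *)
Lemma spec_level_set l : 0 < l -> (exists2 e, e \in ground M & lvl e = l) ->
  exists p, l = (rank p).+1%:Z /\ bip (lminor M lvl l) p.
Proof.
move=> l0 [e eM eql].
have [p eqp] : exists p, l = (rank p).+1%:Z.
  by rewrite -eql; case: (spec eM) => [] [p [eqp _]]; exists p; lia.
exists p; split=> //.
have bp : bounded_covec M e p by apply/spec_char => //; lia.
have [m [mM pm /(spec_char _ eM) bem /(spec_char _ mM) bmm]] := bounded_covec_least wM eM bp.
have emp : m = p.
  by apply: rank_inj; move: pm bem; rewrite -leq_rank; lia.
move: mM bmm; rewrite {m pm bem}emp => pM bpp.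
have lvlp : lvl p = l.
  apply: le_anti; apply/andP; split; last by lia.
  rewrite leNgt; apply/negP=> lt_lp.
  case: (spec pM) => [] [p' [eqp' H]]; last by lia.
  have pp' : (p < p')%O by rewrite -ltn_rank; lia.
  have /(spec_bound pM) : (rank p')%:Z < lvl p by lia.
  by rewrite leNgt pp'.
have above f : f \in ground M -> l <= lvl f -> exists x, [/\ covec M x, 0 < x f,
    forall g, g \in ground M -> lvl g < lvl f -> x g = 0 &
    forall g, g \in ground M -> 0 <= x g].
  move=> fM lf.
  case: (spec fM) => [] [q [eqq H]]; last by lia.
  have [x [Hx xge xf xlt]] : bounded_covec M f q by apply/H; rewrite lexx.
  exists x; split=> // g gM lg; apply/eqP; apply: contraT => xg.
  have : bounded_covec M g q by exists x; split; rewrite // lt_neqAle eq_sym xg xge.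
  by move/(spec_char _ gM); lia.
split.
- apply: is_minI; first by rewrite in_lminor pM lvlp eqxx.
  move=> f; rewrite in_lminor => /andP[fM /eqP eqf].
  by apply: spec_bound => //; rewrite eqf eqp; lia.
- have [|x [Hx xZ xp]] := @covec_sum _ _ M [set f in ground M | l <= lvl f]
    [set f in ground M | lvl f < l] wM.
    move=> f; rewrite inE => /andP[fM lf].
    have [x [Hx xf xz xge]] := above f fM lf; exists x; split=> // g.
      by rewrite inE => /andP[gM lg]; apply: xz => //; lia.
    by rewrite inE => /andP[gM lg]; apply: xge.
  exists x; split.
    by exists x; split=> // f fM; rewrite inE => lf; apply: xZ; rewrite inE fM.
  by move=> f; rewrite in_lminor => /andP[fM /eqP eqf]; apply: xp; rewrite inE fM eqf lexx.
have [|u [Hu uZ up]] := @covec_sum _ _ M [set f in ground M | l < lvl f]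
  [set f in ground M | lvl f <= l] wM.
  move=> f; rewrite inE => /andP[fM lf].
  have [x [Hx xf xz xge]] := above f fM (ltW lf); exists x; split=> // g.
    by rewrite inE => /andP[gM lg]; apply: xz => //; lia.
  by rewrite inE => /andP[gM lg]; apply: xge.
have [|y [Hy yZ yp]] := @covec_sum _ _ (dual M)
  [set f in ground M | (lvl f == l) && (f != p)]
  [set f in ground M | l < lvl f] (wf_dual wM); last first.
  exists y; split.
    by exists y; split=> // f fM; rewrite inE => lf; apply: yZ; rewrite inE fM.
  move=> f; rewrite in_lminor => /andP[fM /eqP eqf] fp; apply: yp.
  by rewrite inE fM eqf eqxx.
move=> f; rewrite inE => /and3P[fM /eqP eqf fp].
pose C := p |: [set g | lvl g < l]; pose D := [set g | l < lvl g].
have dis : [disjoint C & D].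
  rewrite -setI_eq0; apply/eqP/setP=> g; rewrite !inE.
  by case: eqVneq => [->|] /=; [rewrite lvlp ltxx|case: ltgtP].
have fC : f \notin C by rewrite !inE (negPf fp) eqf ltxx.
have fD : f \notin D by rewrite !inE eqf ltxx.
case: (nonneg_painting wM dis fM fC fD) => [[x [Hx xf xC xge]]|[y [Hy yf yD yge]]]; last first.
  exists y; split=> // g; rewrite inE => /andP[gM].
    by move=> lg; apply: yD; rewrite ?inE.
  by case/andP=> /eqP eqg gp; apply: yge; rewrite // !inE ?(negPf gp) eqg ltxx.
have [K [K0 KD]] := dominate x up.
(* v is nonnegative, vanishes at p and below level l, and is positive at f *)
exfalso; pose v := fun g => x g + K * u g.
have ulow g : g \in ground M -> lvl g <= l -> v g = x g.
  by move=> gM lg; rewrite /v uZ ?mulr0 ?addr0 // inE gM.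
have Hv : covec M v by apply: covecD => //; apply: covec_scale.
have vge g : g \in ground M -> 0 <= v g.
  move=> gM; have [lg|lg] := ltP l (lvl g); first by apply: KD; rewrite inE gM.
  rewrite ulow //; have [gC|gC] := boolP (g \in C); first by rewrite xC.
  by apply: xge => //; rewrite inE -leNgt.
have vf : 0 < v f by rewrite ulow // eqf.
have low g : g \in ground M -> v g != 0 -> l <= lvl g.
  move=> gM vg; rewrite leNgt; apply/negP=> lg; move: vg.
  by rewrite ulow ?ltW // xC ?eqxx // !inE lg orbT.
have [|a [[aM va] amin]] := @exists_least _ _ (fun g => g \in ground M /\ v g != 0).
  by exists f; rewrite gt_eqF.
have /(spec_char _ fM) : bounded_covec M f a.
  exists v; split=> // g gM ga; apply/eqP; apply: contraT => vg.
  by have := amin g (conj gM vg); rewrite leNgt ga.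
rewrite eqf eqp => rank_a.
have pa : (p <= a)%O by apply: spec_bound => //; have := low a aM va; lia.
have eap : a = p by apply: rank_inj; move: pa; rewrite -leq_rank; lia.
by move: va; rewrite eap ulow ?lvlp // xC ?eqxx // !inE eqxx.
Qed.
End FromSpec.

Lemma leveling_exists M : wf M -> exists lvl, leveling M lvl.
Proof.
move=> wM.
have [lvl spec] : {lvl : E -> int & forall e, e \in ground M -> level_spec M e (lvl e)}.
  apply: (@choice _ _ (fun e l => e \in ground M -> level_spec M e l)) => e.
  have [eM|eM] := boolP (e \in ground M); last by exists 0.
  by have [l Hl] := level_spec_exists wM eM; exists l.
exists lvl => e eM; case: (ltgtP (lvl e) 0) => [lt0|gt0|eq0].
- have spec' f : f \in ground (dual M) -> level_spec (dual M) f (opp_level lvl f).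
    by move=> fM; apply/level_spec_dual/spec.
  have gt0 : 0 < - lvl e by rewrite oppr_gt0.
  have [|p [eqp bp]] := spec_level_set (wf_dual wM) spec' gt0; first by exists e.
  exists p; split; [by []|by lia|].
  rewrite -bip_at_dual; last by rewrite lt_eqF.
  by rewrite -lminor_dual /bip_at oppr_gt0 lt0.
- have [|p [eqp bp]] := spec_level_set wM spec gt0; first by exists e.
  by exists p; split; [by []|lia|rewrite /bip_at gt0].
by case: (spec e eM) => [] [p []]; rewrite eq0; lia.
Qed.
End Levels.

(** * Active spanning trees under deletion and contraction *)
Section ActiveBasis.
Context {disp : Order.disp_t} {E : finOrderType disp}.
Implicit Types (A C D F S T U Z : {set E}) (a b c e f g m p w : E) (x y z : E -> rat).
Implicit Types (M N : opair (E := E)) (lvl : E -> int) (l : int).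

(** The notion does not record the type of the pair: by [optimal_in] and
    [optimal_bip_at] this type is equivalent to the side on which [p] lies. *)
Definition fully_opt M T : Prop := exists p, is_min (ground M) p /\ optimal M p T.

Lemma fully_opt_uniq M T T' : wf M -> fully_opt M T -> fully_opt M T' -> T = T'.
Proof.
move=> wM [p [mp oT]] [p' [mp' oT']]; rewrite (is_min_uniq mp' mp) in oT'.
exact: optimal_uniq oT oT'.
Qed.

Lemma fully_opt_dual M T : fully_opt M T -> fully_opt (dual M) (ground M :\: T).
Proof. by case=> p [mp oT]; exists p; split=> //; apply: optimal_dual. Qed.

Lemma fully_opt_sub M T : fully_opt M T -> T \subset ground M.
Proof. by case=> p [_ []]. Qed.

Lemma bip_at_min l M p : bip_at l M p -> is_min (ground M) p.
Proof. by rewrite /bip_at; case: ifP => _ []. Qed.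

Lemma fully_opt_exists M l p : wf M -> bip_at l M p -> exists T, fully_opt M T.
Proof.
move=> wM bM; have := bM; rewrite /bip_at; case: ifP => _.
  by case/(optimal_exists wM) => T [oT _]; exists T, p; split; rewrite // (bip_at_min bM).
case/(optimal_exists (wf_dual wM)) => T [oT _]; exists (ground M :\: T).
by rewrite -[M in fully_opt M]dualK; apply: fully_opt_dual; exists p; split; rewrite // (bip_at_min bM).
Qed.

Lemma optimal_in l M p T : wf M -> bip_at l M p -> optimal M p T -> (p \in T) = (0 < l).
Proof.
move=> wM bM oT; have mp := bip_at_min bM; move: bM; rewrite /bip_at.
case: ifP => _ bM.
  by apply: contraT => pT; case: (bip_excl wM bM (optimal_bipd wM mp oT pT)).
by apply/negbTE/negP=> pT; case: (bip_excl wM (optimal_bip wM mp oT pT) bM).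
Qed.

Lemma optimal_bip_at l M p T : wf M -> is_min (ground M) p -> optimal M p T ->
  (p \in T) = (0 < l) -> bip_at l M p.
Proof.
move=> wM mp oT pT; rewrite /bip_at -pT; case: ifP => [pT'|/negbT pT'].
  exact: optimal_bip oT pT'.
exact: optimal_bipd oT pT'.
Qed.

Section BipAt.
Variables (M : opair (E := E)) (p w : E) (l : int).
Hypotheses (wM : wf M) (mw : is_max (ground M) w) (wp : w != p).

Let wM' := wf_dual wM.

Lemma bip_at_minor : bip_at l M p -> bip_at l (del M w) p \/ bip_at l (con M w) p.
Proof.
rewrite /bip_at; case: ifP => _; first exact: bip_minor.
by rewrite dual_del dual_con => /(bip_minor wM' mw wp) []; [right|left].
Qed.

Lemma bip_at_reverse_minors : bip_at l M p -> bip_at l (reverse M w) p ->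
  bip_at l (del M w) p /\ bip_at l (con M w) p.
Proof.
rewrite /bip_at; case: ifP => _; first exact: bip_reverse_minors.
by rewrite dual_del dual_con dual_reverse => /(bip_reverse_minors wM' mw wp) H /H [].
Qed.

Lemma bip_at_both : bip_at l (del M w) p -> bip_at l (con M w) p ->
  ~ coloop M w -> ~ coloop (dual M) w -> bip_at l M p.
Proof.
rewrite /bip_at; case: ifP => _; first exact: bip_both.
by rewrite dual_del dual_con => b1 b2 nc nl; apply: (bip_both wM' mw wp); rewrite ?dualK.
Qed.
End BipAt.

Lemma bip_at_noloop l M p w : wf M -> bip_at l M p -> w \in ground M ->
  w != p -> ~ coloop M w /\ ~ coloop (dual M) w.
Proof.
move=> wM; rewrite /bip_at; case: ifP => _ bM wG wp; first exact: bip_noloop bM _ _.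
by have [] := bip_noloop (wf_dual wM) bM wG wp; rewrite dualK.
Qed.

Definition slice T lvl l := T :&: [set f | lvl f == l].

Definition level_optimal M lvl T : Prop :=
  T \subset ground M /\
  forall e, e \in ground M -> fully_opt (lminor M lvl (lvl e)) (slice T lvl (lvl e)).

(** The active spanning tree: its trace on each part is the fully optimal tree
    of the active minor. *)
Definition active_basis M T : Prop := exists lvl, leveling M lvl /\ level_optimal M lvl T.

Lemma level_optimal_ext M lvl lvl' T :
  (forall e, e \in ground M -> lvl e = lvl' e) -> level_optimal M lvl T ->
  level_optimal M lvl' T.
Proof.
move=> eql [sT H]; split=> // e eM; have := H e eM.
rewrite -eql // (lminor_eq _ eql); congr fully_opt.
apply/setP=> f; rewrite !inE; case fT: (f \in T) => //=.
by rewrite eql // (subsetP sT).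
Qed.

Lemma active_basis_level M lvl T : wf M -> leveling M lvl -> active_basis M T ->
  level_optimal M lvl T.
Proof.
move=> wM L [lvl' [L' H]]; apply: level_optimal_ext H.
exact: (leveling_uniq wM L' L).
Qed.

Lemma active_basis_exists M : wf M -> exists T, active_basis M T.
Proof.
move=> wM; have [lvl L] := leveling_exists wM.
have [tau Htau] : {tau : E -> {set E} & forall e, e \in ground M ->
    fully_opt (lminor M lvl (lvl e)) (tau e)}.
  apply: (@choice _ _ (fun e T => e \in ground M -> fully_opt (lminor M lvl (lvl e)) T)) => e.
  have [eM|eM] := boolP (e \in ground M); last by exists set0.
  have [p [_ _ bp]] := L e eM.
  by have [T HT] := fully_opt_exists (wf_lminor _ _ wM) bp; exists T.
exists [set e in ground M | e \in tau e], lvl; split=> //; split.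
  by apply/subsetP=> e; rewrite inE => /andP[].
move=> e eM; suff -> : slice [set e in ground M | e \in tau e] lvl (lvl e) = tau e.
  exact: Htau.
have sub f : f \in tau e -> (f \in ground M) && (lvl f == lvl e).
  by move/(subsetP (fully_opt_sub (Htau e eM))); rewrite in_lminor.
have same f : f \in ground M -> lvl f = lvl e -> tau f = tau e.
  move=> fM eqf; apply: fully_opt_uniq (wf_lminor lvl (lvl e) wM) _ (Htau e eM).
  by rewrite -eqf; apply: Htau.
apply/setP=> f; rewrite !inE; apply/idP/idP => [/andP[/andP[fM ft] /eqP eqf]|ft].
  by rewrite -(same f).
by have /andP[fM /eqP eqf] := sub f ft; rewrite fM eqf eqxx (same f) // ft.
Qed.

Lemma active_basis_dual M T : active_basis M T -> active_basis (dual M) (ground M :\: T).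
Proof.
case=> lvl [L [sT H]]; exists (opp_level lvl); split; first exact: leveling_dual.
split; first exact: subsetDl.
move=> e eM; rewrite lminor_dual; have := fully_opt_dual (H e eM); congr fully_opt.
apply/setP=> f; rewrite in_setD in_lminor !inE /opp_level eqr_opp.
by case: (f \in ground M); case: (f \in T); case: (lvl f == lvl e).
Qed.

(** The leveling of a bipolar or cyclic-bipolar pair is constant. *)
Lemma active_basis_fully_opt M l p T : wf M -> l != 0 -> `|l|%N = (rank p).+1 ->
  bip_at l M p -> fully_opt M T -> active_basis M T.
Proof.
move=> wM l0 eql bM oT; exists (fun _ => l).
have eqM : lminor M (fun _ => l) l = M.
  apply: wf_eq => //; first exact: wf_lminor.
    by apply/setP=> e; rewrite in_lminor eqxx andbT.
  move=> x; split=> [[x0 [H0 _ H2]]|Hx].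
    apply: (sub_ext (covec_sub wM)) H0 => e eM; apply: H2.
    by have := in_lminor M (fun _ => l) l e => /= ->; rewrite eM eqxx.
  by exists x; split=> // e _; rewrite inE ltxx.
split; first by move=> e _; exists p; rewrite eqM.
split; first exact: fully_opt_sub.
move=> e _; rewrite eqM; have -> // : slice T (fun _ => l) l = T.
by apply/setP=> f; rewrite !inE eqxx andbT.
Qed.

Section LevelMinors.
Variables (M : opair (E := E)) (w : E) (lvl : E -> int).
Hypotheses (wM : wf M) (wG : w \in ground M).

(** At a level lower than that of [w], covectors may take any value at [w]. At
    a higher level, a covector that vanishes on all elements below that level
    other than [w] also vanishes at [w], by orthogonality with the given vector. *)
Lemma lminor_del l :
  (exists y, [/\ vect M y, y w != 0 &
     forall f, f \in ground M -> lvl w < lvl f -> y f = 0]) ->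
  l != lvl w -> lminor (del M w) lvl l = lminor M lvl l.
Proof.
move=> [y [Hy yw yz]] lw; apply: wf_eq; try by apply: wf_lminor; rewrite ?wf_del.
  by exact: wf_lminor (wf_del w wM).
  apply/setP=> e; rewrite !in_lminor in_del.
  by case: eqVneq => //= ->; rewrite eq_sym (negPf lw) andbF.
have inG e : e \in ground (lminor M lvl l) -> e != w.
  by rewrite in_lminor => /andP[_ /eqP el]; apply: contraNneq lw => <-; rewrite el.
move=> x; split=> [[x1 [/covec_del [x0 [H0 H1]] H2 H3]]|[x0 [H0 H1 H2]]].
  have x0z f : f \in ground M -> f != w -> lvl f < l -> x0 f = 0.
    by move=> fM fw lf; rewrite H1 // H2 ?in_del ?fw // inE.
  exists x0; split=> // e.
    move=> eM; rewrite inE => le; have [ew|ew] := eqVneq e w; last exact: x0z.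
    have := orth wM H0 Hy; rewrite (bigD1 w) //= big1 ?addr0 => [|f /andP[fM fw]].
      by rewrite ew => /eqP; rewrite mulf_eq0 (negPf yw) orbF => /eqP.
    have [lf|lf] := ltP (lvl f) l; first by rewrite x0z // mul0r.
    by rewrite yz ?mulr0 //; apply: lt_le_trans lf; rewrite -ew.
  move=> eG; have ew := inG e eG; have := eG; rewrite in_lminor => /andP[eM el].
  rewrite H1 // H3 //.
  by have := in_lminor (del M w) lvl l e; rewrite in_del ew eM el.
exists x0; split; first by apply/covec_del; exists x0.
  by move=> e; rewrite in_del => /andP[_ eM]; apply: H1.
move=> e eG; apply: H2; move: eG; have := in_lminor (del M w) lvl l e => /= ->.
have := in_lminor M lvl l e => /= ->; have := in_del M w e => /= ->.
by case/andP=> /andP[_ ->] ->.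
Qed.

Lemma lminor_del_same : lminor (del M w) lvl (lvl w) = del (lminor M lvl (lvl w)) w.
Proof.
rewrite /lminor /del !minor_minor // ?set0U ?setU0.
- by rewrite setUC.
- by rewrite -setI_eq0; apply/eqP/setP=> e; rewrite !inE; case: eqVneq => [->|_];
  [rewrite ltxx|case: ltgtP]; rewrite ?andbF ?orbF.
- by rewrite -setI_eq0; apply/eqP/setP=> e; rewrite !inE; case: eqVneq => [->|_];
  [rewrite ltxx|case: ltgtP]; rewrite ?andbF ?orbF.
Qed.

Lemma lminor_reverse l : l != lvl w -> lminor (reverse M w) lvl l = lminor M lvl l.
Proof.
move=> lw; rewrite /lminor reverse_minor reverse_out //; first exact: wf_lminor.
by have := in_lminor M lvl l w => ->; rewrite eq_sym (negPf lw) andbF.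
Qed.

Lemma lminor_reverse_same :
  lminor (reverse M w) lvl (lvl w) = reverse (lminor M lvl (lvl w)) w.
Proof. exact: reverse_minor. Qed.
End LevelMinors.

Lemma lminor_con M w lvl l : wf M -> w \in ground M ->
  (exists x, [/\ covec M x, x w != 0 &
     forall f, f \in ground M -> lvl f < lvl w -> x f = 0]) ->
  l != lvl w -> lminor (con M w) lvl l = lminor M lvl l.
Proof.
move=> wM wG [x [Hx xw xz]] lw.
rewrite -[LHS]dualK -lminor_dual dual_con (@lminor_del (dual M) w (opp_level lvl)) //.
- by rewrite lminor_dual dualK.
- exact: wf_dual.
- by exists x; split=> // f fM; rewrite ltrN2; apply: xz.
- by rewrite /opp_level eqr_opp.
Qed.

Lemma lminor_con_same M w lvl : wf M ->
  lminor (con M w) lvl (lvl w) = con (lminor M lvl (lvl w)) w.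
Proof.
move=> wM; rewrite -[LHS]dualK -lminor_dual dual_con.
rewrite (@lminor_del_same (dual M) w (opp_level lvl)) ?lminor_dual //; last exact: wf_dual.
by rewrite dual_del dualK.
Qed.

(** A pair that has the same level minors as [M] except at the level of [w] is
    leveled by the same function if and only if that level minor is bipolar of the
    right type. *)
Lemma leveling_transfer M N lvl w p : leveling M lvl ->
  {subset ground N <= ground M} -> lvl w != 0 -> `|lvl w|%N = (rank p).+1 ->
  (forall l, l != lvl w -> lminor N lvl l = lminor M lvl l) ->
  (exists2 e, e \in ground N & lvl e = lvl w) ->
  leveling N lvl <-> bip_at (lvl w) (lminor N lvl (lvl w)) p.
Proof.
move=> L sub w0 eqw eqN [e0 e0N eq0]; split=> [LN|bN e eN].
  have [p' []] := LN e0 e0N; rewrite eq0 eqw => _ eqp bN.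
  by have -> : p = p' by apply: rank_inj; case: eqp.
have [eqe|ne] := eqVneq (lvl e) (lvl w); first by exists p; rewrite eqe.
by have [q [n0 eqr bq]] := L e (sub e eN); exists q; rewrite eqN.
Qed.

Section Top.
Variables (M : opair (E := E)) (w : E) (lvl : E -> int).
Hypotheses (wM : wf M) (mw : is_max (ground M) w).
Hypotheses (nc : ~ coloop M w) (nl : ~ coloop (dual M) w) (L : leveling M lvl).

Let wG : w \in ground M. Proof. by case/andP: mw. Qed.
Let Mw := lminor M lvl (lvl w).
Let wMw : wf Mw := wf_lminor _ _ wM.

(** If [w] were the smallest element of its part, [leveling_char] would give a
    nonnegative covector (or vector) supported by elements at least [w], so [w]
    would be a coloop (or a loop). *)
Lemma top_above p : `|lvl w|%N = (rank p).+1 -> p != w.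
Proof.
move=> eqr; apply/negP=> /eqP epw; rewrite {p}epw in eqr.
have aux M' lvl' : wf M' -> ground M' = ground M -> ~ coloop M' w -> leveling M' lvl' ->
    lvl' w = (rank w).+1%:Z -> False.
  move=> wM' eqG nc' L' eqw; apply: nc'.
  have wG' : w \in ground M' by rewrite eqG.
  have /(leveling_char w wM' L' wG') [x [Hx xge xw xlt]] : (rank w)%:Z < lvl' w by lia.
  exists x; split; rewrite ?gt_eqF // => e eM ew; apply: xlt => //.
  by rewrite lt_neqAle ew (is_maxP mw) // -eqG.
case: (ltgtP (lvl w) 0) => [lt0|gt0|eq0].
- apply: (aux (dual M) (opp_level lvl)) => //; first exact: wf_dual.
    exact: leveling_dual.
  by rewrite /opp_level; lia.
- by apply: (aux M lvl) => //; lia.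
- by rewrite eq0 in eqr.
Qed.

(** As [w] is not the exempt element of its part, both the covector and the
    vector attached to its level are positive at [w]. *)
Lemma top_level : exists p x y,
  [/\ w != p /\ `|lvl w|%N = (rank p).+1, bip_at (lvl w) Mw p,
      covec M x /\ vect M y, 0 < x w /\ 0 < y w &
      (forall f, f \in ground M -> lvl f < lvl w -> x f = 0) /\
      (forall f, f \in ground M -> lvl w < lvl f -> y f = 0)].
Proof.
have [p [pM eqp pmin [n0 eqr] [x [y [Hx Hy xz yz xy]]]]] := leveling_at L wG.
have wp : w != p by rewrite eq_sym top_above.
have [p' [_ eqr' bp]] := L wG.
have epp : p' = p by apply: rank_inj; move: eqr'; rewrite eqr => -[].
rewrite epp in bp; have [xw yw] := xy w wG erefl; rewrite wp /= in xw yw.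
by exists p, x, y; do !split=> //; [apply: xw|apply: yw].
Qed.

Lemma top_max : is_max (ground Mw) w.
Proof.
rewrite /is_max in_lminor wG eqxx; apply/forallP=> e; apply/implyP.
by rewrite in_lminor => /andP[eM _]; apply: (is_maxP mw).
Qed.

Lemma top_nonzero : lvl w != 0.
Proof. by have [p []] := L wG. Qed.

Section TopPrincipal.
Variable p : E.
Hypotheses (wp : w != p) (eqr : `|lvl w|%N = (rank p).+1) (bp : bip_at (lvl w) Mw p).

Let pM : p \in ground M /\ lvl p = lvl w.
Proof. by have := is_min_in (bip_at_min bp); rewrite in_lminor => /andP[? /eqP]. Qed.

Lemma other_del l : l != lvl w -> lminor (del M w) lvl l = lminor M lvl l.
Proof.
move=> lw; have [p' [x [y [_ _ [_ Hy] [_ yw] [_ yz]]]]] := top_level.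
by apply: lminor_del => //; exists y; rewrite gt_eqF.
Qed.

Lemma other_con l : l != lvl w -> lminor (con M w) lvl l = lminor M lvl l.
Proof.
move=> lw; have [p' [x [y [_ _ [Hx _] [xw _] [xz _]]]]] := top_level.
by apply: lminor_con => //; exists x; rewrite gt_eqF.
Qed.

Lemma leveling_delE : leveling (del M w) lvl <-> bip_at (lvl w) (del Mw w) p.
Proof.
rewrite -lminor_del_same //; apply: leveling_transfer L _ top_nonzero eqr other_del _.
  by move=> e; rewrite in_del => /andP[].
by have [pG eqp] := pM; exists p; rewrite // in_del eq_sym wp.
Qed.

Lemma leveling_conE : leveling (con M w) lvl <-> bip_at (lvl w) (con Mw w) p.
Proof.
rewrite -lminor_con_same //; apply: leveling_transfer L _ top_nonzero eqr other_con _.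
  by move=> e; rewrite in_con => /andP[].
by have [pG eqp] := pM; exists p; rewrite // in_con eq_sym wp.
Qed.

Lemma leveling_reverseE : leveling (reverse M w) lvl <-> bip_at (lvl w) (reverse Mw w) p.
Proof.
rewrite -lminor_reverse_same //; apply: leveling_transfer L _ top_nonzero eqr _ _ => //.
  by move=> l; apply: lminor_reverse.
by have [pG eqp] := pM; exists p.
Qed.
End TopPrincipal.

Lemma leveling_minor : leveling (del M w) lvl \/ leveling (con M w) lvl.
Proof.
have [p [x [y [[wp eqr] bp _ _ _]]]] := top_level.
case: (bip_at_minor wMw top_max wp bp) => b; [left|right].
  by apply/(leveling_delE wp eqr bp).
by apply/(leveling_conE wp eqr bp).
Qed.

Lemma leveling_reverse_minors : leveling (reverse M w) lvl ->
  leveling (del M w) lvl /\ leveling (con M w) lvl.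
Proof.
have [p [x [y [[wp eqr] bp _ _ _]]]] := top_level.
move/(leveling_reverseE eqr bp) => br.
have [b1 b2] := bip_at_reverse_minors wMw top_max wp bp br.
by split; [apply/(leveling_delE wp eqr bp)|apply/(leveling_conE wp eqr bp)].
Qed.

Lemma leveling_both : leveling (del M w) lvl -> leveling (con M w) lvl ->
  leveling (reverse M w) lvl.
Proof.
have [p [x [y [[wp eqr] bp _ _ _]]]] := top_level.
move/(leveling_delE wp eqr bp) => b1 /(leveling_conE wp eqr bp) b2.
apply/(leveling_reverseE eqr bp).
have wGw : w \in ground Mw by rewrite in_lminor wG eqxx.
have [c1 c2] := bip_at_noloop wMw bp wGw wp.
apply: (bip_at_both (w := w) (wf_reverse w wMw) top_max wp).
- by rewrite del_reverse.
- by rewrite con_reverse.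
- by rewrite coloop_reverse_iff.
- by rewrite dual_reverse coloop_reverse_iff.
Qed.

(** Outside the level of [w], the active basis is read in the minor or
    reorientation [N]. *)
Lemma level_optimal_patch N T : leveling N lvl ->
  (forall l, l != lvl w -> lminor N lvl l = lminor M lvl l) ->
  (forall e, e \in ground M -> e != w -> e \in ground N) ->
  level_optimal N lvl T ->
  forall T' p, T' \subset ground M -> (forall e, e != w -> (e \in T') = (e \in T)) ->
  is_min (ground Mw) p -> optimal Mw p (slice T' lvl (lvl w)) ->
  active_basis M T'.
Proof.
move=> LN eqN sub [sT H] T' p sT' eqT mp oT; exists lvl; split=> //; split=> // e eM.
have [eqe|ne] := eqVneq (lvl e) (lvl w); first by rewrite eqe; exists p.
have ew : e != w by apply: contraNneq ne => ->.
have -> : slice T' lvl (lvl e) = slice T lvl (lvl e).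
  apply/setP=> f; rewrite !inE; have [->|fw] := eqVneq f w; last by rewrite eqT.
  by rewrite eq_sym (negPf ne) !andbF.
by rewrite -eqN //; apply/H/sub.
Qed.
End Top.

Lemma slice_U1 T w lvl : slice (w |: T) lvl (lvl w) = w |: slice T lvl (lvl w).
Proof.
by apply/setP=> e; rewrite !inE; case: eqVneq => [->|_] //=; rewrite eqxx.
Qed.

Lemma optimal_slice M lvl w p T : wf M -> leveling M lvl -> active_basis M T ->
  is_min (ground (lminor M lvl (lvl w))) p ->
  optimal (lminor M lvl (lvl w)) p (slice T lvl (lvl w)).
Proof.
move=> wM L aT mp; have [sT H] := active_basis_level wM L aT.
have := is_min_in mp; rewrite in_lminor => /andP[pM /eqP eqp].
have := H p pM; rewrite eqp => -[q [mq oT]].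
by rewrite (is_min_uniq mp mq).
Qed.

Lemma slice_del M lvl w p T : wf M -> is_max (ground M) w -> w != p ->
  leveling (del M w) lvl -> active_basis (del M w) T ->
  is_min (ground (lminor M lvl (lvl w))) p ->
  optimal (del (lminor M lvl (lvl w)) w) p (slice T lvl (lvl w)).
Proof.
move=> wM mw wp L aT mp; have wG : w \in ground M by case/andP: mw.
rewrite -lminor_del_same //; apply: optimal_slice => //; first exact: wf_del.
by rewrite lminor_del_same // ground_del is_min_D1 //; apply: top_max.
Qed.

Lemma slice_con M lvl w p T : wf M -> is_max (ground M) w -> w != p ->
  leveling (con M w) lvl -> active_basis (con M w) T ->
  is_min (ground (lminor M lvl (lvl w))) p ->
  optimal (con (lminor M lvl (lvl w)) w) p (slice T lvl (lvl w)).
Proof.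
move=> wM mw wp L aT mp; have wG : w \in ground M by case/andP: mw.
rewrite -lminor_con_same //; apply: optimal_slice => //; first exact: wf_con.
by rewrite lminor_con_same // ground_con is_min_D1 //; apply: top_max.
Qed.

(** If [w] were at a higher level for the reversed pair, the covector attached
    to that level in the reversed pair and the vector attached to the level of [w]
    in [M] would meet only in [w], where neither vanishes. *)
Lemma leveling_insert M w lvl lvl' : wf M -> is_max (ground M) w ->
  ~ coloop M w -> ~ coloop (dual M) w -> leveling M lvl -> leveling (reverse M w) lvl' ->
  (forall e, e \in ground M -> e != w -> lvl e = lvl' e) -> lvl' w <= lvl w.
Proof.
move=> wM mw nc nl L L' eql; rewrite leNgt; apply/negP=> lt_w.
have wG : w \in ground M by case/andP: mw.
have nc' : ~ coloop (reverse M w) w by rewrite coloop_reverse_iff.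
have nl' : ~ coloop (dual (reverse M w)) w by rewrite dual_reverse coloop_reverse_iff.
have [p [x [y [_ _ [_ Hy] [_ yw] [_ yz]]]]] := top_level wM mw nc nl L.
have [p' [x' [y' [_ _ [Hx' _] [xw _] [xz _]]]]] := top_level (wf_reverse w wM) mw nc' nl' L'.
have := orth wM Hx' Hy; rewrite (bigD1 w) //= big1 ?addr0 => [|f /andP[fM fw]].
  by move/eqP; rewrite mulf_eq0 flip_eq0 !gt_eqF.
have [lf|lf] := ltP (lvl w) (lvl f); first by rewrite yz // mulr0.
rewrite flip_id // xz ?mul0r // -eql //; exact: le_lt_trans lt_w.
Qed.

Section Choice.
Variables (M : opair (E := E)) (w : E).
Hypotheses (wM : wf M) (mw : is_max (ground M) w).
Hypotheses (nc : ~ coloop M w) (nl : ~ coloop (dual M) w).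

Let wG : w \in ground M. Proof. by case/andP: mw. Qed.
Let wR : wf (reverse M w) := wf_reverse w wM.

Section Leveled.
Variable lvl : E -> int.
Hypothesis L : leveling M lvl.
Let Mw := lminor M lvl (lvl w).
Let wMw : wf Mw := wf_lminor _ _ wM.
Let mww : is_max (ground Mw) w := top_max lvl mw.

Lemma top_noloop : ~ coloop Mw w /\ ~ coloop (dual Mw) w.
Proof.
have [p [x [y [[wp eqr] bp _ _ _]]]] := top_level wM mw nc nl L.
by apply: bip_at_noloop bp _ wp => //; rewrite in_lminor wG eqxx.
Qed.

Lemma active_basis_del T p : leveling (del M w) lvl -> active_basis (del M w) T ->
  is_min (ground Mw) p -> optimal Mw p (slice T lvl (lvl w)) -> active_basis M T.
Proof.
move=> Ld aT mp oT; have := active_basis_level (wf_del w wM) Ld aT => H.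
have sT : T \subset ground M.
  by have [sT _] := H; apply: subset_trans sT _; rewrite ground_del subsetDl.
apply: (level_optimal_patch L (w := w) Ld _ _ H sT _ mp oT) => //.
  by move=> l; apply: (other_del wM mw nc nl L).
by move=> e eM ew; rewrite in_del ew.
Qed.

Lemma active_basis_con T p : leveling (con M w) lvl -> active_basis (con M w) T ->
  is_min (ground Mw) p -> optimal Mw p (w |: slice T lvl (lvl w)) ->
  active_basis M (w |: T).
Proof.
move=> Lc aT mp oT; have := active_basis_level (wf_con w wM) Lc aT => H.
have sT : w |: T \subset ground M.
  have [sT _] := H; rewrite subUset sub1set wG.
  by apply: subset_trans sT _; rewrite ground_con subsetDl.
apply: (level_optimal_patch L (w := w) Lc _ _ H sT _ mp) => //.
- by move=> l; apply: (other_con wM mw nc nl L).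
- by move=> e eM ew; rewrite in_con ew.
- by move=> e ew; rewrite !inE (negPf ew).
- by rewrite slice_U1.
Qed.

(** If the tree of the deletion were optimal for the reversed level minor, that
    minor would be bipolar, and the contraction would inherit the leveling. *)
Lemma del_basis T : leveling (del M w) lvl -> ~ leveling (con M w) lvl ->
  active_basis (del M w) T -> active_basis M T.
Proof.
move=> Ld nLc aT; have [p [x [y [[wp eqr] bp _ _ _]]]] := top_level wM mw nc nl L.
have mp := bip_at_min bp; have [nc' nl'] := top_noloop.
have bd := (leveling_delE wM mw nc nl L wp eqr bp).1 Ld.
have oT := slice_del wM mw wp Ld aT mp.
case: (optimal_del_alt wMw mww nc' nl' oT) => o1; first exact: active_basis_del o1.
case: nLc; suff /(leveling_reverse_minors wM mw nc nl L)[] : leveling (reverse M w) lvl by [].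
apply/(leveling_reverseE wM mw L eqr bp); apply: optimal_bip_at o1 _ => //.
  exact: wf_reverse.
exact: optimal_in (wf_del w wMw) bd oT.
Qed.

Lemma con_basis T : leveling (con M w) lvl -> ~ leveling (del M w) lvl ->
  active_basis (con M w) T -> active_basis M (w |: T).
Proof.
move=> Lc nLd aT; have [p [x [y [[wp eqr] bp _ _ _]]]] := top_level wM mw nc nl L.
have mp := bip_at_min bp; have [nc' nl'] := top_noloop.
have bc := (leveling_conE wM mw nc nl L wp eqr bp).1 Lc.
have oT := slice_con wM mw wp Lc aT mp.
case: (optimal_con_alt wMw mww nc' nl' oT) => o1; first exact: active_basis_con o1.
case: nLd; suff /(leveling_reverse_minors wM mw nc nl L)[] : leveling (reverse M w) lvl by [].
apply/(leveling_reverseE wM mw L eqr bp); apply: optimal_bip_at o1 _ => //.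
  exact: wf_reverse.
rewrite in_setU1 eq_sym (negPf wp) /=.
exact: optimal_in (wf_con w wMw) bc oT.
Qed.
End Leveled.

(** By [leveling_insert] in both directions, the two levelings also agree at
    [w]; hence [lvl] is a leveling of the reversed pair, and of both minors. *)
Lemma leveling_exclusive lvl lvl' : leveling M lvl -> leveling (reverse M w) lvl' ->
  (leveling (del M w) lvl /\ leveling (del M w) lvl') \/
  (leveling (con M w) lvl /\ leveling (con M w) lvl') ->
  leveling (del M w) lvl /\ leveling (con M w) lvl.
Proof.
move=> L L' H.
have eql e : e \in ground M -> e != w -> lvl e = lvl' e.
  move=> eM ew; case: H => [] [L1 L2].
    by apply: (leveling_uniq (wf_del w wM) L1 L2); rewrite in_del ew.
  by apply: (leveling_uniq (wf_con w wM) L1 L2); rewrite in_con ew.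
have nc' : ~ coloop (reverse M w) w by rewrite coloop_reverse_iff.
have nl' : ~ coloop (dual (reverse M w)) w by rewrite dual_reverse coloop_reverse_iff.
have le1 := leveling_insert wM mw nc nl L L' eql.
have le2 : lvl w <= lvl' w.
  apply: (leveling_insert wR mw nc' nl' L').
    by rewrite reverseK.
  by move=> e eM ew; rewrite eql.
apply: (leveling_reverse_minors wM mw nc nl L).
apply: leveling_ext _ L' => e /= eM.
have [->|ew] := eqVneq e w; last by rewrite eql.
by apply: le_anti; rewrite le1 le2.
Qed.
End Choice.

Section Assignment.
Variables (M : opair (E := E)) (w : E) (lvl : E -> int).
Hypotheses (wM : wf M) (mw : is_max (ground M) w).
Hypotheses (nc : ~ coloop M w) (nl : ~ coloop (dual M) w) (L : leveling M lvl).

Let wR : wf (reverse M w) := wf_reverse w wM.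
Let ncR : ~ coloop (reverse M w) w. Proof. by rewrite coloop_reverse_iff. Qed.
Let nlR : ~ coloop (dual (reverse M w)) w.
Proof. by rewrite dual_reverse coloop_reverse_iff. Qed.

(** By [leveling_exclusive], the contraction is the only minor that inherits the
    leveling of the reversed pair; then [con_basis] applies to that pair. *)
Lemma del_choice T T' : leveling (del M w) lvl -> ~ leveling (con M w) lvl ->
  active_basis (del M w) T -> active_basis (con M w) T' ->
  active_basis M T /\ active_basis (reverse M w) (w |: T').
Proof.
move=> Ld nLc aT aT'; split; first exact: (del_basis wM mw nc nl L).
have [lvl' L'] := leveling_exists wR.
have nd' : ~ leveling (del (reverse M w) w) lvl'.
  rewrite del_reverse // => Ld'; have [] := leveling_exclusive wM mw nc nl L L' => //.
  by left.
have [|Lc'] := leveling_minor wR mw ncR nlR L'; first by [].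
by apply: (con_basis wR mw ncR nlR L' Lc' nd'); rewrite con_reverse.
Qed.

Lemma con_choice T T' : leveling (con M w) lvl -> ~ leveling (del M w) lvl ->
  active_basis (del M w) T -> active_basis (con M w) T' ->
  active_basis M (w |: T') /\ active_basis (reverse M w) T.
Proof.
move=> Lc nLd aT aT'; split; first exact: (con_basis wM mw nc nl L).
have [lvl' L'] := leveling_exists wR.
have nc' : ~ leveling (con (reverse M w) w) lvl'.
  rewrite con_reverse // => Lc'; have [] := leveling_exclusive wM mw nc nl L L' => //.
  by right.
have [Ld'|] := leveling_minor wR mw ncR nlR L'; last by [].
by apply: (del_basis wR mw ncR nlR L' Ld' nc'); rewrite del_reverse.
Qed.

Let Mw := lminor M lvl (lvl w).
Let wMw : wf Mw := wf_lminor _ _ wM.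
Let mww : is_max (ground Mw) w := top_max lvl mw.

Lemma both_slices T T' : leveling (del M w) lvl -> leveling (con M w) lvl ->
  active_basis (del M w) T -> active_basis (con M w) T' ->
  exists p, [/\ is_min (ground Mw) p,
    optimal (del Mw w) p (slice T lvl (lvl w)),
    optimal (con Mw w) p (slice T' lvl (lvl w)),
    active_basis (del Mw w) (slice T lvl (lvl w)) &
    active_basis (con Mw w) (slice T' lvl (lvl w))].
Proof.
move=> Ld Lc aT aT'; have [p [x [y [[wp eqr] bp _ _ _]]]] := top_level wM mw nc nl L.
have l0 := top_nonzero mw L; have mp := bip_at_min bp.
have bd := (leveling_delE wM mw nc nl L wp eqr bp).1 Ld.
have bc := (leveling_conE wM mw nc nl L wp eqr bp).1 Lc.
have oT := slice_del wM mw wp Ld aT mp.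
have oT' := slice_con wM mw wp Lc aT' mp.
exists p; split=> //.
  apply: (active_basis_fully_opt (wf_del w wMw) l0 eqr bd).
  by exists p; split=> //; apply: bip_at_min bd.
apply: (active_basis_fully_opt (wf_con w wMw) l0 eqr bc).
by exists p; split=> //; apply: bip_at_min bc.
Qed.

(** The smallest element of the support is not [w], and its sign is changed. *)
Lemma negmin_flip_excl S x : is_max S w -> 0 < x w ->
  negmin S x -> negmin S (flip w (fun e => - x e)) -> False.
Proof.
move=> mw' xw [m [mS xm xlt]] [m' [mS' xm' xlt']].
have mnw : m != w by apply: contraTneq xm => ->; rewrite -leNgt ltW.
have mnw' : m' != w.
  by apply: contraTneq xm' => ->; rewrite /flip eqxx opprK -leNgt ltW.
rewrite flip_id // in xm'.
case: (ltgtP m m') => [lt|lt|eq].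
- have := xlt' m mS lt; rewrite flip_id // => /eqP; rewrite oppr_eq0 => /eqP xm0.
  by rewrite xm0 ltxx in xm.
- by have := xlt m' mS' lt => xm0; rewrite xm0 oppr0 ltxx in xm'.
- by move: xm'; rewrite -eq oppr_lt0 ltNge ltW.
Qed.

(** The criterion on the fundamental cycle of [w] and the one on its fundamental
    cocycle select the same orientation, by uniqueness in the level minor of [w]. *)
Lemma both_choice T T' x y : leveling (del M w) lvl -> leveling (con M w) lvl ->
  active_basis (del M w) T -> active_basis (con M w) T' ->
  fund Mw (w |: slice T' lvl (lvl w)) w x ->
  fund (dual Mw) (ground Mw :\: slice T lvl (lvl w)) w y ->
  [/\ negmin (ground Mw) y, negmin (ground Mw) (flip w (fun e => - x e)),
      active_basis M T & active_basis (reverse M w) (w |: T')] \/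
  [/\ negmin (ground Mw) (flip w (fun e => - y e)), negmin (ground Mw) x,
      active_basis M (w |: T') & active_basis (reverse M w) T].
Proof.
move=> Ld Lc aT aT' fx fy.
have [p [mp oT oT' _ _]] := both_slices Ld Lc aT aT'.
have [nc' nl'] := top_noloop wM mw nc nl L.
have LR := leveling_both wM mw nc nl L Ld Lc.
have excl o : optimal Mw p (slice T lvl (lvl w)) ->
  optimal Mw p (w |: slice T' lvl (lvl w)) -> o.
  move=> o1 o2; have wT : w \notin slice T lvl (lvl w).
    by have [sT _ _] := oT; apply/negP=> /(subsetP sT); rewrite in_del eqxx.
  by move: wT; rewrite (optimal_uniq wMw mp o1 o2) !inE eqxx.
have exclR o : optimal (reverse Mw w) p (slice T lvl (lvl w)) ->
  optimal (reverse Mw w) p (w |: slice T' lvl (lvl w)) -> o.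
  move=> o1 o2; have wT : w \notin slice T lvl (lvl w).
    by have [sT _ _] := oT; apply/negP=> /(subsetP sT); rewrite in_del eqxx.
  by move: wT; rewrite (optimal_uniq (wf_reverse w wMw) mp o1 o2) !inE eqxx.
have LdR : leveling (del (reverse M w) w) lvl by rewrite del_reverse.
have LcR : leveling (con (reverse M w) w) lvl by rewrite con_reverse.
have aTR : active_basis (del (reverse M w) w) T by rewrite del_reverse.
have aTR' : active_basis (con (reverse M w) w) T' by rewrite con_reverse.
case: (optimal_del_flip wMw mww nl' oT fy) => [] [ny o1];
case: (optimal_con_flip wMw mww nc' oT' fx) => [] [nx o2].
- exact: excl.
- left; split=> //; first exact: (active_basis_del wM mw nc nl L Ld aT mp o1).
  by apply: (active_basis_con wR mw ncR nlR LR LcR aTR' (p := p));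
     rewrite lminor_reverse_same.
- right; split=> //; first exact: (active_basis_con wM mw nc nl L Lc aT' mp o2).
  by apply: (active_basis_del wR mw ncR nlR LR LdR aTR (p := p));
     rewrite lminor_reverse_same.
- exact: exclR.
Qed.
End Assignment.

(** A greatest coloop is a part by itself, at the top level, and its level minor
    has the tree [set w]. *)
Lemma coloop_basis M w T : wf M -> is_max (ground M) w -> coloop M w ->
  active_basis (con M w) T -> active_basis M (w |: T).
Proof.
move=> wM mw [x [Hx xw x0]] aT; have wG : w \in ground M by case/andP: mw.
have [lvl L] := leveling_exists wM.
have eqw : lvl w = (rank w).+1%:Z.
  have lt_w : (rank w)%:Z < lvl w.
    apply/(leveling_char w wM L wG); exists (fun e => x w * x e); split.
    - exact: covec_scale.
    - move=> f fM; have [->|fw] := eqVneq f w; first by rewrite -expr2 sqr_ge0.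
      by rewrite (x0 f) // mulr0.
    - by rewrite -expr2 exprn_even_gt0.
    - move=> f fM fw; rewrite (x0 f) ?mulr0 //.
      by apply: contraTneq fw => ->; rewrite ltxx.
  have [p [pM _ pmin [_ eqr] _]] := leveling_at L wG.
  by have := pmin w wG erefl; rewrite -leq_rank; lia.
have only f : f \in ground M -> lvl f = lvl w -> f = w.
  move=> fM eqf; have [p [pM _ pmin [_ eqr] _]] := leveling_at L fM.
  apply: le_anti; rewrite (is_maxP mw) //= -leq_rank.
  by have := pmin f fM erefl; rewrite -leq_rank; lia.
have oth l : l != lvl w -> lminor (con M w) lvl l = lminor M lvl l.
  apply: lminor_con => //; exists x; split=> // f fM lf; apply: x0 => //.
  by apply: contraTneq lf => ->; rewrite ltxx.
have Lc : leveling (con M w) lvl.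
  move=> e; rewrite in_con => /andP[ew eM].
  have ne : lvl e != lvl w by apply: contra_neq ew; apply: only.
  by have [p Hp] := L e eM; exists p; rewrite oth.
have [sT H] := active_basis_level (wf_con w wM) Lc aT; rewrite ground_con in sT.
have wT : w \notin T by apply/negP => /(subsetP sT); rewrite !inE eqxx.
have sT' : w |: T \subset ground M.
  by rewrite subUset sub1set wG; apply: subset_trans sT (subsetDl _ _).
have eqs : slice (w |: T) lvl (lvl w) = [set w].
  apply/setP=> f; rewrite !inE; have [->|fw] /= := eqVneq f w; first by rewrite eqxx.
  apply/negP=> /andP[fT /eqP eqf]; case/negP: fw; apply/eqP/only => //.
  by have := subsetP sT f fT; rewrite !inE => /andP[].
have eqG : ground (lminor M lvl (lvl w)) = [set w].
  apply/setP=> f; rewrite in_lminor inE; apply/andP/eqP => [[fM /eqP]|->//].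
  exact: only.
have [p [_ _ bp]] := L w wG; have mp := bip_at_min bp.
have epw : p = w by have := is_min_in mp; rewrite eqG inE => /eqP.
rewrite {p}epw in mp bp.
have [T' [q [mq oq]]] := fully_opt_exists (wf_lminor _ _ wM) bp.
rewrite (is_min_uniq mq mp) in oq.
have wT' : w \in T' by rewrite (optimal_in (wf_lminor lvl (lvl w) wM) bp oq) eqw.
have eqT' : T' = [set w].
  by have [sT'' _ _] := oq; apply/eqP; rewrite eqEsubset -{1}eqG sT'' sub1set.
apply: (level_optimal_patch L (w := w) Lc oth _ (conj _ H) sT' _ mp).
- by move=> e eM ew; rewrite in_con ew.
- by rewrite ground_con.
- by move=> e ew; rewrite !inE (negPf ew).
- by rewrite eqs -eqT'.
Qed.

Lemma loop_basis M w T : wf M -> is_max (ground M) w -> coloop (dual M) w ->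
  active_basis (del M w) T -> active_basis M T.
Proof.
move=> wM mw cl aT; have wG : w \in ground M by case/andP: mw.
have sT : T \subset ground M :\ w.
  by case: aT => lvl [_ [sT _]]; rewrite -ground_del.
have := coloop_basis (wf_dual wM) mw cl (T := (ground M :\ w) :\: T).
rewrite -dual_del -ground_del => /(_ (active_basis_dual aT)).
rewrite ground_del => /active_basis_dual; rewrite dualK /=.
have -> // : ground M :\: (w |: ground M :\ w :\: T) = T.
apply/setP=> e; rewrite !inE; have [->|ew] /= := eqVneq e w.
  by apply/esym/negbTE/negP => /(subsetP sT); rewrite !inE eqxx.
case eT : (e \in T) => /=; last by rewrite andNb.
by move/(subsetP sT): eT; rewrite !inE ew.
Qed.
End ActiveBasis.

(** * Tensions and flows of a digraph *)
Section DigraphPairs.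
Context {disp : Order.disp_t} {V : finType} {E : finOrderType disp}.
Implicit Types (G H : digraph V E) (A B C D F T : {set E}) (b e f g p w : E).
Implicit Types (x y : E -> rat) (a : E * bool) (s : seq (E * bool)) (S : {set V}).
Implicit Types (u v : V) (pi : V -> rat).

Definition tension G pi : E -> rat := fun e => pi (Defs.head G e) - pi (tail G e).

(** With flows defined by orthogonality to the tensions, rather than by
    conservation at the vertices, minors can be compared on tensions alone. *)
Definition pair_of G : opair (E := E) :=
  OPair (edges G)
    (fun x => exists pi, forall e, e \in edges G -> x e = tension G pi e)
    (fun y => forall pi, \sum_(e in edges G) tension G pi e * y e = 0).

Definition dsign (d : bool) : rat := if d then 1 else -1.

(** Defined as a sum over the walk, so that orthogonality to tensions becomes a
    telescoping sum along the walk, without any uniqueness condition. *)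
Definition walk_vect s : E -> rat := fun e => \sum_(a <- s | a.1 == e) dsign a.2.

Definition follows G : rel (E * bool) := fun a a' => step_dst G a == step_src G a'.

Lemma walk_vect_out s e : e \notin [seq a.1 | a <- s] -> walk_vect s e = 0.
Proof.
move=> es; rewrite /walk_vect big_seq_cond big1 // => a /andP[aS /eqP eqa].
by case/negP: es; rewrite -eqa map_f.
Qed.

Lemma walk_vect_in s a : uniq [seq a.1 | a <- s] -> a \in s -> walk_vect s a.1 = dsign a.2.
Proof.
elim: s => // b s IHs /= /andP[bs us]; rewrite inE /walk_vect big_cons => /predU1P[->|aS].
  by rewrite eqxx -/(walk_vect s b.1) walk_vect_out // addr0.
rewrite -/(walk_vect s a.1) IHs //; case: eqVneq => // eqb.
by case/negP: bs; rewrite eqb map_f.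
Qed.

Lemma walk_vect_neq0 s e : uniq [seq a.1 | a <- s] ->
  (walk_vect s e != 0) = (e \in [seq a.1 | a <- s]).
Proof.
move=> us; apply/idP/idP; first by apply: contraNT => /walk_vect_out ->.
by case/mapP=> a aS ->; rewrite walk_vect_in // /dsign; case: a.2.
Qed.

Lemma tension_step G pi a :
  tension G pi a.1 * dsign a.2 = pi (step_dst G a) - pi (step_src G a).
Proof. by rewrite /tension /step_dst /step_src /dsign; case: a.2; ring. Qed.

Lemma path_tension G pi a s : path (follows G) a s ->
  \sum_(b <- a :: s) tension G pi b.1 * dsign b.2 =
  pi (step_dst G (last a s)) - pi (step_src G a).
Proof.
elim: s a => [|b s IHs] a /=; first by rewrite big_seq1 tension_step.
case/andP=> /eqP ab /IHs eqs; rewrite big_cons eqs tension_step ab.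
by ring.
Qed.

Lemma walk_vectP G s : all (fun a => a.1 \in edges G) s -> cycle (follows G) s ->
  vect (pair_of G) (walk_vect s).
Proof.
move=> es cs pi; transitivity (\sum_(a <- s) tension G pi a.1 * dsign a.2).
  under eq_bigr => e _ do rewrite /walk_vect big_distrr.
  rewrite (exchange_big_dep xpredT) //=; apply: eq_big_seq => a aS.
  have aG : a.1 \in edges G := allP es a aS.
  rewrite (bigD1 a.1) /= ?aG ?eqxx // big1 ?addr0 // => e.
  by case/andP=> /andP[_ /eqP ->]; rewrite eqxx.
case: s es cs => [|a s] _; first by rewrite big_nil.
rewrite /= rcons_path => /andP[ps /eqP close].
by rewrite path_tension // close subrr.
Qed.

Section ClosedWalks.
Variables (G : digraph V E) (D : pred (E * bool)).
Hypothesis DG : forall a, D a -> a.1 \in edges G.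

Definition step_rel : rel V := fun u v =>
  [exists a, [&& D a, step_src G a == u & step_dst G a == v]].

(** A step cannot use the edge of a later step: all ends of the later steps are
    among the remaining vertices, which do not include [u]. *)
Lemma walk_of_path q u a0 : path step_rel u q -> uniq (u :: q) -> step_dst G a0 = u ->
  exists s, [/\ all D s, [seq step_src G a | a <- s] = belast u q,
    path (follows G) a0 s /\ step_dst G (last a0 s) = last u q,
    uniq [seq a.1 | a <- s] &
    forall a, a \in s -> (step_src G a \in u :: q) && (step_dst G a \in u :: q)].
Proof.
elim: q u a0 => [|v q IHq] u a0; first by exists [::].
rewrite [path _ _ _]/= => /andP[/existsP[a /and3P[Da /eqP au /eqP av]] pp].
rewrite cons_uniq => /andP[up uvp] a0u.
have [s [Ds ss [ps ls] us inp]] := IHq v a pp uvp av.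
exists (a :: s); split=> //=.
- by rewrite Da.
- by rewrite au ss.
- by rewrite ps /follows a0u au eqxx ls.
- rewrite us andbT; apply/negP=> /mapP[b bS eqab].
  have /andP[b1 b2] := inp b bS; case/negP: up.
  move: b1 b2; rewrite -au /step_src /step_dst eqab.
  by case: (a.2); case: (b.2).
- move=> b; rewrite inE => /predU1P[->|/inp/andP[b1 b2]].
    by rewrite au av !inE !eqxx orbT.
  by rewrite !(in_cons u) b1 b2 !orbT.
Qed.

(** The condition on [a0] lets [D] contain the closing step itself: it is never
    used by the path, since its source is the last vertex of the path. *)
Lemma closed_walk a0 : a0.1 \in edges G -> (forall a, D a -> a.1 = a0.1 -> a = a0) ->
  connect step_rel (step_dst G a0) (step_src G a0) ->
  exists s, simple_closed_walk G (a0 :: s) /\ all D s.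
Proof.
move=> a0G Da0 /connectP[q0 /shortenP[q pp up _] lastp].
have [s [Ds ss [ps ls] us inp]] := walk_of_path pp up erefl.
have src_s : step_src G a0 \notin [seq step_src G a | a <- s].
  by move: up; rewrite ss lastI rcons_uniq -lastp => /andP[].
exists s; split=> //; apply/and5P; split=> //=.
- by rewrite a0G; apply/allP=> a /(allP Ds)/DG.
- rewrite us andbT; apply/negP=> /mapP[b bS eqb]; case/negP: src_s.
  by have <- := Da0 b (allP Ds b bS) (esym eqb); rewrite map_f.
- rewrite src_s ss /=; move: up; rewrite lastI rcons_uniq => /andP[_].
  by [].
- by rewrite rcons_path ps /= /follows ls -lastp.
Qed.
End ClosedWalks.

Lemma traversal_exists G s : simple_closed_walk G s ->
  exists t : #|E|.-bseq (E * bool), val t = s /\ traversal G [set e in [seq a.1 | a <- s]] t.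
Proof.
move=> cs; have sz : (size s <= #|E|)%N.
  have /and5P[_ _ us _ _] := cs; rewrite -(size_map fst s) -(card_uniqP us).
  exact: max_card.
by exists (Bseq sz); rewrite /traversal /= cs eqxx.
Qed.

Lemma traversalP G C (t : #|E|.-bseq (E * bool)) : traversal G C t ->
  [/\ vect (pair_of G) (walk_vect t),
      forall e, (walk_vect t e != 0) = (e \in C),
      forall e d, (e, d) \in val t -> walk_vect t e = dsign d,
      C \subset edges G & C != set0].
Proof.
case/andP=> /and5P[nt es us _ cs] /eqP ->; split.
- exact: walk_vectP.
- by move=> e; rewrite walk_vect_neq0 // inE.
- by move=> e d /(walk_vect_in us).
- apply/subsetP=> e; rewrite inE => /mapP[a aS ->]; exact: (allP es).
- case: (val t) nt => // a s _; apply/set0Pn; exists a.1; by rewrite inE mem_head.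
Qed.

(** Follow the edges of the support in the direction of the flow, from the end
    of e. If its origin were not reached, no flow would leave the set of reached
    vertices whereas some enters it through e. *)
Lemma conformal_cycle G y e : vect (pair_of G) y -> e \in edges G -> y e != 0 ->
  exists s, [/\ simple_closed_walk G s, e \in [seq a.1 | a <- s] &
    forall a, a \in s -> y a.1 != 0 /\ a.2 = (0 < y a.1)].
Proof.
move=> Hy eG ye.
pose D (a : E * bool) := [&& a.1 \in edges G, y a.1 != 0 & a.2 == (0 < y a.1)].
pose a0 := (e, 0 < y e).
have DG a : D a -> a.1 \in edges G by case/and3P.
have Da0 : D a0 by rewrite /D eG ye eqxx.
have Da a : D a -> a.1 = a0.1 -> a = a0.
  by case: a => f d /and3P[_ _ /eqP /= ->] ->.
have [con|ncon] := boolP (connect (step_rel G D) (step_dst G a0) (step_src G a0)).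
  have [s [cs Ds]] := closed_walk (a0 := a0) DG eG Da con.
  exists (a0 :: s); rewrite /= mem_head; split=> // a; rewrite inE => /predU1P[->|aS].
    by have /and3P[_ ? /eqP] := Da0.
  by have /and3P[_ ? /eqP] := allP Ds a aS.
pose pi v : rat := (connect (step_rel G D) (step_dst G a0) v)%:R.
have stepE f : f \in edges G -> y f != 0 ->
    tension G pi f * y f = `|y f| * (pi (step_dst G (f, 0 < y f)) - pi (step_src G (f, 0 < y f))).
  move=> fG yf; rewrite -tension_step /= mulrCA; congr (_ * _).
  rewrite /dsign; case: (ltgtP 0 (y f)) => h.
  - by rewrite gtr0_norm // mulr1.
  - by rewrite ltr0_norm // mulrN1 opprK.
  - by rewrite -h normr0 mul0r.
have ge0 f : f \in edges G -> 0 <= tension G pi f * y f.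
  move=> fG; have [->|yf] := eqVneq (y f) 0; first by rewrite mulr0.
  rewrite stepE // mulr_ge0 // subr_ge0 /pi.
  have [cf|//] := boolP (connect _ _ (step_src G (f, 0 < y f))).
  rewrite (connect_trans cf) ?lexx //; apply/connect1/existsP; exists (f, 0 < y f).
  by rewrite /D fG yf !eqxx.
have := Hy pi => /eqP; rewrite psumr_eq0 // => /allP/(_ e).
rewrite mem_index_enum eG => /(_ isT) /=.
by rewrite stepE // /pi connect0 (negPf ncon) subr0 mulr1 normr_eq0 (negPf ye).
Qed.

Lemma tensionP G pi : covec (pair_of G) (tension G pi).
Proof. by exists pi. Qed.

(** Painting: either the ends of [w] are joined by a walk in [C], which gives a
    cycle, or the set of vertices reached from one end gives a cut avoiding [C]. *)
Lemma pair_of_wf G : wf (pair_of G).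
Proof.
split=> /=.
- split.
  + by move=> x x' eqx [pi H]; exists pi => e eG; rewrite -eqx // H.
  + by exists (fun _ => 0) => e _; rewrite /tension subrr.
  + move=> k l x x' [pi H] [pi' H']; exists (fun v => k * pi v + l * pi' v) => e eG.
    by rewrite H // H' // /tension; ring.
- split.
  + by move=> y y' eqy H pi; rewrite -[RHS](H pi); apply: eq_bigr => e eG; rewrite eqy.
  + by move=> pi; rewrite big1 // => e _; rewrite mulr0.
  + move=> k l y y' H H' pi.
    rewrite (eq_bigr (fun e => k * (tension G pi e * y e) + l * (tension G pi e * y' e))).
      by rewrite big_split /= -!mulr_sumr H H' !mulr0 addr0.
    by move=> e _; ring.
- move=> x y [pi Hx] Hy; rewrite -[RHS](Hy pi); apply: eq_bigr => e eG.
  by rewrite Hx.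
- move=> C w wG wC.
  pose D (a : E * bool) := (a.1 \in edges G) && (a.1 \in C).
  pose a0 := (w, true).
  have DG a : D a -> a.1 \in edges G by case/andP.
  have Da a : D a -> a.1 = a0.1 -> a = a0.
    by case/andP=> _ aC eqa; case/negP: wC; rewrite -[w]/(a0.1) -eqa.
  have [con|ncon] := boolP (connect (step_rel G D) (step_dst G a0) (step_src G a0)).
    have [s [/and5P[_ es us _ cs] Ds]] := closed_walk (a0 := a0) DG wG Da con.
    right; exists (walk_vect (a0 :: s)); split; first exact: walk_vectP.
      by rewrite walk_vect_neq0 // mem_head.
    move=> e eG eC ew; apply: walk_vect_out; rewrite /= inE (negPf ew) /=.
    by apply: contra eC => /mapP[a /(allP Ds)/andP[_ aC] ->].
  left; pose pi v : rat := (connect (step_rel G D) (step_dst G a0) v)%:R.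
  exists (tension G pi); split; first exact: tensionP.
    by rewrite /tension {1}/pi connect0 /pi (negPf ncon) subr0 oner_eq0.
  move=> e eG eC; rewrite /tension /pi; apply/eqP; rewrite subr_eq0; apply/eqP.
  congr ((nat_of_bool _)%:R).
  suff step d : connect (step_rel G D) (step_src G (e, d)) (step_dst G (e, d)).
    by apply/idP/idP => H; apply: connect_trans H _; [apply: (step false)|apply: (step true)].
  by apply/connect1/existsP; exists (e, d); rewrite /D eG eC !eqxx.
Qed.

(** The potential is chosen so that the edges that leave [S] get the value 1. *)
Definition cut_vect G S := tension G (fun v => (v \notin S)%:R).

Lemma in_cut G S e : (e \in cut G S) =
  (e \in edges G) && ((tail G e \in S) != (Defs.head G e \in S)).
Proof. by rewrite inE. Qed.

Lemma cut_vect_neq0 G S e : e \in edges G -> (cut_vect G S e != 0) = (e \in cut G S).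
Proof.
move=> eG; rewrite in_cut eG /cut_vect /tension.
by case: (tail G e \in S); case: (Defs.head G e \in S); rewrite /= ?subrr ?subr0 ?sub0r ?oppr_eq0 ?oner_eq0 ?eqxx.
Qed.

Lemma cut_vect_val G S e : e \in cut G S -> cut_vect G S e = dsign (tail G e \in S).
Proof.
rewrite in_cut /cut_vect /tension /dsign => /andP[_].
by case: (tail G e \in S); case: (Defs.head G e \in S); rewrite //= ?subr0 ?sub0r.
Qed.

Definition conformal_cut G x S : bool :=
  [forall f in cut G S, (x f != 0) && ((tail G f \in S) == (0 < x f))].

Lemma graph_cocycleP G D : graph_cocycle G D <->
  [/\ D != set0, exists S, D = cut G S &
      forall S, cut G S \subset D -> cut G S != set0 -> cut G S = D].
Proof.
split=> [/minsetP[/andP[D0 /existsP[S /eqP eqD]] minD]|[D0 [S eqD] minD]].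
  split=> //; first by exists S.
  move=> S' sub S'0; apply: minD => //; rewrite S'0; apply/existsP; by exists S'.
apply/minsetP; split; first by rewrite D0; apply/existsP; exists S; apply/eqP.
move=> B /andP[B0 /existsP[S' /eqP eqB]] sub; rewrite eqB; apply: minD; by rewrite -eqB.
Qed.

Lemma conformal_level_cut G x e : covec (pair_of G) x -> e \in edges G -> x e != 0 ->
  exists S, conformal_cut G x S /\ e \in cut G S.
Proof.
move=> [pi Hx] eG xe.
(* the lower end of e is below the threshold c and the upper end is not *)
pose c := Order.max (pi (tail G e)) (pi (Defs.head G e)).
exists [set v | pi v < c]; split.
  apply/forallP=> f; apply/implyP; rewrite in_cut !inE => /andP[fG].
  rewrite Hx // /tension subr_gt0 subr_eq0.
  case: (ltrP (pi (tail G f)) c) => tf; case: (ltrP (pi (Defs.head G f)) c) => hf // _.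
    have lt := lt_le_trans tf hf; by rewrite lt gt_eqF.
  have lt := lt_le_trans hf tf; by rewrite lt_eqF //= ltNge ltW.
rewrite in_cut eG !inE /c; move: xe; rewrite Hx // /tension subr_eq0 !lt_max !ltxx orbF /=.
by rewrite neq_lt; case: ltgtP.
Qed.

(** Start from a level set of the potential, and take a conformal cut through
    [e] with as few edges as possible. If it strictly contained a nonempty cut, then
    restricting [S] to the vertices on one side of the smaller cut, or enlarging it
    by them, would give a conformal cut through [e] with fewer edges. *)
Lemma conformal_cocycle G x e : covec (pair_of G) x -> e \in edges G -> x e != 0 ->
  exists S, [/\ graph_cocycle G (cut G S), e \in cut G S & conformal_cut G x S].
Proof.
move=> Hx eG xe; have [S0 [cS0 eS0]] := conformal_level_cut Hx eG xe.
have P0 : conformal_cut G x S0 && (e \in cut G S0) by rewrite cS0.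
case: (@arg_minnP _ S0 (fun S => conformal_cut G x S && (e \in cut G S))
  (fun S => #|cut G S|) P0) => S /andP[cS eS] minS.
exists S; split=> //; apply/graph_cocycleP.
split; [by apply/set0Pn; exists e|by exists S|].
move=> S' sub /set0Pn[g gS'].
have cSP f : f \in cut G S -> (x f != 0) && ((tail G f \in S) == (0 < x f)).
  by move=> fS; have /forallP/(_ f)/implyP := cS; apply.
(* a conformal cut through e within the minimal one is equal to it *)
have smaller S1 : {subset cut G S1 <= cut G S} -> e \in cut G S1 ->
    (forall f, f \in cut G S1 -> (tail G f \in S1) = (tail G f \in S)) ->
    cut G S1 = cut G S.
  move=> sub1 e1 same; apply/eqP; rewrite eqEcard; apply/andP; split.
    exact/subsetP.
  apply: minS; rewrite e1 andbT; apply/forallP=> f; apply/implyP=> f1.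
  by rewrite same //; apply/cSP/sub1.
(* the ends of f inside and outside S *)
pose inner f := if tail G f \in S then tail G f else Defs.head G f.
pose outer f := if tail G f \in S then Defs.head G f else tail G f.
have Hinner f : f \in cut G S -> (inner f \in S') = (inner e \in S').
  set i := (inner e \in S'); pose S1 := [set v in S | (v \in S') == i].
  have sub1 : {subset cut G S1 <= cut G S}.
    move=> h; rewrite !in_cut !inE => /andP[hG]; rewrite hG /=.
    have := subsetP sub h; rewrite !in_cut hG /=.
    case: (tail G h \in S); case: (Defs.head G h \in S) => //=.
    by case: (tail G h \in S'); case: (Defs.head G h \in S');
       case: (i) => //= /(_ isT).
  have e1 : e \in cut G S1.
    move: eS; rewrite !in_cut !inE eG /= /i /inner.
    by case: (tail G e \in S); case: (Defs.head G e \in S) => //=; rewrite eqxx.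
  have := smaller S1 sub1 e1 _ => eq1 fS; move: (fS); rewrite -eq1.
    rewrite in_cut !inE => /andP[fG]; rewrite /inner; move: fS; rewrite in_cut fG /=.
    case: (tail G f \in S); case: (Defs.head G f \in S) => //= _.
      by case: (_ \in S'); case: (i).
    by case: (_ \in S'); case: (i).
  move=> h h1; have := sub1 h h1; move: h1; rewrite !in_cut !inE => /andP[hG].
  rewrite hG /=; case: (tail G h \in S) => //=.
  by case: (Defs.head G h \in S) => //=; case: (_ \in S'); case: (i).
have Houter f : f \in cut G S -> (outer f \in S') = (outer e \in S').
  set i := (outer e \in S'); pose S1 := [set v | (v \in S) || ((v \in S') != i)].
  have sub1 : {subset cut G S1 <= cut G S}.
    move=> h; rewrite !in_cut !inE => /andP[hG]; rewrite hG /=.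
    have := subsetP sub h; rewrite !in_cut hG /=.
    case: (tail G h \in S); case: (Defs.head G h \in S) => //=.
    by case: (tail G h \in S'); case: (Defs.head G h \in S');
       case: (i) => //= /(_ isT).
  have e1 : e \in cut G S1.
    move: eS; rewrite !in_cut !inE eG /= /i /outer.
    by case: (tail G e \in S); case: (Defs.head G e \in S) => //=; rewrite eqxx.
  have := smaller S1 sub1 e1 _ => eq1 fS; move: (fS); rewrite -eq1.
    rewrite in_cut !inE => /andP[fG]; rewrite /outer; move: fS; rewrite in_cut fG /=.
    case: (tail G f \in S); case: (Defs.head G f \in S) => //= _.
      by case: (_ \in S'); case: (i).
    by case: (_ \in S'); case: (i).
  move=> h h1; have := sub1 h h1; move: h1; rewrite !in_cut !inE => /andP[hG].
  rewrite hG /=; case: (tail G h \in S) => //=.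
  by case: (Defs.head G h \in S) => //=; case: (_ \in S'); case: (i).
have cutS' f : f \in cut G S -> (f \in cut G S') = ((inner f \in S') != (outer f \in S')).
  rewrite !in_cut => /andP[fG _]; rewrite fG /= /inner /outer.
  by case: (tail G f \in S); rewrite // eq_sym.
have gS := subsetP sub g gS'; apply/eqP; rewrite eqEsubset sub /=.
apply/subsetP=> f fS; move: gS'; rewrite !cutS' // Hinner // Houter //.
by rewrite (Hinner f) // (Houter f).
Qed.

End DigraphPairs.

(** * Fundamental cycles and cocycles of a digraph *)
Section Bases.
Context {disp : Order.disp_t} {E : finOrderType disp}.
Implicit Types (T : {set E}) (b e f : E) (x y : E -> rat) (M : opair (E := E)).

Lemma base_fund M T b : wf M -> base M T -> b \in T -> exists x, fund M T b x.
Proof.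
move=> wM [sT h h'] bT; have bM := subsetP sT b bT.
have bC : b \notin T :\ b by rewrite !inE eqxx.
case: (painting wM bM bC) => [[x [Hx xb x0]]|[y [Hy yb y0]]].
  exists (fun e => x b * x e); split; first exact: covec_scale.
    by rewrite -expr2 exprn_even_gt0.
  by move=> c cT cb; rewrite (x0 c) ?mulr0 ?(subsetP sT) // !inE cb.
case/eqP: yb; apply: h' => // t; rewrite inE => /andP[tT tM].
by apply: y0 => //; [rewrite !inE (negPf tT) andbF|apply: contraNneq tT => ->].
Qed.

Lemma base_cofund M T e : wf M -> base M T -> e \in ground M -> e \notin T ->
  exists y, fund (dual M) (ground M :\: T) e y.
Proof.
move=> wM bT eM eT; apply: base_fund (wf_dual wM) (base_dual bT) _.
by rewrite inE eT.
Qed.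

(** Covectors vanishing on [T] except at [b] form a line. *)
Lemma fund_multiple M T b x z : wf M -> base M T -> b \in T -> fund M T b x ->
  covec M z -> (forall t, t \in T -> t != b -> z t = 0) ->
  forall e, e \in ground M -> z e = z b / x b * x e.
Proof.
move=> wM [sT h _] bT [Hx xb x0] Hz z0 e eM.
apply/eqP; rewrite -subr_eq0; apply/eqP; move: e eM.
apply: h; first by apply: covecB => //; apply: covec_scale.
move=> t tT; have [->|tb] := eqVneq t b; first by rewrite divfK ?subrr // gt_eqF.
by rewrite z0 // (x0 t) // mulr0 subrr.
Qed.
End Bases.

Section DigraphMinors.
Context {disp : Order.disp_t} {V : finType} {E : finOrderType disp}.
Implicit Types (G H : digraph V E) (A B C D F T : {set E}) (b e f g p w : E).
Implicit Types (x y : E -> rat) (S : {set V}) (u v : V) (pi : V -> rat).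

Lemma adjacent_sym G F : connect_sym (adjacent G F).
Proof.
apply: sym_connect_sym => u v; rewrite /adjacent.
by apply: eq_existsb => e; rewrite orbC.
Qed.

(** A tension that vanishes on [F] comes from a potential that is constant on the
    components of [F]. *)
Lemma adjacent_connect G F pi u v :
  (forall e, e \in edges G -> e \in F -> tension G pi e = 0) ->
  connect (adjacent G F) u v -> pi u = pi v.
Proof.
move=> H /connectP[q pq ->]; elim: q u pq => //= v' q IHq u /andP[/existsP[e]].
rewrite inE => /andP[/andP[eG eF]] uv /IHq <-.
have /eqP := H e eG eF; rewrite subr_eq0 => /eqP.
by case/orP: uv => /andP[/eqP <- /eqP <-].
Qed.

Lemma pair_of_contract G F :
  pair_of (contract G F) = pair_minor (pair_of G) F set0.
Proof.
apply: wf_eq; first exact: pair_of_wf.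
- by apply: wf_minor (pair_of_wf G) _; rewrite -setI_eq0 setI0.
- by rewrite /= /minor_ground setU0.
move=> x; split=> [[pi Hx]|[x0 [[pi Hpi] H1 H2]]].
  exists (tension G (fun v => pi (fingraph.root (adjacent G F) v))); split.
  - exact: tensionP.
  - move=> e eG eF; rewrite /tension; apply/eqP; rewrite subr_eq0; apply/eqP; congr (pi _).
    apply/eqP; rewrite root_connect; last exact: adjacent_sym.
    by apply/connect1/existsP; exists e; rewrite inE eG eF !eqxx orbT.
  - by move=> e eG; rewrite Hx //; move: eG; rewrite /= /minor_ground setU0.
exists pi => e eG; rewrite -H2; last by rewrite /minor_ground setU0.
have eG' : e \in edges G by move: eG; rewrite inE => /andP[].
rewrite Hpi // /tension /=.
have rootE v : pi (fingraph.root (adjacent G F) v) = pi v.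
  apply/esym/(adjacent_connect (G := G) (F := F)); last exact: connect_root.
  by move=> f fG fF; rewrite -Hpi // H1.
by rewrite !rootE.
Qed.

Lemma pair_of_con G w : pair_of (contract G [set w]) = con (pair_of G) w.
Proof. exact: pair_of_contract. Qed.

Lemma pair_of_restrict G F :
  pair_of (restrict G F) = pair_minor (pair_of G) set0 (~: F).
Proof.
have eqG : minor_ground (pair_of G) set0 (~: F) = edges G :&: F.
  by rewrite /minor_ground set0U setDE setCK.
apply: wf_eq; first exact: pair_of_wf.
- by apply: wf_minor (pair_of_wf G) _; rewrite -setI_eq0 set0I.
- by rewrite /= eqG.
move=> x; split=> [[pi Hx]|[x0 [[pi Hpi] H1 H2]]].
  exists (tension G pi); split; first exact: tensionP.
    by move=> e _; rewrite inE.
  by rewrite eqG => e eG; rewrite Hx.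
exists pi => e eG; rewrite -H2 ?eqG // Hpi //.
by move: eG; rewrite inE => /andP[].
Qed.

Lemma pair_of_del G w : pair_of (delete G w) = del (pair_of G) w.
Proof.
apply: wf_eq; first exact: pair_of_wf.
- exact: wf_del (pair_of_wf G).
- by rewrite ground_del.
move=> x; rewrite covec_del; split=> [[pi Hx]|[x0 [[pi Hpi] H2]]].
  exists (tension G pi); split; first exact: tensionP.
  by move=> e eG ew; rewrite Hx //= !inE ew.
exists pi => e; rewrite !inE => /andP[ew eG]; by rewrite -H2 // Hpi.
Qed.

Lemma pair_of_reverse G w :
  pair_of (reorient G [set w]) = reverse (pair_of G) w.
Proof.
have tE pi e : tension (reorient G [set w]) pi e = flip w (tension G pi) e.
  by rewrite /tension /flip /= inE; case: eqP => // _; rewrite opprB.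
apply: wf_eq; first exact: pair_of_wf.
- exact: wf_reverse (pair_of_wf G).
- by [].
move=> x; split=> [] [pi Hx]; exists pi => e eG.
  by rewrite /flip Hx // tE /flip; case: eqP; rewrite ?opprK.
by rewrite tE -[x in LHS](flipK w) /flip -/(flip w x e) Hx //.
Qed.

Section Fundamental.
Variables (G : digraph V E) (T : {set E}).
Hypothesis bT : base (pair_of G) T.

Let wG := pair_of_wf G.

(** The flow of a cycle contained in [T] with [e] added is a nonzero multiple of the
    fundamental vector, so supports and relative signs are the same. *)
Lemma traversal_multiple C e y (t : #|E|.-bseq (E * bool)) : e \in edges G -> e \notin T ->
  fund (dual (pair_of G)) (edges G :\: T) e y -> traversal G C t -> C \subset e |: T ->
  exists k : rat, k != 0 /\ forall f, f \in edges G -> walk_vect t f = k * y f.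
Proof.
move=> eG eT fy /traversalP[Hw Cw _ CG C0] sub.
have eD : e \in edges G :\: T by rewrite inE eT.
have w0 g : g \in edges G :\: T -> g != e -> walk_vect t g = 0.
  rewrite inE => /andP[gT gG] ge.
  by apply/eqP; apply: contraNT gT; rewrite Cw => /(subsetP sub); rewrite !inE (negPf ge).
have mul := fund_multiple (wf_dual wG) (base_dual bT) eD fy Hw w0.
exists (walk_vect t e / y e); split; last exact: mul.
have [_ ye _] := fy; rewrite mulf_neq0 ?invr_eq0 ?(gt_eqF ye) //.
apply/negP=> /eqP we0; case/set0Pn: C0 => f fC.
by move: (Cw f); rewrite fC (mul f) ?(subsetP CG) // we0 !mul0r eqxx.
Qed.

Lemma fund_cycleE e y : e \in edges G -> e \notin T ->
  fund (dual (pair_of G)) (edges G :\: T) e y ->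
  fund_cycle G T e = [set f in edges G | y f != 0] /\ graph_cycle G (fund_cycle G T e).
Proof.
move=> eG eT fy; have [Hy ye y0] := fy.
have ex : exists C, graph_cycle G C && (C \subset e |: T).
  have [|s [cs es Hs]] := conformal_cycle Hy eG _; first by rewrite gt_eqF.
  have [t [_ tr]] := traversal_exists cs; exists [set e in [seq a.1 | a <- s]].
  apply/andP; split; first by apply/existsP; exists t.
  have /and5P[_ sG _ _ _] := cs.
  apply/subsetP=> f; rewrite !inE => /mapP[a aS ->]; have [yf _] := Hs a aS.
  case: eqVneq => //= ne; apply: contraNT yf => fT; apply/eqP/y0 => //.
  by rewrite inE fT (allP sG).
rewrite /fund_cycle; case: pickP => [C /andP[cC sub]|none]; last first.
  by case: ex => C; rewrite none.
rewrite /odflt /=; split=> //; case/existsP: cC => t tr.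
have [k [k0 Hk]] := traversal_multiple eG eT fy tr sub.
have [_ Cw _ CG _] := traversalP tr.
apply/setP=> f; rewrite inE; have [fG|fG] := boolP (f \in edges G); last first.
  by apply: contraNF fG => /(subsetP CG).
by rewrite -Cw Hk // mulf_eq0 (negPf k0).
Qed.

(** The cases [r = true] and [r = false] are opposite and same directions: both
    compare the product of two signs with a fixed sign, which is not affected by
    the choice of the traversal. *)
Lemma fund_cycle_sign (r : bool) e y f g : e \in edges G -> e \notin T ->
  fund (dual (pair_of G)) (edges G :\: T) e y ->
  [exists s, traversal G (fund_cycle G T e) s &&
    [exists d : bool, ((f, d) \in val s) && ((g, r (+) d) \in val s)]] =
  [&& f \in edges G, g \in edges G & 0 < dsign (~~ r) * (y f * y g)].
Proof.
move=> eG eT fy; have [eqC cC] := fund_cycleE eG eT fy; have [_ _ y0] := fy.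
set C := fund_cycle G T e in eqC cC *.
have sub : C \subset e |: T.
  rewrite eqC; apply/subsetP=> h; rewrite !inE => /andP[hG yh].
  case: eqVneq => //= he; apply: contraNT yh => hT; apply/eqP/y0 => //.
  by rewrite inE hT.
have key t (h h' : E) d d' : traversal G C t -> (h, d) \in val t -> (h', d') \in val t ->
    [/\ h \in edges G, h' \in edges G & exists k : rat, 0 < k /\
        dsign d * dsign d' = k * (y h * y h')].
  move=> tr ht ht'; have [k [k0 Hk]] := traversal_multiple eG eT fy tr sub.
  have [_ Cw vw CG _] := traversalP tr.
  have inG (i : E) di : (i, di) \in val t -> i \in edges G.
    move=> it; apply: (subsetP CG); rewrite -Cw (vw _ _ it).
    by rewrite /dsign; case: (di).
  have hG := inG _ _ ht; have hG' := inG _ _ ht'; split=> //.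
  exists (k ^+ 2); rewrite exprn_even_gt0 //; split=> //.
  by rewrite -(vw _ _ ht) -(vw _ _ ht') !Hk //; ring.
apply/existsP/and3P => [[t /andP[tr /existsP[d /andP[ft gt]]]]|[fG gG pos]].
  have [fG gG [k [k0 Hk]]] := key t f g d _ tr ft gt; split=> //.
  by rewrite -(pmulr_rgt0 _ k0) mulrCA -Hk /dsign; case: (d); case: (r).
have := lt0r_neq0 pos; rewrite !mulf_eq0 !negb_or => /and3P[_ yf yg].
case/existsP: cC => t tr; exists t; rewrite tr; have /andP[_ /eqP eqt] := tr.
have : f \in [set e in [seq a.1 | a <- t]] by rewrite -eqt eqC inE fG.
have : g \in [set e in [seq a.1 | a <- t]] by rewrite -eqt eqC inE gG.
rewrite !inE => /mapP[[g' d'] gt /= eqg] /mapP[[f' d] ft /= eqf]; subst f' g'.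
apply/existsP; exists d; rewrite ft /=; have [_ _ [k [k0 Hk]]] := key t f g d d' tr ft gt.
move: pos; rewrite -(pmulr_rgt0 _ k0) mulrCA -Hk /dsign.
by case: d d' r {Hk} ft gt => [] [] [] ft gt;
  rewrite // ?(mulr1, mul1r, mulN1r, mulrN1, opprK) ?ltr0N1 ?ltrN10 ?oppr_gt0 ?ltr10.
Qed.

Lemma fund_cycle_signs e y f g : e \in edges G -> e \notin T ->
  fund (dual (pair_of G)) (edges G :\: T) e y ->
  opposite_in_cycle G (fund_cycle G T e) f g =
    [&& f \in edges G, g \in edges G & y f * y g < 0] /\
  same_in_cycle G (fund_cycle G T e) f g =
    [&& f \in edges G, g \in edges G & 0 < y f * y g].
Proof.
move=> eG eT fy; have H r := fund_cycle_sign r f g eG eT fy; split.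
  by rewrite [LHS](H true) mulN1r oppr_gt0.
by rewrite [LHS](H false) mul1r.
Qed.

Lemma cut_multiple S b x : b \in T -> fund (pair_of G) T b x ->
  cut G S \subset b |: (edges G :\: T) -> cut G S != set0 ->
  exists k : rat, k != 0 /\ forall f, f \in edges G -> cut_vect G S f = k * x f.
Proof.
move=> bT' fx sub C0; have [sT _ _] := bT.
have cz t : t \in T -> t != b -> cut_vect G S t = 0.
  move=> tT tb; apply/eqP; have tG := subsetP sT t tT.
  apply: contraTT tT; rewrite cut_vect_neq0 // => /(subsetP sub).
  by rewrite !inE (negPf tb) => /andP[].
have Hc : covec (pair_of G) (cut_vect G S) := tensionP G _.
have mul := fund_multiple wG bT bT' fx Hc cz.
exists (cut_vect G S b / x b); split; last exact: mul.
have [_ xb _] := fx; rewrite mulf_neq0 ?invr_eq0 ?(gt_eqF xb) //.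
apply/negP=> /eqP cb0; case/set0Pn: C0 => f fC.
have fG : f \in edges G by move: fC; rewrite in_cut => /andP[].
by move: fC; rewrite -cut_vect_neq0 // (mul f) // cb0 !mul0r eqxx.
Qed.

Lemma fund_cocycleE b x : b \in T -> fund (pair_of G) T b x ->
  fund_cocycle G T b = [set f in edges G | x f != 0] /\
  exists S, fund_cocycle G T b = cut G S.
Proof.
move=> bT' fx; have [Hx xb x0] := fx; have [sT _ _] := bT.
have bG := subsetP sT b bT'.
have ex : exists D, graph_cocycle G D && (D \subset b |: (edges G :\: T)).
  have [|S [cS bS conf]] := conformal_cocycle Hx bG _; first by rewrite gt_eqF.
  exists (cut G S); rewrite cS; apply/subsetP=> f fS.
  have /forallP/(_ f)/implyP/(_ fS)/andP[xf _] := conf.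
  move: fS; rewrite in_cut !inE => /andP[fG _]; rewrite fG andbT.
  by case: eqVneq => //= fb; apply: contraNN xf => fT; rewrite x0.
rewrite /fund_cocycle; case: pickP => [D /andP[cD sub]|none]; last first.
  by case: ex => D; rewrite none.
rewrite /odflt /=; have [D0 [S eqD] _] := (graph_cocycleP G D).1 cD; split; last by exists S.
rewrite eqD in D0 sub *; have [k [k0 Hk]] := cut_multiple bT' fx sub D0.
apply/setP=> f; rewrite [RHS]inE; have [fG|fG] := boolP (f \in edges G); last first.
  by rewrite in_cut (negPf fG).
by rewrite -cut_vect_neq0 // Hk // mulf_eq0 (negPf k0).
Qed.

(** As for cycles, [r] selects opposite or same directions. *)
Lemma fund_cocycle_sign (r : bool) b x f g : b \in T -> fund (pair_of G) T b x ->
  let D := fund_cocycle G T b in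
  [&& f \in D, g \in D & [exists S, (D == cut G S) &&
     (r (+) ((tail G f \in S) == (tail G g \in S)))]] =
  [&& f \in edges G, g \in edges G & 0 < dsign (~~ r) * (x f * x g)].
Proof.
move=> bT' fx D; have [eqD [S0 eqS0]] := fund_cocycleE bT' fx; have [_ xb x0] := fx.
have [sT _ _] := bT; have bG := subsetP sT b bT'; rewrite -/D in eqD eqS0.
have D0 : D != set0 by apply/set0Pn; exists b; rewrite eqD inE bG gt_eqF.
have sub : D \subset b |: (edges G :\: T).
  rewrite eqD; apply/subsetP=> h; rewrite !inE => /andP[hG xh]; rewrite hG andbT.
  by case: eqVneq => //= hb; apply: contraNN xh => hT; rewrite x0.
have inD h : (h \in D) = (h \in edges G) && (x h != 0) by rewrite eqD inE.
have key S : D = cut G S -> f \in D -> g \in D -> exists k : rat, 0 < k /\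
    dsign (tail G f \in S) * dsign (tail G g \in S) = k * (x f * x g).
  move=> eqS fD gD; rewrite eqS in D0 sub fD gD.
  have [k [k0 Hk]] := cut_multiple bT' fx sub D0.
  exists (k ^+ 2); rewrite exprn_even_gt0 //; split=> //.
  have fG : f \in edges G by move: fD; rewrite in_cut => /andP[].
  have gG : g \in edges G by move: gD; rewrite in_cut => /andP[].
  by rewrite -(cut_vect_val fD) -(cut_vect_val gD) !Hk //; ring.
apply/and3P/and3P => [[fD gD /existsP[S /andP[/eqP eqS sgn]]]|[fG gG pos]].
  have [k [k0 Hk]] := key S eqS fD gD.
  move: fD gD; rewrite !inD => /andP[-> _] /andP[-> _]; split=> //.
  rewrite -(pmulr_rgt0 _ k0) mulrCA -Hk /dsign; move: sgn.
  by case: (tail G f \in S); case: (tail G g \in S); case: (r).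
have := lt0r_neq0 pos; rewrite !mulf_eq0 !negb_or => /and3P[_ xf xg].
have fD : f \in D by rewrite inD fG.
have gD : g \in D by rewrite inD gG.
split=> //; apply/existsP; exists S0; rewrite -eqS0 eqxx /=.
have [k [k0 Hk]] := key S0 eqS0 fD gD.
move: pos; rewrite -(pmulr_rgt0 _ k0) mulrCA -Hk /dsign.
by case: (tail G f \in S0); case: (tail G g \in S0); case: (r).
Qed.

Lemma fund_cocycle_signs b x f g : b \in T -> fund (pair_of G) T b x ->
  opposite_in_cocycle G (fund_cocycle G T b) f g =
    [&& f \in edges G, g \in edges G & x f * x g < 0] /\
  same_in_cocycle G (fund_cocycle G T b) f g =
    [&& f \in edges G, g \in edges G & 0 < x f * x g].
Proof.
move=> bT' fx; have H r := fund_cocycle_sign r f g bT' fx; split.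
  by rewrite [LHS](H true) mulN1r oppr_gt0.
by rewrite [LHS](H false) mul1r.
Qed.
End Fundamental.
End DigraphMinors.

(** * Fully optimal trees of a digraph *)
Section OptimalTrees.
Context {disp : Order.disp_t} {V : finType} {E : finOrderType disp}.
Implicit Types (G H : digraph V E) (A B C D F T : {set E}) (b e f g m p w : E).
Implicit Types (M : opair (E := E)) (x y : E -> rat) (S : {set V}) (u v : V) (pi : V -> rat).

Lemma conformal_graph_cycle G y e : vect (pair_of G) y -> e \in edges G -> y e != 0 ->
  exists C, [/\ graph_cycle G C, e \in C & forall f, f \in C -> f \in edges G /\ y f != 0].
Proof.
move=> Hy eG ye; have [s [cs es Hs]] := conformal_cycle Hy eG ye.
have [t [_ tr]] := traversal_exists cs; exists [set e in [seq a.1 | a <- s]].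
have /and5P[_ sG _ _ _] := cs.
split; first by [apply/existsP; exists t]; first by rewrite inE.
move=> f; rewrite inE => /mapP[a aS ->]; split; first exact: (allP sG).
by have [] := Hs a aS.
Qed.

Lemma graph_cycle_vect G C : graph_cycle G C -> exists y,
  [/\ vect (pair_of G) y, forall e, (y e != 0) = (e \in C),
      C \subset edges G & C != set0].
Proof. by case/existsP=> t /traversalP[Hy Cy _ CG C0]; exists (walk_vect t). Qed.

(** Every nonzero flow contains a cycle in its support, so forests are the sets
    that support no nonzero flow. *)
Lemma spanning_treeP G T : spanning_tree G T <-> base (pair_of G) T.
Proof.
have wG := pair_of_wf G; split=> [/maxsetP[/andP[sT /forallP ac] maxT]|bT].
  split=> //= [x Hx xT e eG|y Hy yT e eG].
    apply/eqP; apply: contraT => xe.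
    have eT : e \notin T by apply: contraNN xe => eT; rewrite xT.
    have : ~~ forest G (e |: T).
      apply: contra eT => fT; rewrite -(maxT _ fT (subsetUr _ _)).
      by rewrite !inE eqxx.
    rewrite /forest subUset sub1set eG sT /= negb_forall => /existsP[C].
    rewrite negb_imply negbK => /andP[cC sub].
    have [y [Hy Cy CG _]] := graph_cycle_vect cC.
    have eC : e \in C.
      apply: contraT => eC; have := ac C; rewrite cC /= => /negP; case.
      apply/subsetP=> f fC; have := subsetP sub f fC; rewrite !inE => /predU1P[efe|//].
      by rewrite -efe fC in eC.
    have := orth wG Hx Hy; rewrite (bigD1 e) //= big1 ?addr0 => [|f /andP[fG fe]].
      by move/eqP; rewrite mulf_eq0 (negPf xe) -[y e == 0]negbK Cy eC.
    have [fT|fT] := boolP (f \in T); first by rewrite xT // mul0r.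
    have /eqP -> : y f == 0; last by rewrite mulr0.
    rewrite -[_ == _]negbK Cy; apply: contra fT => /(subsetP sub).
    by rewrite !inE (negPf fe).
  apply/eqP; apply: contraT => ye; have [C [cC eC HC]] := conformal_graph_cycle Hy eG ye.
  have := ac C; rewrite cC /= => /negP; case; apply/subsetP=> f fC.
  have [fG yf] := HC f fC; apply: contraNT yf => fT.
  by rewrite yT // inE fT.
have [sT h h'] := bT; apply/maxsetP; split.
  rewrite /forest sT /=; apply/forallP=> C; apply/implyP=> /graph_cycle_vect[y [Hy Cy CG C0]].
  apply/negP=> sub; case/set0Pn: C0 => e eC; have := Cy e; rewrite eC.
  rewrite h' ?eqxx ?(subsetP CG) // => t; rewrite inE => /andP[tT tG].
  by apply/eqP; apply: contraNT tT; rewrite Cy => /(subsetP sub).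
move=> T' /andP[sT' /forallP ac'] sub; apply/eqP; rewrite eqEsubset sub andbT.
apply/subsetP=> e eT'; apply: contraT => eT; have eG := subsetP sT' e eT'.
have [y [Hy ye y0]] := base_cofund wG bT eG eT.
have [|C [cC eC HC]] := conformal_graph_cycle Hy eG; first by rewrite gt_eqF.
have := ac' C; rewrite cC /= => /negP; case; apply/subsetP=> f fC.
have [fG yf] := HC f fC; have [->//|fe] := eqVneq f e.
apply: (subsetP sub); apply: contraNT yf => fT; apply/eqP/y0 => //.
by rewrite inE fT.
Qed.

(** The link with the condition on the smallest element of a fundamental cycle
    or cocycle. *)
Lemma negmin_supp A x b D : 0 < x b -> D = [set f in A | x f != 0] -> b \in A ->
  negmin A x <-> exists m, is_min D m && [&& b \in A, m \in A & x b * x m < 0].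
Proof.
move=> xb eqD bS; split=> [[m [mS xm xlt]]|[m /and4P[mD _ mS neg]]].
  exists m; rewrite bS mS pmulr_rlt0 // xm !andbT; apply: is_minI.
    by rewrite eqD inE mS ltr0_neq0.
  move=> f; rewrite eqD inE => /andP[fS xf]; rewrite leNgt.
  by apply: contra xf => /(xlt _ fS) ->.
exists m; rewrite -(pmulr_rlt0 _ xb); split=> // f fS fm; apply/eqP.
apply: contraT => xf; have := is_minP mD (e := f); rewrite eqD inE fS xf leNgt fm.
by move=> /(_ isT).
Qed.

Lemma optimal_insideP G T B : base (pair_of G) T -> B \subset T ->
  optimal_inside G T B <-> forall b, b \in B ->
    exists x, fund (pair_of G) T b x /\ negmin (edges G) x.
Proof.
move=> bT sub; have wG := pair_of_wf G; have [sT _ _] := bT.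
have key b x : b \in T -> fund (pair_of G) T b x ->
    [exists m, is_min (fund_cocycle G T b) m &&
       opposite_in_cocycle G (fund_cocycle G T b) b m] <-> negmin (edges G) x.
  move=> bT' fx; have [eqD _] := fund_cocycleE bT bT' fx; have [_ xb _] := fx.
  rewrite (negmin_supp xb eqD (subsetP sT b bT')).
  split=> [/existsP[m]|[m]].
    by have [-> _] := fund_cocycle_signs bT b m bT' fx => Hm; exists m.
  have [<- _] := fund_cocycle_signs bT b m bT' fx => Hm; by apply/existsP; exists m.
split=> [/forallP H b bB|H].
  have bT' := subsetP sub b bB; have [x fx] := base_fund wG bT bT'.
  exists x; split=> //; apply/(key b x bT' fx).
  by have := H b => /implyP; apply.
apply/forallP=> b; apply/implyP=> bB; have [x [fx nx]] := H b bB.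
by apply/(key b x _ fx) => //; apply: (subsetP sub).
Qed.

Lemma optimal_outsideP G T B : base (pair_of G) T -> B \subset edges G :\: T ->
  optimal_outside G T B <-> forall e, e \in B ->
    exists y, fund (dual (pair_of G)) (edges G :\: T) e y /\ negmin (edges G) y.
Proof.
move=> bT sub; have wG := pair_of_wf G; have [sT _ _] := bT.
have key e y : e \in edges G -> e \notin T ->
    fund (dual (pair_of G)) (edges G :\: T) e y ->
    [exists m, is_min (fund_cycle G T e) m &&
       opposite_in_cycle G (fund_cycle G T e) e m] <-> negmin (edges G) y.
  move=> eG eT fy; have [eqC _] := fund_cycleE bT eG eT fy; have [_ ye _] := fy.
  rewrite (negmin_supp ye eqC eG).
  split=> [/existsP[m]|[m]].
    by have [-> _] := fund_cycle_signs bT e m eG eT fy => Hm; exists m.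
  have [<- _] := fund_cycle_signs bT e m eG eT fy => Hm; by apply/existsP; exists m.
have inB e : e \in B -> e \in edges G /\ e \notin T.
  by move/(subsetP sub); rewrite inE => /andP[].
split=> [/forallP H e eB|H].
  have [eG eT] := inB e eB; have [y fy] := base_cofund wG bT eG eT.
  exists y; split=> //; apply/(key e y eG eT fy).
  by have := H e => /implyP; apply.
apply/forallP=> e; apply/implyP=> eB; have [y [fy ny]] := H e eB.
by have [eG eT] := inB e eB; apply/(key e y eG eT fy).
Qed.

Lemma directed_cocycle_vect G D : directed_cocycle G D -> exists x,
  [/\ covec (pair_of G) x, forall e, e \in edges G -> 0 <= x e,
      forall e, e \in edges G -> (x e != 0) = (e \in D) & D \subset edges G /\ D != set0].
Proof.
case/andP=> /graph_cocycleP[D0 _ _] /existsP[S /andP[/eqP eqD /forallP tS]].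
exists (cut_vect G S); split; first exact: tensionP.
- move=> e eG; have [eD|eD] := boolP (e \in cut G S).
    rewrite cut_vect_val // /dsign; have /implyP := tS e.
    by rewrite eqD => /(_ eD) ->.
  by have /negbFE/eqP -> : (cut_vect G S e != 0) = false; rewrite // cut_vect_neq0 // (negPf eD).
- by move=> e eG; rewrite eqD cut_vect_neq0.
- split=> //; rewrite eqD; apply/subsetP=> e; by rewrite in_cut => /andP[].
Qed.

Lemma directed_cocycle_exists G x e : covec (pair_of G) x ->
  (forall f, f \in edges G -> 0 <= x f) -> e \in edges G -> x e != 0 ->
  exists D, [/\ directed_cocycle G D, e \in D & forall f, f \in D -> f \in edges G /\ x f != 0].
Proof.
move=> Hx xge eG xe; have [S [cS eS /forallP conf]] := conformal_cocycle Hx eG xe.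
have inG f : f \in cut G S -> f \in edges G by rewrite in_cut => /andP[].
exists (cut G S); split=> //.
  rewrite /directed_cocycle cS; apply/existsP; exists S; rewrite eqxx.
  apply/forallP=> f; apply/implyP=> fS.
  have /implyP/(_ fS)/andP[xf /eqP ->] := conf f.
  by rewrite lt_neqAle eq_sym xf xge // inG.
move=> f fS; split; first exact: inG.
by have /implyP/(_ fS)/andP[] := conf f.
Qed.

Lemma directed_cycle_vect G C : directed_cycle G C -> exists y,
  [/\ vect (pair_of G) y, forall e, e \in edges G -> 0 <= y e,
      forall e, e \in edges G -> (y e != 0) = (e \in C) & C \subset edges G /\ C != set0].
Proof.
case/existsP=> t /andP[tr dt]; have [Hy Cy vy CG C0] := traversalP tr.
exists (walk_vect t); split=> // e eG.
have [eC|eC] := boolP (e \in C); last first.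
  by have /negbFE/eqP -> : (walk_vect t e != 0) = false; rewrite // Cy (negPf eC).
move: eC; have /andP[_ /eqP ->] := tr; rewrite inE => /mapP[[e' d] at' /= ->].
by rewrite (vy _ _ at'); have /= -> := allP dt _ at'.
Qed.

Lemma directed_cycle_exists G y e : vect (pair_of G) y ->
  (forall f, f \in edges G -> 0 <= y f) -> e \in edges G -> y e != 0 ->
  exists C, [/\ directed_cycle G C, e \in C & forall f, f \in C -> f \in edges G /\ y f != 0].
Proof.
move=> Hy yge eG ye; have [s [cs es Hs]] := conformal_cycle Hy eG ye.
have [t [vt tr]] := traversal_exists cs; exists [set e in [seq a.1 | a <- s]].
have /and5P[_ sG _ _ _] := cs.
have pos a : a \in s -> 0 < y a.1.
  by move=> aS; have [ya _] := Hs a aS; rewrite lt_neqAle eq_sym ya yge // (allP sG).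
split.
- apply/existsP; exists t; rewrite tr vt; apply/allP=> a aS.
  by have [_ ->] := Hs a aS; rewrite pos.
- by rewrite inE.
move=> f; rewrite inE => /mapP[a aS ->]; split; first exact: (allP sG).
by have [] := Hs a aS.
Qed.

(** The link between directed cocycles and nonnegative covectors, in a form that
    applies to directed cycles and nonnegative vectors as well: each directed
    cocycle is the support of a nonnegative covector, and each element of the
    support of a nonnegative covector is in a directed cocycle within that
    support. *)
Definition directed_supports M (dir : pred {set E}) : Prop :=
  (forall D, dir D -> exists x, [/\ covec M x,
      forall e, e \in ground M -> 0 <= x e,
      forall e, e \in ground M -> (x e != 0) = (e \in D) &
      D \subset ground M /\ D != set0]) /\
  (forall x e, covec M x -> (forall f, f \in ground M -> 0 <= x f) ->
    e \in ground M -> x e != 0 ->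
    exists D, [/\ dir D, e \in D & forall f, f \in D -> f \in ground M /\ x f != 0]).

Lemma directed_cocycle_supports G : directed_supports (pair_of G) (directed_cocycle G).
Proof. by split=> [D|x e]; [exact: directed_cocycle_vect|exact: directed_cocycle_exists]. Qed.

Lemma directed_cycle_supports G : directed_supports (dual (pair_of G)) (directed_cycle G).
Proof. by split=> [D|x e]; [exact: directed_cycle_vect|exact: directed_cycle_exists]. Qed.

Lemma bip_directed M dir p : wf M -> directed_supports M dir -> bip M p ->
  [forall e in ground M, exists D, dir D && (e \in D)] &&
  [forall D, dir D ==> (p \in D)].
Proof.
move=> wM [Hd Hx] [mp [x [cx xp]] [y [Hy yp]]]; apply/andP; split.
  apply/forallP=> e; apply/implyP=> eM.
  have [f fM||D [dD eD _]] := Hx x e cx _ eM; first by rewrite ltW ?xp.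
    by rewrite gt_eqF ?xp.
  by apply/existsP; exists D; rewrite dD.
apply/forallP=> D; apply/implyP=> /Hd[z [Hz zge zD [DM D0]]].
apply: contraT => pD; case/set0Pn: D0 => e eD; have eM := subsetP DM e eD.
have z0 : z p = 0 by apply/eqP; rewrite -[_ == _]negbK zD // (is_min_in mp).
have zy f : f \in ground M -> 0 <= z f * y f.
  move=> fM; have [->|fp] := eqVneq f p; first by rewrite z0 mul0r.
  by rewrite mulr_ge0 ?zge // ltW ?yp.
have ye : 0 < y e by apply: yp => //; apply: contraNneq pD => <-.
have := orth_nonneg wM Hz Hy zy eM; move/eqP; rewrite mulf_eq0 (gt_eqF ye) orbF.
by rewrite -[_ == _]negbK zD // eD.
Qed.

Lemma fully_optimalP G T : fully_optimal G T <-> fully_opt (pair_of G) T.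
Proof.
have wG := pair_of_wf G; split.
  case/andP=> /spanning_treeP bT /existsP[p /andP[mp H]]; exists p; split=> //.
  have [sT _ _] := bT.
  have split1 : (forall b, b \in T -> b != p -> exists x,
        fund (pair_of G) T b x /\ negmin (edges G) x) ->
      (forall e, e \in edges G :\: T -> e != p -> exists y,
        fund (dual (pair_of G)) (edges G :\: T) e y /\ negmin (edges G) y) ->
      optimal (pair_of G) p T.
    move=> H1 H2; split=> // [b bT'|e eT'] /=.
      have [ebp|bp] := eqVneq b p.
        by have [x fx] := base_fund wG bT bT'; exists x.
      by have [x [fx nx]] := H1 b bT' bp; exists x.
    have [epe|ep] := eqVneq e p.
      have [y fy] := base_fund (wf_dual wG) (base_dual bT) eT'; by exists y.
    by have [y [fy ny]] := H2 e eT' ep; exists y.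
  case/orP: H => /and3P[_ /optimal_insideP Hi /optimal_outsideP Ho]; apply: split1.
  - by move=> b bT' bp; apply: Hi; rewrite ?subsetDl // !inE bp.
  - by move=> e eT' ep; apply: Ho.
  - by move=> b bT' bp; apply: Hi.
  - by move=> e eT' ep; apply: Ho; rewrite ?subsetDl // in_setD1 ep.
case=> p [mp oT]; have bT := optimal_base wG oT; have [sT h h'] := oT.
have pG := is_min_in mp.
apply/andP; split; first exact/spanning_treeP.
apply/existsP; exists p; rewrite mp; apply/orP.
have [pT|pT] := boolP (p \in T); [left|right]; apply/and3P; split.
- exact: bip_directed wG (directed_cocycle_supports G) (optimal_bip wG mp oT pT).
- apply/optimal_insideP; rewrite ?subsetDl // => b; rewrite !inE => /andP[bp bT'].
  by have [x [fx /(_ bp) nx]] := h b bT'; exists x.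
- apply/optimal_outsideP => // e eT'; have [y [fy ny]] := h' e eT'.
  exists y; split=> //; apply: ny; apply: contraTneq eT' => ->.
  by rewrite inE pT.
- exact: bip_directed (wf_dual wG) (directed_cycle_supports G) (optimal_bipd wG mp oT pT).
- apply/optimal_insideP => // b bT'; have [x [fx nx]] := h b bT'.
  by exists x; split=> //; apply: nx; apply: contraNneq pT => <-.
- apply/optimal_outsideP; rewrite ?subsetDl // => e; rewrite in_setD1 => /andP[ep eT'].
  by have [y [fy /(_ ep) ny]] := h' e eT'; exists y.
Qed.

Lemma alpha_bipolarE G T : fully_opt (pair_of G) T -> alpha_bipolar G = T.
Proof.
move=> oT; rewrite /alpha_bipolar; case: pickP => [T' /fully_optimalP oT'|none].
  exact: fully_opt_uniq (pair_of_wf G) oT' oT.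
by have := (fully_optimalP G T).2 oT; rewrite none.
Qed.

End OptimalTrees.

(** * The active partition of a digraph *)
Section ActivePartition.
Context {disp : Order.disp_t} {V : finType} {E : finOrderType disp}.
Implicit Types (G H : digraph V E) (A B C D F S T : {set E}) (a b e f g m p w : E).
Implicit Types (x y : E -> rat) (lvl : E -> int) (M : opair (E := E)) (l : int).

Lemma bounded_directed M (dir : pred {set E}) e a : directed_supports M dir ->
  e \in ground M -> bounded_covec M e a <->
  exists D, [/\ dir D, e \in D & min_ge D a].
Proof.
move=> [Hd Hx] eM; split=> [[x [cx xge xe xlt]]|[D [dD eD /existsP[m /andP[mD am]]]]].
  have [|D [dD eD sub]] := Hx x e cx xge eM; first by rewrite gt_eqF.
  exists D; split=> //; have [|m mD] := @exists_min _ _ D; first by apply/set0Pn; exists e.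
  apply/existsP; exists m; rewrite mD leNgt; apply/negP=> ma.
  by have [mM] := sub m (is_min_in mD); rewrite xlt ?eqxx.
have [x [cx xge xD [DM _]]] := Hd D dD.
exists x; split=> // [|f fM fa]; first by rewrite lt_neqAle eq_sym xD // eD xge.
apply/eqP; rewrite -[_ == _]negbK xD //; apply/negP=> fD.
by have := is_minP mD fD; rewrite leNgt (lt_le_trans fa am).
Qed.

Lemma leveling_bounded M lvl a : wf M -> leveling M lvl -> a \in ground M ->
  bounded_covec M a a <-> lvl a = (rank a).+1%:Z.
Proof.
move=> wM L aM; rewrite (leveling_char a wM L aM).
have [p [_ _ pmin [_ eqr] _]] := leveling_at L aM.
by have := pmin a aM erefl; rewrite -leq_rank; lia.
Qed.

(** The smallest elements of directed cocycles are the elements [a] that are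
    the smallest of their part. *)
Lemma active_directed M (dir : pred {set E}) lvl a : wf M -> directed_supports M dir ->
  leveling M lvl ->
  [exists D, dir D && is_min D a] = (a \in ground M) && (lvl a == (rank a).+1%:Z).
Proof.
move=> wM dM L; apply/existsP/andP => [[D /andP[dD mD]]|[aM /eqP]].
  have [x [_ _ _ [DM _]]] := dM.1 D dD.
  have aM := subsetP DM a (is_min_in mD); split=> //; apply/eqP.
  apply/(leveling_bounded wM L aM)/(bounded_directed a dM aM); exists D.
  by split=> //; [exact: is_min_in mD|apply/existsP; exists a; rewrite mD lexx].
move/(leveling_bounded wM L aM)/(bounded_directed a dM aM).
case=> D [dD aD /existsP[m /andP[mD am]]]; exists D; rewrite dD /=.
suff -> : a = m by []; by apply: le_anti; rewrite am (is_minP mD).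
Qed.

Lemma dual_activeP G lvl a : leveling (pair_of G) lvl ->
  (a \in dual_active G) = (a \in edges G) && (lvl a == (rank a).+1%:Z).
Proof.
move=> L; rewrite mem_sort mem_enum inE.
exact: active_directed (pair_of_wf G) (directed_cocycle_supports G) L.
Qed.

Lemma activeP G lvl a : leveling (pair_of G) lvl ->
  (a \in active G) = (a \in edges G) && (opp_level lvl a == (rank a).+1%:Z).
Proof.
move=> L; rewrite mem_sort mem_enum inE.
exact: active_directed (wf_dual (pair_of_wf G)) (directed_cycle_supports G)
  (leveling_dual L).
Qed.

(** There is no level strictly between those of two consecutive active
    elements, so the next step of the filtration adds one level only. *)
Lemma level_gap M lvl (s : seq E) a0 k e : leveling M lvl -> sorted <%O s ->
  (forall a, (a \in s) = (a \in ground M) && (lvl a == (rank a).+1%:Z)) ->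
  (k < size s)%N -> e \in ground M ->
  if (k.+1 < size s)%N
  then (lvl e <= (rank (nth a0 s k.+1))%:Z) = (lvl e <= (rank (nth a0 s k)).+1%:Z)
  else lvl e <= (rank (nth a0 s k)).+1%:Z.
Proof.
move=> L ss ms ks eM.
have gap : (rank (nth a0 s k)).+1%:Z < lvl e -> exists j, [/\ (k < j)%N, (j < size s)%N &
    lvl e = (rank (nth a0 s j)).+1%:Z].
  move=> lt_e; have [p [pM eqp _ [_ eqr] _]] := leveling_at L eM.
  have eqe : lvl e = (rank p).+1%:Z by lia.
  have ps : p \in s by rewrite ms pM eqp eqe eqxx.
  exists (index p s); rewrite index_mem nth_index //; split=> //.
  rewrite ltnNge; apply/negP=> le_k.
  have : (p <= nth a0 s k)%O.
    rewrite -[X in (X <= _)%O](nth_index a0 ps).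
    by rewrite (lt_sorted_leq_nth _ ss) ?inE ?index_mem.
  by rewrite -leq_rank; lia.
case: ifP => k1.
  have lt_nth i j : (i < j)%N -> (j < size s)%N -> (rank (nth a0 s i) < rank (nth a0 s j))%N.
    move=> ij js; rewrite ltn_rank (lt_sorted_ltn_nth _ ss) ?inE //.
    exact: ltn_trans js.
  have := lt_nth k k.+1 (ltnSn k) k1 => lt1.
  apply/idP/idP; last by lia.
  move=> le1; rewrite leNgt; apply/negP=> /gap[j [kj js eqe]].
  have [ekj|nkj] := eqVneq j k.+1; first by rewrite ekj in eqe; lia.
  by have := lt_nth k.+1 j _ js; lia.
rewrite leNgt; apply/negP=> /gap[j [kj js _]].
by move: k1; rewrite (leq_ltn_trans kj js).
Qed.

Lemma onth_Some (I : Type) (a0 : I) s k : (k < size s)%N -> onth s k = Some (nth a0 s k).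
Proof. by move=> ks; rewrite onthE (nth_map a0). Qed.

Definition below G lvl l := [set e in edges G | lvl e <= l].
Definition strictly_below G lvl l := [set e in edges G | lvl e < l].

(** Each part of the active partition as a pair of consecutive sets of the
    filtration, the larger one first. *)
Definition pieces G : seq ({set E} * {set E}) :=
  [seq (acyclic_filtration G k.+1, acyclic_filtration G k) | k <- iota 0 (size (dual_active G))] ++
  [seq (cyclic_filtration G k, cyclic_filtration G k.+1) | k <- iota 0 (size (active G))].

Section Leveled.
Variables (G : digraph V E) (lvl : E -> int).
Hypothesis L : leveling (pair_of G) lvl.
Let wG := pair_of_wf G.
Let L' := leveling_dual L.

Lemma sorted_active : sorted <%O (dual_active G) /\ sorted <%O (active G).
Proof.
by split; rewrite lt_sorted_uniq_le sort_uniq enum_uniq; apply: sort_sorted; apply: le_total.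
Qed.

Lemma acyclic_filtrationE a0 k : (k < size (dual_active G))%N ->
  acyclic_filtration G k = [set e in edges G | lvl e <= (rank (nth a0 (dual_active G) k))%:Z].
Proof.
move=> ks; rewrite /acyclic_filtration (onth_Some a0) //.
set a := nth _ _ _; apply/setP=> e; rewrite !inE andbC.
case eG: (e \in edges G) => //=; rewrite leNgt; congr (~~ _).
apply/bigcupP/idP => [[D /andP[dD mD] eD]|].
  by apply/(leveling_char a wG L eG)/(bounded_directed _ (directed_cocycle_supports G) eG); exists D.
move/(leveling_char a wG L eG)/(bounded_directed a (directed_cocycle_supports G) eG) => [D [dD eD mD]].
by exists D; rewrite ?dD.
Qed.

Lemma cyclic_filtrationE a0 k : (k < size (active G))%N ->
  cyclic_filtration G k =
  [set e in edges G | ~~ (opp_level lvl e <= (rank (nth a0 (active G) k))%:Z)].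
Proof.
move=> ks; rewrite /cyclic_filtration (onth_Some a0) //.
set a := nth _ _ _; apply/setP=> e; rewrite !inE -ltNge.
apply/bigcupP/andP => [[C /andP[dC mC] eC]|[eG]].
  have [x [_ _ _ [CG _]]] := directed_cycle_vect dC.
  have eG := subsetP CG e eC; split=> //.
  by apply/(leveling_char a (wf_dual wG) L' eG)/(bounded_directed _ (directed_cycle_supports G) eG); exists C.
move/(leveling_char a (wf_dual wG) L' eG)/(bounded_directed a (directed_cycle_supports G) eG) => [D [dD eD mD]].
by exists D; rewrite ?dD.
Qed.

(** The active elements, whose sorted lists index the filtration, are the smallest
    elements of the parts. *)
Lemma piecesP A B : (A, B) \in pieces G <->
  exists e, [/\ e \in edges G, A = below G lvl (lvl e) & B = strictly_below G lvl (lvl e)].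
Proof.
have [sd sa] := sorted_active.
have md a := dual_activeP a L; have ma a := activeP a L.
have acy a0 k : (k < size (dual_active G))%N ->
    let a := nth a0 (dual_active G) k in
    [/\ a \in edges G, acyclic_filtration G k.+1 = below G lvl (lvl a) &
        acyclic_filtration G k = strictly_below G lvl (lvl a)].
  move=> ks a; have : a \in dual_active G by rewrite mem_nth.
  rewrite md => /andP[aG /eqP eqa]; split=> //.
    have gap e := level_gap (e := e) a0 L sd md ks.
    have [k1|k1] := boolP (k.+1 < size (dual_active G))%N.
      rewrite (acyclic_filtrationE a0) //; apply/setP=> e; rewrite !inE.
      case eG: (e \in edges G) => //=; have := gap e eG; rewrite k1 => ->.
      by rewrite eqa.
    rewrite /acyclic_filtration onth_default; last by rewrite leqNgt.
    apply/setP=> e; rewrite !inE; case eG: (e \in edges G) => //=.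
    by have := gap e eG; rewrite (negPf k1) eqa => ->.
  rewrite (acyclic_filtrationE a0) //; apply/setP=> e; rewrite !inE eqa.
  by case: (e \in edges G) => //=; rewrite -/a; lia.
have cyc a0 k : (k < size (active G))%N ->
    let a := nth a0 (active G) k in
    [/\ a \in edges G, cyclic_filtration G k = below G lvl (lvl a) &
        cyclic_filtration G k.+1 = strictly_below G lvl (lvl a)].
  move=> ks a; have : a \in active G by rewrite mem_nth.
  rewrite ma => /andP[aG /eqP eqa]; split=> //.
    rewrite (cyclic_filtrationE a0) //; apply/setP=> e; rewrite !inE.
    case: (e \in edges G) => //=; move: eqa; rewrite /opp_level -/a; lia.
  have gap e := level_gap (e := e) a0 L' sa ma ks.
  have [k1|k1] := boolP (k.+1 < size (active G))%N.
    rewrite (cyclic_filtrationE a0) //; apply/setP=> e; rewrite !inE.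
    case eG: (e \in edges G) => //=; have := gap e eG; rewrite k1 => ->.
    by move: eqa; rewrite /opp_level -/a; lia.
  rewrite /cyclic_filtration onth_default; last by rewrite leqNgt.
  apply/setP=> e; rewrite !inE; case eG: (e \in edges G) => //=.
  have := gap e eG; rewrite (negPf k1); move: eqa; rewrite /opp_level -/a; lia.
split.
  rewrite mem_cat => /orP[] /mapP[k]; rewrite mem_iota add0n => /= ks [-> ->].
    move: (ks); case Eq: (dual_active G) => [//|a0 s] _.
    by have [aG -> ->] := acy a0 k ks; exists (nth a0 (dual_active G) k).
  move: (ks); case Eq: (active G) => [//|a0 s] _.
  by have [aG -> ->] := cyc a0 k ks; exists (nth a0 (active G) k).
case=> e [eG -> ->]; have [p [pG eqp _ [n0 eqr] _]] := leveling_at L eG.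
rewrite mem_cat -eqp; have : (0 < lvl e) || (lvl e < 0) by lia.
case/orP=> le; apply/orP; [left|right]; apply/mapP.
  have pa : p \in dual_active G by rewrite md pG; lia.
  exists (index p (dual_active G)); first by rewrite mem_iota index_mem.
  by have [|_ -> ->] := acy p (index p (dual_active G)); rewrite ?index_mem ?nth_index.
have pa : p \in active G by rewrite ma pG /opp_level; lia.
exists (index p (active G)); first by rewrite mem_iota index_mem.
by have [|_ -> ->] := cyc p (index p (active G)); rewrite ?index_mem ?nth_index.
Qed.

Lemma pair_of_level l :
  pair_of (contract (restrict G (below G lvl l)) (strictly_below G lvl l)) =
  lminor (pair_of G) lvl l.
Proof.
rewrite pair_of_contract pair_of_restrict minor_minor //.
  by apply: pair_minor_ext => e /= eG; rewrite !inE eG ?orbF //= -ltNge.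
rewrite -setI_eq0; apply/eqP/setP=> e; rewrite !inE orbF.
by case: (e \in edges G) => //=; case: ltgtP.
Qed.

Lemma active_minors_pieces :
  active_minors G = [seq contract (restrict G AB.1) AB.2 | AB <- pieces G].
Proof. by rewrite map_cat -!map_comp. Qed.

End Leveled.

Lemma in_bigcup_seq (I : eqType) (s : seq I) (F : I -> {set E}) e :
  (e \in \bigcup_(i <- s) F i) <-> exists2 i, i \in s & e \in F i.
Proof.
elim: s => [|i s IHs]; first by rewrite big_nil inE; split=> // [[]].
rewrite big_cons inE; split=> [/orP[ei|/IHs[j js ej]]|[j]].
- by exists i; rewrite ?mem_head.
- by exists j; rewrite // inE js orbT.
rewrite inE => /predU1P[->|js] ej; apply/orP; [by left|right; apply/IHs].
by exists j.
Qed.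

Lemma alphaE G T : active_basis (pair_of G) T -> alpha G = T.
Proof.
case=> lvl [L [sT H]]; rewrite /alpha (active_minors_pieces G) big_map.
have pcE e : e \in edges G ->
    alpha_bipolar (contract (restrict G (below G lvl (lvl e))) (strictly_below G lvl (lvl e))) =
    slice T lvl (lvl e).
  by move=> eG; apply: alpha_bipolarE; rewrite pair_of_level; apply: H.
apply/setP=> f; apply/idP/idP => [/in_bigcup_seq[[A B]]|fT].
  case/(piecesP L) => e [eG -> ->] /=; rewrite pcE // inE => /andP[]; by [].
have fG := subsetP sT f fT.
apply/in_bigcup_seq; exists (below G lvl (lvl f), strictly_below G lvl (lvl f)).
  by apply/(piecesP L); exists f.
by rewrite /= pcE // !inE fT eqxx.
Qed.

Lemma head_filter_map (I : eqType) (J : Type) (h : I -> J) (q : pred J) d (s : seq I) :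
  (exists2 i, i \in s & q (h i)) ->
  exists2 i, i \in s & q (h i) /\ seq.head d [seq j <- [seq h i | i <- s] | q j] = h i.
Proof.
elim: s => [|i s IHs] /= [j]; first by [].
case qi: (q (h i)); first by exists i; rewrite ?mem_head.
rewrite inE => /predU1P[->|js] qj; first by rewrite qi in qj.
have [|i' i's [qi' eqi']] := IHs; first by exists j.
by exists i'; rewrite ?inE ?i's ?orbT.
Qed.

Lemma active_minor_ofP G lvl w : leveling (pair_of G) lvl -> w \in edges G ->
  pair_of (active_minor_of G w) = lminor (pair_of G) lvl (lvl w).
Proof.
move=> L wG; rewrite /active_minor_of (active_minors_pieces G).
pose h (AB : {set E} * {set E}) := contract (restrict G AB.1) AB.2.
have inh e : (w \in edges (h (below G lvl (lvl e), strictly_below G lvl (lvl e)))) =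
    (lvl w == lvl e).
  have := pair_of_level G lvl (lvl e) => /(congr1 (fun M => w \in ground M)).
  by rewrite in_lminor /= wG.
have [|[A B] inp [wh ->]] := @head_filter_map _ _ h (fun H => w \in edges H) G (pieces G).
  exists (below G lvl (lvl w), strictly_below G lvl (lvl w)).
    by apply/(piecesP L); exists w.
  by rewrite inh.
case/(piecesP L): inp wh => e [eG -> ->]; rewrite inh => /eqP ->.
exact: pair_of_level.
Qed.

Definition level_partition S lvl : {set {set E}} * {set E} :=
  ([set [set f in S | lvl f == lvl e] | e in S], [set e in S | lvl e < 0]).

Lemma active_partitionE G lvl : leveling (pair_of G) lvl ->
  active_partition G = level_partition (edges G) lvl.
Proof.
move=> L; have wG := pair_of_wf G; congr (_, _).
  have dif e : below G lvl (lvl e) :\: strictly_below G lvl (lvl e) =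
      [set f in edges G | lvl f == lvl e].
    apply/setP=> f; rewrite !inE; case: (f \in edges G) => //=.
    by case: ltgtP.
  apply/setP=> P; transitivity (has (fun AB => P == AB.1 :\: AB.2) (pieces G)).
    rewrite inE has_cat !has_map; congr (_ || _).
      apply/imsetP/hasP => [[k _ ->]|[k]].
        by exists (k : nat); rewrite ?mem_iota /= ?eqxx.
      by rewrite mem_iota => ks /eqP ->; exists (Ordinal ks).
    apply/imsetP/hasP => [[k _ ->]|[k]].
      by exists (k : nat); rewrite ?mem_iota /= ?eqxx.
    by rewrite mem_iota => ks /eqP ->; exists (Ordinal ks).
  apply/hasP/imsetP => [[[A B] /(piecesP L)[e [eG -> ->]] /eqP ->]|[e eG ->]].
    by exists e; rewrite //= dif.
  exists (below G lvl (lvl e), strictly_below G lvl (lvl e)); last by rewrite /= dif.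
  by apply/(piecesP L); exists e.
have L' := leveling_dual L; have wG' := wf_dual wG.
apply/setP=> e; rewrite inE; apply/bigcupP/andP => [[C dC eC]|[eG lt0]].
  have [x [_ _ _ [CG C0]]] := directed_cycle_vect dC.
  have eG := subsetP CG e eC; split=> //; have [m mC] := exists_min C0.
  have /(leveling_char m wG' L' eG) : bounded_covec (dual (pair_of G)) e m.
    by apply/(bounded_directed _ (directed_cycle_supports G) eG); exists C; split=> //; apply/existsP; exists m; rewrite mC lexx.
  by rewrite /opp_level; lia.
have [p [_ eqr _]] := L e eG.
have /(leveling_char p wG' L' eG)/(bounded_directed p (directed_cycle_supports G) eG) [C [dC eC _]] :
  (rank p)%:Z < opp_level lvl e by rewrite /opp_level; lia.
by exists C.
Qed.

Lemma remove_level_partition S lvl w : remove_from_partition w (level_partition S lvl) =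
  level_partition (S :\ w) lvl.
Proof.
rewrite /remove_from_partition /level_partition /=; congr (_, _); last first.
  by apply/setP=> e; rewrite !inE andbA.
have blk e : [set f in S | lvl f == lvl e] :\ w = [set f in S :\ w | lvl f == lvl e].
  by apply/setP=> f; rewrite !inE andbA.
apply/setP=> P; rewrite !inE; apply/andP/imsetP => [[P0 /imsetP[A /imsetP[e eS ->] eqPA]]|[e]].
  move: P0; rewrite eqPA blk => /set0Pn[f]; rewrite !inE => /andP[/andP[fw fS] /eqP eqf].
  by exists f; rewrite ?inE ?fw // eqf.
rewrite !inE => /andP[ew eS] ->; split.
  by apply/set0Pn; exists e; rewrite !inE ew eS eqxx.
by apply/imsetP; exists [set f in S | lvl f == lvl e]; rewrite ?blk //; apply: imset_f.
Qed.

(** The property of levelings from which they can be recovered, given their level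
    sets and signs. *)
Definition ranked S lvl : Prop := forall e, e \in S -> exists p,
  [/\ p \in S, lvl p = lvl e, forall f, f \in S -> lvl f = lvl e -> (p <= f)%O &
      `|lvl e|%N = (rank p).+1].

Lemma leveling_ranked M lvl : leveling M lvl -> ranked (ground M) lvl.
Proof.
move=> L e eM; have [p [pM eqp pmin [_ eqr] _]] := leveling_at L eM.
by exists p.
Qed.

(** The smallest element of each part survives, as [w] is not one of them. *)
Lemma ranked_del M lvl w : wf M -> is_max (ground M) w -> ~ coloop M w ->
  ~ coloop (dual M) w -> leveling M lvl -> ranked (ground M :\ w) lvl.
Proof.
move=> wM mw nc nl L e; rewrite !inE => /andP[ew eM].
have [p [pM eqp pmin [_ eqr] _]] := leveling_at L eM.
have pw : p != w.
  have [eqw|nw] := eqVneq (lvl e) (lvl w).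
    by apply: (top_above wM mw nc nl L); rewrite -eqw.
  by apply: contraNneq nw => <-; rewrite eqp.
exists p; split; rewrite ?inE ?pw // => f; rewrite !inE => /andP[_]; exact: pmin.
Qed.

(** The level of a part is, up to sign, determined by its smallest element, and
    the sign by the cyclic flat. *)
Lemma level_partition_inj S lvl lvl' : ranked S lvl -> ranked S lvl' ->
  level_partition S lvl = level_partition S lvl' -> forall e, e \in S -> lvl e = lvl' e.
Proof.
move=> R R' [eqS eqF] e eS.
have sgn : (lvl e < 0) = (lvl' e < 0) by have /setP/(_ e) := eqF; rewrite !inE eS.
have : [set f in S | lvl f == lvl e] \in [set [set f in S | lvl f == lvl e] | e in S].
  exact: imset_f.
rewrite eqS => /imsetP[e0 e0S /setP eqB].
have eq0 : lvl' e = lvl' e0 by have := eqB e; rewrite !inE eS eqxx => /esym/eqP.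
have [p [pS eqp pmin eqr]] := R e eS; have [q [qS eqq qmin eqr']] := R' e eS.
have epq : p = q.
  apply: le_anti; apply/andP; split.
    by apply: pmin => //; apply/eqP; have := eqB q; rewrite !inE qS -eq0 eqq eqxx.
  by apply: qmin => //; apply/eqP; have := eqB p; rewrite !inE pS -eq0 eqp eqxx => /esym.
by move: sgn eqr eqr'; rewrite epq; lia.
Qed.

Lemma isthmusP G w : w \in edges G -> isthmus G w <-> coloop (pair_of G) w.
Proof.
move=> wG; split=> [/graph_cocycleP[_ [S eqS] _]|[x [Hx xw x0]]].
  exists (cut_vect G S); split; first exact: tensionP.
    by rewrite cut_vect_neq0 // -eqS inE.
  by move=> e eG ew; apply/eqP; rewrite -[_ == _]negbK cut_vect_neq0 // -eqS inE.
have [S [cS wS /forallP conf]] := conformal_cocycle Hx wG xw.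
rewrite /isthmus; suff <- : cut G S = [set w] by [].
apply/eqP; rewrite eqEsubset sub1set wS andbT; apply/subsetP=> f fS; rewrite inE.
have /implyP/(_ fS)/andP[xf _] := conf f; apply: contraNT xf => fw.
by rewrite x0 //; move: fS; rewrite in_cut => /andP[].
Qed.

Lemma loopP G w : w \in edges G -> loop G w <-> coloop (dual (pair_of G)) w.
Proof.
move=> wG; split=> [/graph_cycle_vect[y [Hy Cy _ _]]|[y [Hy yw y0]]].
  exists y; split=> //; first by rewrite Cy inE.
  by move=> e eG ew; apply/eqP; rewrite -[_ == _]negbK Cy inE.
have [C [cC wC HC]] := conformal_graph_cycle Hy wG yw.
rewrite /loop; suff <- : C = [set w] by [].
apply/eqP; rewrite eqEsubset sub1set wC andbT; apply/subsetP=> f fC; rewrite inE.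
by have [fG yf] := HC f fC; apply: contraNT yf => fw; rewrite y0.
Qed.
End ActivePartition.

(** * Deletion and contraction of the greatest edge *)
Section Main.
Context {disp : Order.disp_t} {V : finType} {E : finOrderType disp}.
Implicit Types (G H : digraph V E) (A B C D F S T : {set E}) (a b e f g m p w : E).
Implicit Types (x y : E -> rat) (lvl : E -> int) (M : opair (E := E)) (k : minor_kind).

(** Since [w] is greatest and not alone in the support, the smallest element of
    the support differs from [w], so that both signs relative to [w] correspond to
    a condition on one orientation of [w]. *)
Lemma negmin_choice S w y D : is_max S w -> 0 < y w ->
  (exists e, [/\ e \in S, e != w & y e != 0]) -> D = [set f in S | y f != 0] ->
  ((exists2 e, is_min D e & [&& e \in S, w \in S & y e * y w < 0]) <-> negmin S y) /\
  ((exists2 e, is_min D e & [&& e \in S, w \in S & 0 < y e * y w]) <->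
     negmin S (flip w (fun e => - y e))).
Proof.
move=> mw yw other eqD; have wS : w \in S by case/andP: mw.
have neg : (exists2 e, is_min D e & [&& e \in S, w \in S & y e * y w < 0]) <-> negmin S y.
  rewrite (negmin_supp yw eqD wS); split=> [[e mD /and3P[eS _ ey]]|[e /andP[mD /and3P[_ eS ey]]]];
  by exists e; rewrite ?mD ?wS ?eS //= mulrC.
split=> //; split=> [[e mD /and3P[eS _ ey]]|[m [mS xm xlt]]].
  case: (negmin_alt mw yw other) => // /neg[e' mD' /and3P[_ _ ey']].
  by move: ey'; rewrite (is_min_uniq mD' mD) ltNge ltW.
have mnw : m != w by apply: contraTneq xm => ->; rewrite /flip eqxx opprK -leNgt ltW.
rewrite flip_id // oppr_lt0 in xm.
exists m; last by rewrite mS wS mulr_gt0.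
apply: is_minI; first by rewrite eqD inE mS gt_eqF.
move=> f; rewrite eqD inE => /andP[fS yf]; rewrite leNgt; apply/negP=> fm.
by have := xlt f fS fm => /eqP; rewrite flip_eq0 oppr_eq0 (negPf yf).
Qed.

Lemma minor_pair_of G w k : pair_of (minor G w k) =
  if k is Deletion then del (pair_of G) w else con (pair_of G) w.
Proof. by case: k; rewrite ?pair_of_del ?pair_of_con. Qed.

Section Neither.
Variables (G : digraph V E) (w : E).
Hypotheses (mw : is_max (edges G) w) (ni : ~~ isthmus G w) (nlo : ~~ loop G w).

Let M := pair_of G.
Let wM : wf M := pair_of_wf G.
Let wG : w \in edges G. Proof. by case/andP: mw. Qed.
Let nc : ~ coloop M w. Proof. by move=> /(isthmusP wG); apply/negP. Qed.
Let nl : ~ coloop (dual M) w. Proof. by move=> /(loopP wG); apply/negP. Qed.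

Lemma alpha_minor k T : active_basis (if k is Deletion then del M w else con M w) T ->
  alpha (minor G w k) = T.
Proof. by move=> aT; apply: alphaE; rewrite minor_pair_of. Qed.

Lemma alpha_reorient T : active_basis (reverse M w) T -> alpha (reorient G [set w]) = T.
Proof. by move=> aT; apply: alphaE; rewrite pair_of_reverse. Qed.

(** By uniqueness of the leveling of the minor and injectivity of
    [level_partition]. *)
Lemma selectsP lvl k : leveling M lvl ->
  active_partition (minor G w k) = remove_from_partition w (active_partition G) <->
  leveling (pair_of (minor G w k)) lvl.
Proof.
move=> L; have edgesE : edges (minor G w k) = edges G :\ w by case: k.
rewrite (active_partitionE L) remove_level_partition -edgesE.
split=> [eqP|Lk]; last by rewrite (active_partitionE Lk).
have [lvl' L'] := leveling_exists (pair_of_wf (minor G w k)).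
apply: (leveling_ext _ L').
apply: (@level_partition_inj _ _ (edges (minor G w k))).
- exact: (leveling_ranked L').
- by rewrite edgesE; apply: (ranked_del wM mw nc nl L).
- by rewrite -eqP (active_partitionE L').
Qed.

Lemma minor_levelings lvl : leveling M lvl ->
  leveling (pair_of (minor G w Deletion)) lvl \/
  leveling (pair_of (minor G w Contraction)) lvl.
Proof. by move=> L; rewrite !minor_pair_of; apply: leveling_minor. Qed.

(** At least one minor inherits the leveling, and both would have the same
    partition if both did. *)
Lemma choice_by_partition :
  active_partition (contract G [set w]) <> active_partition (delete G w) ->
  let selects k := active_partition (minor G w k) =
    remove_from_partition w (active_partition G) in
  (exists! k, selects k) /\ (forall k, selects k -> assignment G w k).
Proof.
move=> neq selects; have [lvl L] := leveling_exists wM.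
have [T aT] := active_basis_exists (wf_del w wM).
have [T' aT'] := active_basis_exists (wf_con w wM).
have eT := alpha_minor (k := Deletion) aT; have eT' := alpha_minor (k := Contraction) aT'.
have excl : ~ (selects Deletion /\ selects Contraction).
  by case=> s1 s2; apply: neq; rewrite -/(minor G w Contraction) -/(minor G w Deletion) s2 s1.
have uniq k k' : selects k -> selects k' -> k = k'.
  by case: k; case: k' => // s1 s2; case: excl.
split.
  have [/selectsP s|/selectsP s] := minor_levelings L.
    by exists Deletion; split=> [|k' s']; [exact: s|apply: uniq => //; apply: s].
  by exists Contraction; split=> [|k' s']; [exact: s|apply: uniq => //; apply: s].
case=> sk.
  have Lc : leveling (con M w) lvl.
    by have := (selectsP Contraction L).1 sk; rewrite minor_pair_of.
  have nLd : ~ leveling (del M w) lvl.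
    move=> Ld; apply: excl; split=> //; apply/(selectsP Deletion L).
    by rewrite minor_pair_of.
  have [a1 a2] := con_choice wM mw nc nl L Lc nLd aT aT'.
  by split; [rewrite eT'; apply: alphaE|rewrite eT; apply: alpha_reorient].
have Ld : leveling (del M w) lvl.
  by have := (selectsP Deletion L).1 sk; rewrite minor_pair_of.
have nLc : ~ leveling (con M w) lvl.
  move=> Lc; apply: excl; split=> //; apply/(selectsP Contraction L).
  by rewrite minor_pair_of.
have [a1 a2] := del_choice wM mw nc nl L Ld nLc aT aT'.
by split; [rewrite eT; apply: alphaE|rewrite eT'; apply: alpha_reorient].
Qed.

(** One minor inherits the leveling, hence both do since they have the same
    partition; then everything takes place in the active minor of [w], where
    [both_choice] applies. *)
Lemma choice_by_optimality :
  active_partition (contract G [set w]) = active_partition (delete G w) ->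
  let Gw := active_minor_of G w in
  [/\ alpha (delete Gw w) = alpha (delete G w) :&: edges Gw,
      alpha (contract Gw [set w]) = alpha (contract G [set w]) :&: edges Gw,
      exists! k, full_optimality_choice Gw w k,
      forall k, full_optimality_choice Gw w k <-> dual_full_optimality_choice Gw w k &
      forall k, full_optimality_choice Gw w k -> assignment G w k].
Proof.
move=> eqAP Gw; have [lvl L] := leveling_exists wM.
have [T aT] := active_basis_exists (wf_del w wM).
have [T' aT'] := active_basis_exists (wf_con w wM).
have eT := alpha_minor (k := Deletion) aT; have eT' := alpha_minor (k := Contraction) aT'.
have [Ld Lc] : leveling (del M w) lvl /\ leveling (con M w) lvl.
  have := selectsP Contraction L; have := selectsP Deletion L.
  have := minor_levelings L; rewrite !minor_pair_of /= eqAP => [] [] H s1 s2.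
    by split=> //; apply/s2/s1.
  by split=> //; apply/s1/s2.
pose Mw := lminor M lvl (lvl w); have wMw : wf Mw := wf_lminor _ _ wM.
have eqMw : pair_of Gw = Mw := active_minor_ofP L wG.
have eqGw : edges Gw = ground Mw by rewrite -eqMw.
have mww : is_max (ground Mw) w := top_max (M := M) lvl mw.
have wGw : w \in ground Mw by case/andP: mww.
have [nc' nl'] := top_noloop wM mw nc nl L.
have [p [mp oT oT' bT bT']] := both_slices wM mw nc nl L Ld Lc aT aT'.
pose Tw := slice T lvl (lvl w); pose Tw' := slice T' lvl (lvl w).
have aTw : alpha (delete Gw w) = Tw by apply: alphaE; rewrite pair_of_del eqMw.
have aTw' : alpha (contract Gw [set w]) = Tw' by apply: alphaE; rewrite pair_of_con eqMw.
have sliceE T0 : T0 \subset edges G -> slice T0 lvl (lvl w) = T0 :&: edges Gw.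
  move=> sT; apply/setP=> e; rewrite eqGw in_setI in_setI in_lminor inE.
  by case eT0: (e \in T0) => //=; rewrite (subsetP sT).
have sT : T \subset edges G.
  by case: aT => l [_ [sT _]]; apply: subset_trans sT _; rewrite ground_del subsetDl.
have sT' : T' \subset edges G.
  by case: aT' => l [_ [sT' _]]; apply: subset_trans sT' _; rewrite ground_con subsetDl.
have wTw : w \notin Tw.
  by have [sTw _ _] := oT; apply/negP=> /(subsetP sTw); rewrite in_del eqxx.
have base_or N T0 : optimal N p T0 \/ optimal (reverse N w) p T0 -> wf N -> base N T0.
  case=> oT0 wN; first exact: optimal_base wN oT0.
  exact: base_reverse (optimal_base (wf_reverse w wN) oT0).
have bTw : base (pair_of Gw) Tw.
  by rewrite eqMw; apply: base_or (optimal_del_alt wMw mww nc' nl' oT) wMw.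
have bTw' : base (pair_of Gw) (w |: Tw').
  by rewrite eqMw; apply: base_or (optimal_con_alt wMw mww nc' nl' oT') wMw.
have [y fy] := fund_del_exists wMw wGw nc' oT.
have [x fx] := fund_con_exists wMw wGw nl' oT'.
have [_ yw _] := fy; have [_ xw _] := fx.
have wE : w \in edges Gw by rewrite eqGw.
have fy' : fund (dual (pair_of Gw)) (edges Gw :\: Tw) w y by rewrite eqMw eqGw.
have fx' : fund (pair_of Gw) (w |: Tw') w x by rewrite eqMw.
have wTw' : w \in w |: Tw' by rewrite !inE eqxx.
have [eqC _] := fund_cycleE bTw wE wTw fy'.
have [eqD _] := fund_cocycleE bTw' wTw' fx'.
rewrite eqGw in eqC eqD.
have [negC posC] := negmin_choice mww yw (fund_not_loop (wf_dual wMw) nl' fy) eqC.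
have [negD posD] := negmin_choice mww xw (fund_not_loop wMw nc' fx) eqD.
have sC e := fund_cycle_signs bTw e w wE wTw fy'.
have sD e := fund_cocycle_signs bTw' e w wTw' fx'.
have FC k : full_optimality_choice Gw w k <->
    if k is Deletion then negmin (ground Mw) y
    else negmin (ground Mw) (flip w (fun e => - y e)).
  rewrite /full_optimality_choice aTw; case: k.
    by rewrite -posC -eqGw; split=> [] [e mD H]; exists e => //; have [_ s] := sC e;
       rewrite ?s // -s.
  by rewrite -negC -eqGw; split=> [] [e mD H]; exists e => //; have [s _] := sC e;
     rewrite ?s // -s.
have DC k : dual_full_optimality_choice Gw w k <->
    if k is Contraction then negmin (ground Mw) x
    else negmin (ground Mw) (flip w (fun e => - x e)).
  rewrite /dual_full_optimality_choice aTw'; case: k.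
    by rewrite -negD -eqGw; split=> [] [e mD H]; exists e => //; have [s _] := sD e;
       rewrite ?s // -s.
  by rewrite -posD -eqGw; split=> [] [e mD H]; exists e => //; have [_ s] := sD e;
     rewrite ?s // -s.
have exy := negmin_flip_excl mww yw; have exx := negmin_flip_excl mww xw.
split.
- by rewrite aTw -/(minor G w Deletion) eT -sliceE.
- by rewrite aTw' -/(minor G w Contraction) eT' -sliceE.
- case: (both_choice wM mw nc nl L Ld Lc aT aT' fx fy) => [] [ny nx _ _].
    exists Deletion; split=> [|[] // /FC]; first by apply/FC.
    by move/(exy ny).
  exists Contraction; split=> [|[] // /FC]; first by apply/FC.
  by move=> ny'; case: (exy ny' ny).
- move=> k; rewrite FC DC.
  case: (both_choice wM mw nc nl L Ld Lc aT aT' fx fy) => [] [ny nx _ _]; case: k.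
  + by split=> [/(exy ny)//|nx']; case: (exx nx' nx).
  + by split.
  + by split.
  + by split=> [ny'|/(exx nx)//]; case: (exy ny' ny).
move=> k /FC; case: (both_choice wM mw nc nl L Ld Lc aT aT' fx fy) => [] [ny nx a1 a2];
  case: k => nk.
- by case: (exy ny nk).
- split; first by rewrite -/(minor G w Deletion) eT; apply: alphaE.
  by rewrite -/(minor G w Contraction) eT'; apply: alpha_reorient.
- split; first by rewrite -/(minor G w Contraction) eT'; apply: alphaE.
  by rewrite -/(minor G w Deletion) eT; apply: alpha_reorient.
- by case: (exy nk ny).
Qed.
End Neither.

Lemma alpha_isthmus G w : is_max (edges G) w -> isthmus G w ->
  alpha G = alpha (reorient G [set w]) /\ alpha G = w |: alpha (contract G [set w]).
Proof.
move=> mw; have wG : w \in edges G by case/andP: mw.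
move/(isthmusP wG) => cl; have wM := pair_of_wf G.
have [T aT] := active_basis_exists (wf_con w wM).
have eT : alpha (contract G [set w]) = T by apply: alphaE; rewrite pair_of_con.
rewrite eT (alphaE (coloop_basis wM mw cl aT)); split=> //; apply/esym/alphaE.
rewrite pair_of_reverse; apply: coloop_basis => //; first exact: wf_reverse.
  exact/coloop_reverse_iff.
by rewrite con_reverse.
Qed.

Lemma alpha_loop G w : is_max (edges G) w -> loop G w ->
  alpha G = alpha (reorient G [set w]) /\ alpha G = alpha (delete G w).
Proof.
move=> mw; have wG : w \in edges G by case/andP: mw.
move/(loopP wG) => cl; have wM := pair_of_wf G.
have [T aT] := active_basis_exists (wf_del w wM).
have eT : alpha (delete G w) = T by apply: alphaE; rewrite pair_of_del.
rewrite eT (alphaE (loop_basis wM mw cl aT)); split=> //; apply/esym/alphaE.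
rewrite pair_of_reverse; apply: (loop_basis (w := w)) => //; first exact: wf_reverse.
  by rewrite dual_reverse; apply/coloop_reverse_iff.
by rewrite del_reverse.
Qed.

Lemma alpha_empty G : edges G = set0 -> alpha G = set0.
Proof.
move=> E0; have [T aT] := active_basis_exists (pair_of_wf G).
rewrite (alphaE aT); case: aT => lvl [_ [sT _]]; apply/eqP.
by rewrite -subset0 -E0.
Qed.
End Main.

Theorem theorem6p8 (disp : Order.disp_t) (V : finType) (E : finOrderType disp)
    (G : digraph V E) (G_connected : connected_digraph G) :
  (edges G = set0 -> alpha G = set0) /\
  (forall w : E, is_max (edges G) w ->
    [/\ isthmus G w ->
          alpha G = alpha (reorient G [set w]) /\
          alpha G = w |: alpha (contract G [set w]),
        loop G w ->
          alpha G = alpha (reorient G [set w]) /\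
          alpha G = alpha (delete G w) &
        ~~ isthmus G w -> ~~ loop G w ->
        (active_partition (contract G [set w]) <>
           active_partition (delete G w) ->
         let selects k :=
           active_partition (minor G w k) =
           remove_from_partition w (active_partition G) in
         (exists! k, selects k) /\
         (forall k, selects k -> assignment G w k)) /\
        (active_partition (contract G [set w]) =
           active_partition (delete G w) ->
         let Gw := active_minor_of G w in
         [/\ alpha (delete Gw w) = alpha (delete G w) :&: edges Gw,
             alpha (contract Gw [set w]) =
               alpha (contract G [set w]) :&: edges Gw,
             exists! k, full_optimality_choice Gw w k,
             forall k, full_optimality_choice Gw w k <->
                       dual_full_optimality_choice Gw w k &
             forall k, full_optimality_choice Gw w k -> assignment G w k])]).
Proof.
split; first exact: alpha_empty.
move=> w mw; split; [exact: alpha_isthmus|exact: alpha_loop|move=> ni nlo].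
by split; [exact: choice_by_partition|exact: choice_by_optimality].
Qed.
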